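(* There is an algebra isomorphism $\mathbb C[x,y]/\langle P,Q\rangle\cong A(M(1)^+)$ sending $x\mapsto[\omega]$ and $y\mapsto[J]$, where $$P=(y+x-4x^2)(70y+908x^2-515x+27),\qquad Q=(x-1)\Bigl(x-\frac1{16}\Bigr)\Bigl(x-\frac9{16}\Bigr)(y+x-4x^2).$$ In particular $A(M(1)^+)$ is commutative.
   Context: Let $\mathfrak h=\mathbb C h$ with $\langle h,h\rangle=1$, Heisenberg algebra $[h(m),h(n)]=m\delta_{m+n,0}$. Let $M(1)=\mathbb C[h(-1),h(-2),\dots]\mathbf 1$ be the Heisenberg vertex operator algebra of central charge 1 (vacuum $\mathbf 1$, $Y(h(-1)\mathbf 1,z)=\sum_nh(n)z^{-n-1}$, vertex operators of monomials given by normally ordered products of derivatives of $h(z)$), with conformal vector $\omega=\frac12h(-1)^2\mathbf 1$. Let $\theta$ be the automorphism acting by $(-1)^k$ on monomials $h(-n_1)\cdots h(-n_k)\mathbf 1$ and $M(1)^+$ its fixed-point vertex operator subalgebra. Let $J=h(-1)^4\mathbf 1-2h(-3)h(-1)\mathbf 1+\frac32h(-2)^2\mathbf 1$. Zhu's algebra: for a vertex operator algebra $V$, homogeneous $u$ and $v\in V$ with $Y(u,z)=\sum u_nz^{-n-1}$, set $u*v=\sum_{i\ge0}\binom{\mathrm{wt}(u)}{i}u_{i-1}v$ and $u\circ v=\sum_{i\ge0}\binom{\mathrm{wt}(u)}{i}u_{i-2}v$; $O(V)$ is the span of all $u\circ v$, and $A(V)=V/O(V)$ is an associative algebra (with unit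 $[\mathbf 1]$) under the product induced by $*$; $[v]=v+O(V)$. *)

(* Defs.v *)
From HB Require Import structures.
From mathcomp Require Import all_boot all_algebra.
From mathcomp Require Import finmap.
From mathcomp.multinomials Require Import monalg.
From mathcomp Require Import reals.
From mathcomp.real_closed Require Import complex.

Import GRing.Theory Num.Theory.
Local Open Scope ring_scope.

(* The Heisenberg VOA M(1) = K[h(-1), h(-2), ...] 1, realised as the
   polynomial algebra in the variables X_k (k : nat), where X_k stands
   for h(-(k+1)); the vacuum 1 is the constant polynomial 1, and the
   monomial m stands for prod_k h(-(k+1))^(m k) 1.                     *)

Definition M1 (K : fieldType) := {malg K[cmonom nat]}.

Definition mvec (K : fieldType) (m : cmonom nat) : M1 K := << m >>.

Definition hvar (K : fieldType) (k : nat) : M1 K := mvec K (ucm k).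

Definition hderiv (K : fieldType) (k : nat) (v : M1 K) : M1 K :=
  \sum_(m <- msupp v) (v@_m * (m k)%:R) *: mvec K (divcm m (ucm k)).

(* the Heisenberg operator h(j), j in Z, on M(1):
   h(-n) = multiplication by X_(n-1) (n > 0), h(n) = n d/dX_(n-1) (n > 0),
   h(0) = 0. *)
Definition hop (K : fieldType) (j : int) (v : M1 K) : M1 K :=
  match j with
  | Posz 0 => 0
  | Posz k.+1 => k.+1%:R *: hderiv K k v
  | Negz k => hvar K k * v
  end.

(* L(0)-weight of a monomial h(-n_1)...h(-n_r) 1 : n_1 + ... + n_r *)
Definition wtm (m : cmonom nat) : nat := (\sum_(i <- finsupp m) i.+1 * m i)%N.

(* maximal weight occurring in v (used only as a truncation bound) *)
Definition wtmax (K : fieldType) (v : M1 K) : nat :=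
  (\max_(m <- msupp v) wtm m)%N.

Definition parts (m : cmonom nat) : seq nat :=
  flatten [seq nseq (m i) i.+1 | i <- enum_fset (finsupp m)].

Definition gbinom (K : fieldType) (a : int) (k : nat) : K :=
  (\prod_(i < k) ((a - i%:Z)%:~R : K)) / (k`!)%:R.

(* d^(n-1)/dz^(n-1) h(z) / (n-1)! = sum_j binom(-j-1, n-1) h(j) z^(-j-n) *)
Definition dcoef (K : fieldType) (n : nat) (j : int) : K := gbinom K (- j - 1) n.-1.

Definition irange (B : nat) : seq int := [seq i%:Z - B%:Z | i <- iota 0 (B.*2.+1)].
Fixpoint ibox (B k : nat) : seq (seq int) :=
  match k with
  | 0 => [:: [::]]
  | k.+1 => [seq j :: s | j <- irange B, s <- ibox B k]
  end.

(* normally ordered product of h(j_1), ..., h(j_r): annihilation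
   operators (j >= 0) act first, creation operators (j < 0) afterwards
   (operators within each group commute). *)
Definition nord (K : fieldType) (js : seq int) (v : M1 K) : M1 K :=
  foldr (fun (j : int) (w : M1 K) => if j < 0 then hop K j w else w)
        (foldr (fun (j : int) (w : M1 K) => if 0 <= j then hop K j w else w) v js) js.

(* Mode n of Y(h(-n_1)...h(-n_r)1, z) = : prod_i d^(n_i-1)h(z)/(n_i-1)! :
   (coefficient of z^(-n-1)), applied to v.  The formal infinite sum over
   (j_1,...,j_r) with j_1+...+j_r = n+1-(n_1+...+n_r) is truncated to the
   box |j_i| <= B, with B = wtmax v + |n| + sum n_i + 1; all terms outside
   this box vanish on v, so this is exactly the infinite sum. *)
Definition Ymon (K : fieldType) (ns : seq nat) (n : int) (v : M1 K) : M1 K :=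
  let N := sumn ns in
  let B := (wtmax K v + `|n| + N + 1)%N in
  \sum_(js <- ibox B (size ns) | \sum_(j <- js) j == n + 1 - N%:Z)
     (\prod_(p <- zip ns js) dcoef K p.1 p.2) *: nord K js v.

(* u_n v, with Y(u, z) = sum_n u_n z^(-n-1), extended linearly in u *)
Definition vmode (K : fieldType) (u : M1 K) (n : int) (v : M1 K) : M1 K :=
  \sum_(m <- msupp u) u@_m *: Ymon K (parts m) n v.

Definition omega (K : fieldType) : M1 K := 2%:R^-1 *: (hvar K 0 * hvar K 0).

Definition Jvec (K : fieldType) : M1 K :=
  hvar K 0 ^+ 4 - 2%:R *: (hvar K 2 * hvar K 0)
  + (3%:R / 2%:R) *: (hvar K 1 * hvar K 1).

Definition theta (K : fieldType) (v : M1 K) : M1 K :=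
  \sum_(m <- msupp v) ((-1) ^+ mdeg m * v@_m) *: mvec K m.

Definition inVplus (K : fieldType) (v : M1 K) : Prop := theta K v = v.

Definition homog (K : fieldType) (k : nat) (v : M1 K) : Prop :=
  forall m, m \in msupp v -> wtm m = k.

(* Zhu's products for homogeneous u of weight k *)
Definition zstar (K : fieldType) (k : nat) (u v : M1 K) : M1 K :=
  \sum_(i < k.+1) 'C(k, i)%:R *: vmode K u (i%:Z - 1) v.
Definition zcirc (K : fieldType) (k : nat) (u v : M1 K) : M1 K :=
  \sum_(i < k.+1) 'C(k, i)%:R *: vmode K u (i%:Z - 2) v.

(* u * v extended bilinearly (decomposing u into monomials, each of which
   is homogeneous) *)
Definition star (K : fieldType) (u v : M1 K) : M1 K :=
  \sum_(m <- msupp u) zstar K (wtm m) (u@_m *: mvec K m) v.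

Definition inO (K : fieldType) (v : M1 K) : Prop :=
  exists s : seq (K * nat * M1 K * M1 K),
    (forall t, t \in s -> [/\ homog K t.1.1.2 t.1.2, inVplus K t.1.2 & inVplus K t.2])
    /\ v = \sum_(t <- s) t.1.1.1 *: zcirc K t.1.1.2 t.1.2 t.2.

Definition Pol (K : fieldType) := {mpoly K[2]}.
Definition px (K : fieldType) : Pol K := << ucm (0 : 'I_2) >>.
Definition py (K : fieldType) : Pol K := << ucm (1 : 'I_2) >>.

Definition polyP (K : fieldType) : Pol K :=
  let x := px K in let y := py K in
  (y + x - 4%:R *: x ^+ 2)
  * (70%:R *: y + 908%:R *: x ^+ 2 - 515%:R *: x + 27%:R%:MP).

Definition polyQ (K : fieldType) : Pol K :=
  let x := px K in let y := py K in
  (x - 1) * (x - (16%:R^-1)%:MP) * (x - (9%:R / 16%:R)%:MP)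
  * (y + x - 4%:R *: x ^+ 2).

Definition in_idealPQ (K : fieldType) (f : Pol K) : Prop :=
  exists a b : Pol K, f = a * polyP K + b * polyQ K.

(* Main.v *)
Require Import Defs.
From HB Require Import structures.
From mathcomp Require Import all_boot all_algebra.
From mathcomp Require Import finmap.
From mathcomp.multinomials Require Import monalg.
From mathcomp Require Import reals.
From mathcomp.real_closed Require Import complex.
From mathcomp Require Import boolp ring zify.

(** The lowest weight spaces of the modules [M(1, t)] give the points
    [(t^2/2, t^4 - t^2/2)] of the parabola [y = 4 x^2 - x], while [M(1)^-] and the
    two halves of the [theta]-twisted module give the isolated points [(1, -6)],
    [(1/16, 3/128)] and [(9/16, -45/128)].  Each of these points is a linear
    functional on [M(1)] with values on monomials given by Wick's formula.  It is
    computed by hand, without modules, that [(1 + z)^(wt u) phi(Y(u, z) v)] is a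
    polynomial in [z] of degree at most [wt u + wt v] whose coefficient in that
    degree is [phi u * phi v]; thus [phi] kills [u o v] and is multiplicative
    for [*].  Conversely, modulo [O(M(1)^+)] every vector of [M(1)^+] is a
    polynomial in [omega] plus a combination of three vectors
    [h(-m-1)h(-1)1 - h(-1)^2 1], [m = 2, 4, 6], and the functionals above vanish
    together on no such nonzero combination.  Hence two vectors agree in
    [A(M(1)^+)] as soon as all the functionals agree on them, and [<P, Q>] is the
    ideal of the polynomials that vanish on the parabola and at the three points. *)

Set Implicit Arguments. Unset Strict Implicit. Unset Printing Implicit Defensive.
Import GRing.Theory Num.Theory.
Local Open Scope ring_scope.

(** * Formal power series *)

(** Each functional is a diagonal matrix coefficient between lowest weight vectors, and
    [phi(Y(u, z) v)] is the coefficient of [u] at [1 + z] following [v] at [1]. For large [z] the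
    lowest intermediate state of the right parity dominates; this is the source both of the degree
    bound and of the product [phi u * phi v]. Factors of [u] are peeled off one at a time, so odd
    [u] enter as well: they exchange two parity sectors, whose lowest weights differ by 1/2
    (twisted) or 1 (untwisted), and leave factors [(1 + z)^(N/2)] with [N] = 1 or 2.

    In the spanning part the obstacle is length two. On longer monomials, pair relations isolate the
    derivation [L(-1) + L(0)] on a single factor; on length two it acts only on the whole pair, and
    [h(-N-1)h(-1)1] with [N] even survives. A syzygy among quartic relations removes it for
    [N >= 8]; its leading coefficient vanishes at [N = 6].

    The map from [C[x, y]] is prescribed by the values of the functionals: a polynomial in [omega]
    fits the parabola and a basis dual to the three point functionals corrects the isolated
    values. *)

Record fps (K : nzRingType) := Fps { fcoef : nat -> K }.

Lemma fpsP (K : nzRingType) (f g : fps K) : fcoef f =1 fcoef g -> f = g.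
Proof. by case: f g => f [g] /= /funext ->. Qed.

HB.instance Definition _ (K : nzRingType) := gen_eqMixin (fps K).
HB.instance Definition _ (K : nzRingType) := gen_choiceMixin (fps K).

Section FpsZmod.
Variable K : nzRingType.
Implicit Types f g h : fps K.
Definition fps0 : fps K := Fps (fun=> 0).
Definition fpsN f : fps K := Fps (fun n => - fcoef f n).
Definition fpsD f g : fps K := Fps (fun n => fcoef f n + fcoef g n).
Lemma fpsDA : associative fpsD.
Proof. by move=> f g h; apply/fpsP => n /=; rewrite addrA. Qed.
Lemma fpsDC : commutative fpsD.
Proof. by move=> f g; apply/fpsP => n /=; rewrite addrC. Qed.
Lemma fps0D : left_id fps0 fpsD.
Proof. by move=> f; apply/fpsP => n /=; rewrite add0r. Qed.
Lemma fpsND : left_inverse fps0 fpsN fpsD.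
Proof. by move=> f; apply/fpsP => n /=; rewrite addNr. Qed.
HB.instance Definition _ := GRing.isZmodule.Build (fps K) fpsDA fpsDC fps0D fpsND.
End FpsZmod.

Section FpsRing.
Variable K : comNzRingType.
Implicit Types (f g h : fps K) (p : {poly K}).

Definition fps_poly p : fps K := Fps (fun n => p`_n).
Definition fps_trunc n f : {poly K} := \poly_(i < n) fcoef f i.
Definition fpsM f g : fps K :=
  Fps (fun n => \sum_(i < n.+1) fcoef f i * fcoef g (n - i)).

(** Transfers products to [{poly K}]: a coefficient sees only truncations, so the ring axioms are
    inherited from polynomials. *)
Lemma fpsM_trunc n N f g : (n < N)%N ->
  fcoef (fpsM f g) n = (fps_trunc N f * fps_trunc N g)`_n.
Proof.
move=> ltnN; rewrite coefM; apply: eq_bigr => i _; rewrite !coef_poly.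
by rewrite (leq_ltn_trans (leq_ord i) ltnN) (leq_ltn_trans (leq_subr _ _) ltnN).
Qed.

Lemma fps_truncM n N f g : (n < N)%N ->
  (fps_trunc N (fpsM f g))`_n = (fps_trunc N f * fps_trunc N g)`_n.
Proof. by move=> nN; rewrite coef_poly nN (fpsM_trunc _ _ nN). Qed.

Lemma fpsMA : associative fpsM.
Proof.
move=> f g h; apply/fpsP => n; rewrite !(fpsM_trunc _ _ (ltnSn n)).
have -> : (fps_trunc n.+1 f * fps_trunc n.+1 (fpsM g h))`_n =
  (fps_trunc n.+1 f * (fps_trunc n.+1 g * fps_trunc n.+1 h))`_n.
  rewrite !coefM; apply: eq_bigr => i _.
  by rewrite fps_truncM // ltnS leq_subr.
have -> : (fps_trunc n.+1 (fpsM f g) * fps_trunc n.+1 h)`_n =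
  (fps_trunc n.+1 f * fps_trunc n.+1 g * fps_trunc n.+1 h)`_n.
  by rewrite !coefM; apply: eq_bigr => i _; rewrite fps_truncM.
by rewrite mulrA.
Qed.

Lemma fpsMC : commutative fpsM.
Proof. by move=> f g; apply/fpsP => n; rewrite !(fpsM_trunc _ _ (ltnSn n)) mulrC. Qed.

Definition fps1 := fps_poly 1.

Lemma fps1M : left_id fps1 fpsM.
Proof.
move=> f; apply/fpsP => n /=; rewrite big_ord_recl /= coef1 /= mul1r subn0.
by rewrite big1 ?addr0 // => i _; rewrite coef1 mul0r.
Qed.

Lemma fpsMDl : left_distributive fpsM +%R.
Proof.
move=> f g h; apply/fpsP => n /=; rewrite -big_split /=.
by apply: eq_bigr => i _; rewrite mulrDl.
Qed.

Lemma fps1_neq0 : fps1 != 0.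
Proof. by apply/eqP => /(congr1 (fun f => fcoef f 0)) /= /eqP; rewrite coef1 oner_eq0. Qed.

HB.instance Definition _ :=
  GRing.Zmodule_isComNzRing.Build (fps K) fpsMA fpsMC fps1M fpsMDl fps1_neq0.

Lemma fcoefD f g n : fcoef (f + g) n = fcoef f n + fcoef g n. Proof. by []. Qed.
Lemma fcoefN f n : fcoef (- f) n = - fcoef f n. Proof. by []. Qed.
Lemma fcoef0 n : fcoef (0 : fps K) n = 0. Proof. by []. Qed.
Lemma fcoefM f g n : fcoef (f * g) n = \sum_(i < n.+1) fcoef f i * fcoef g (n - i).
Proof. by []. Qed.
Lemma fcoef_poly p n : fcoef (fps_poly p) n = p`_n. Proof. by []. Qed.

Lemma fcoef_sum I (r : seq I) (P : pred I) (F : I -> fps K) n :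
  fcoef (\sum_(i <- r | P i) F i) n = \sum_(i <- r | P i) fcoef (F i) n.
Proof. exact: (big_morph (fun f => fcoef f n) (fun f g => fcoefD f g n) (fcoef0 n)). Qed.

Lemma fps_poly_is_zmod_morphism : zmod_morphism fps_poly.
Proof. by move=> p q; apply/fpsP => n /=; rewrite coefB. Qed.
HB.instance Definition _ := GRing.isZmodMorphism.Build {poly K} (fps K) fps_poly
  fps_poly_is_zmod_morphism.
Lemma fps_poly_is_monoid_morphism : monoid_morphism fps_poly.
Proof. by split=> // p q; apply/fpsP => n /=; rewrite coefM. Qed.
HB.instance Definition _ := GRing.isMonoidMorphism.Build {poly K} (fps K) fps_poly
  fps_poly_is_monoid_morphism.

Definition fpsC (c : K) : fps K := fps_poly c%:P.
Definition fpsX : fps K := fps_poly 'X.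

Lemma fcoefCM c f n : fcoef (fpsC c * f) n = c * fcoef f n.
Proof.
rewrite fcoefM big_ord_recl /= coefC /= subn0.
by rewrite big1 ?addr0 // => i _; rewrite coefC /= mul0r.
Qed.
Lemma fcoefXnM k f n : fcoef (fpsX ^+ k * f) n = if (n < k)%N then 0 else fcoef f (n - k).
Proof.
rewrite /fpsX -rmorphXn fcoefM; case: ltnP => h.
  rewrite big1 // => i _; rewrite /= coefXn ltn_eqF ?mul0r //.
  exact: leq_ltn_trans (leq_ord i) h.
rewrite (bigD1 (inord k)) //= coefXn inordK // eqxx mul1r.
rewrite big1 ?addr0 // => i /eqP ik; rewrite coefXn.
case: eqP => e; last by rewrite mul0r.
by case: ik; apply: val_inj; rewrite /= inordK.
Qed.
Lemma fcoefXM f n : fcoef (fpsX * f) n = if n is m.+1 then fcoef f m else 0.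
Proof. by rewrite -[fpsX]expr1 fcoefXnM; case: n => // n; rewrite subn1. Qed.

Lemma fpsC_is_zmod_morphism : zmod_morphism fpsC.
Proof. by move=> a b; rewrite /fpsC polyCB rmorphB. Qed.
HB.instance Definition _ := GRing.isZmodMorphism.Build K (fps K) fpsC fpsC_is_zmod_morphism.
Lemma fpsC_is_monoid_morphism : monoid_morphism fpsC.
Proof. by split=> [|a b]; rewrite /fpsC ?rmorph1 // polyCM rmorphM. Qed.
HB.instance Definition _ := GRing.isMonoidMorphism.Build K (fps K) fpsC fpsC_is_monoid_morphism.

Lemma fpsCM a b : fpsC (a * b) = fpsC a * fpsC b. Proof. exact: rmorphM. Qed.
Lemma fpsCN a : fpsC (- a) = - fpsC a. Proof. exact: rmorphN. Qed.
Lemma fpsC_nat n : fpsC n%:R = n%:R. Proof. exact: rmorph_nat. Qed.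

Lemma fps_polyM p q : fps_poly (p * q) = fps_poly p * fps_poly q. Proof. exact: rmorphM. Qed.
Lemma fps_polyD p q : fps_poly (p + q) = fps_poly p + fps_poly q. Proof. exact: rmorphD. Qed.
Lemma fps_polyB p q : fps_poly (p - q) = fps_poly p - fps_poly q. Proof. exact: rmorphB. Qed.
Lemma fps_polyZ c p : fps_poly (c *: p) = fpsC c * fps_poly p.
Proof. by rewrite -mul_polyC fps_polyM. Qed.
Lemma fps_poly1X : fps_poly (1 + 'X) = 1 + fpsX.
Proof. by rewrite fps_polyD. Qed.

(** The Euler operator [z d/dz]. It preserves degrees, so on double series it cancels the
    denominators [(m + l).+2] of the twisted pairing. *)
Definition zd f : fps K := Fps (fun n => n%:R * fcoef f n).
Lemma fcoef_zd f n : fcoef (zd f) n = n%:R * fcoef f n. Proof. by []. Qed.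
Lemma fcoefC c n : fcoef (fpsC c) n = if n == 0 then c else 0.
Proof. by rewrite /fpsC /= coefC. Qed.
Lemma zdM f g : zd (f * g) = zd f * g + f * zd g.
Proof.
apply/fpsP => n; rewrite fcoefD !fcoefM /= mulr_sumr -big_split /=.
apply: eq_bigr => i _; rewrite -{1}(subnKC (leq_ord i)).
by rewrite natrD; ring.
Qed.
Lemma zdD f g : zd (f + g) = zd f + zd g.
Proof. by apply/fpsP => n; rewrite /= mulrDr. Qed.
Lemma zdC c : zd (fpsC c) = 0.
Proof. by apply/fpsP => -[|n] /=; rewrite ?mul0r // coefC mulr0. Qed.
Lemma zdCM c f : zd (fpsC c * f) = fpsC c * zd f.
Proof. by rewrite zdM zdC mul0r add0r. Qed.
Lemma zd1 : zd 1 = 0.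
Proof. by rewrite -[1]/(fpsC 1) zdC. Qed.
Lemma zdX : zd fpsX = fpsX.
Proof. by apply/fpsP => -[|[|n]] /=; rewrite coefX ?mul0r ?mul1r ?mulr0. Qed.
Lemma zdXn n f : zd (f ^+ n) = n%:R * f ^+ n.-1 * zd f.
Proof.
elim: n => [|n IH]; first by rewrite zd1 !mul0r.
case: n IH => [|n] IH; first by rewrite expr1 expr0 !mul1r.
by rewrite exprS zdM IH /= [in RHS]exprS -[n.+2]add1n natrD [f ^+ n.+1]exprS; ring.
Qed.

(* The series [sum_m binom(m, k) z^(m+1) F_m]. *)
Definition bshift k (F : nat -> fps K) : fps K :=
  Fps (fun n => \sum_(m < n) 'C(m, k)%:R * fcoef (F m) (n - m.+1)).

(** The factor [X ^+ m.+1] kills every term beyond [n]. One bound [M] therefore serves all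
    coefficients up to [n], and products can be compared termwise. *)
Lemma bshiftE k F n M : (n <= M)%N ->
  fcoef (bshift k F) n = fcoef (\sum_(m < M) fpsC 'C(m, k)%:R * (fpsX ^+ m.+1 * F m)) n.
Proof.
move=> nM; rewrite fcoef_sum [LHS]/=.
rewrite (big_ord_widen _ (fun m => 'C(m, k)%:R * fcoef (F m) (n - m.+1)) nM).
rewrite big_mkcond; apply: eq_bigr => m _; rewrite fcoefCM fcoefXnM ltnS.
by case: ltnP; rewrite ?mulr0.
Qed.

Lemma bshiftMr k F f : bshift k (fun m => F m * f) = bshift k F * f.
Proof.
apply/fpsP => n; rewrite (bshiftE _ _ (leqnn n)).
under eq_bigr do rewrite !mulrA.
rewrite -mulr_suml fcoefM [RHS]fcoefM.
apply: eq_bigr => i _; rewrite (bshiftE _ _ (leq_ord i)).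
by congr (fcoef _ _ * _); apply: eq_bigr => j _; rewrite mulrA.
Qed.

Lemma eq_bshift k F G : F =1 G -> bshift k F = bshift k G.
Proof. by move=> FG; apply/fpsP => n /=; apply: eq_bigr => m _; rewrite FG. Qed.

Lemma bshiftD k F G : bshift k (fun m => F m + G m) = bshift k F + bshift k G.
Proof.
by apply/fpsP => n /=; rewrite -big_split; apply: eq_bigr => m _; rewrite mulrDr.
Qed.

Lemma bshift_sum k I (r : seq I) (F : I -> nat -> fps K) :
  bshift k (fun m => \sum_(i <- r) F i m) = \sum_(i <- r) bshift k (F i).
Proof.
elim: r => [|a r IH].
  rewrite big_nil; apply/fpsP => n /=; rewrite big1 // => m _.
  by rewrite big_nil mulr0.
by rewrite big_cons -IH -bshiftD; apply: eq_bshift => m; rewrite big_cons.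
Qed.

End FpsRing.

(** * Binomial series with arbitrary exponents *)

HB.lock Definition binc (K : numFieldType) (a : K) (n : nat) : K :=
  (\prod_(i < n) (a - i%:R)) / n`!%:R.

Section Binomial.
Variable K : numFieldType.
Implicit Types (a b : K) (f g : fps K) (p : {poly K}).

Lemma factK_neq0 n : n`!%:R != 0 :> K.
Proof. by rewrite pnatr_eq0 -lt0n fact_gt0. Qed.

Lemma binc0 a : binc a 0 = 1.
Proof. by rewrite binc.unlock big_ord0 fact0 divr1. Qed.

Lemma bincS a n : n.+1%:R * binc a n.+1 = (a - n%:R) * binc a n.
Proof.
have h := factK_neq0 n; have h1 : n.+1%:R != 0 :> K by rewrite pnatr_eq0.
rewrite !binc.unlock big_ord_recr /= factS natrM.
by move: n.+1%:R n`!%:R h1 h => u w h1 h; field; rewrite h h1.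
Qed.

Lemma binc_nat m n : binc (m%:R : K) n = 'C(m, n)%:R.
Proof.
elim: n => [|n IH]; first by rewrite binc0 bin0.
have h1 : n.+1%:R != 0 :> K by rewrite pnatr_eq0.
apply: (mulfI h1); rewrite bincS IH; case: (leqP n m) => h.
  by rewrite -natrB // -!natrM mul_bin_left.
by rewrite !bin_small ?mulr0 // ltnW.
Qed.

Lemma binc_trinomial a k j :
  'C(k + j, k)%:R * binc a (k + j) = binc a k * binc (a - k%:R) j.
Proof.
rewrite !binc.unlock big_split_ord /= -(bin_fact (leq_addr j k)) addKn !natrM.
under [X in _ * X / _]eq_bigr => i _ do rewrite natrD opprD addrA.
have h1 := factK_neq0 k; have h2 := factK_neq0 j.
have h3 : 'C(k + j, k)%:R != 0 :> K by rewrite pnatr_eq0 -lt0n bin_gt0 leq_addr.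
move: k`!%:R j`!%:R h1 h2 'C(k + j, k)%:R h3 => u w h1 h2 c h3.
by field; rewrite h1 h2 h3.
Qed.

Definition bser a : fps K := Fps (binc a).

Lemma zd_bser a : (1 + fpsX K) * zd (bser a) = fpsC a * (fpsX K * bser a).
Proof.
apply/fpsP => n; rewrite mulrDl mul1r fcoefD fcoefCM !fcoefXM.
case: n => [|n]; first by rewrite /= mul0r mulr0 add0r.
by rewrite [LHS]/= bincS [fcoef _ _]/=; ring.
Qed.

(** The equation [(1 + z) z f' = a z f] is a recursion in which [n + 1] multiplies the next
    coefficient, invertible in characteristic zero. Additivity of exponents in [bser] then follows
    without Vandermonde sums. *)
Lemma zd_ode_uniq a f g : (1 + fpsX K) * zd f = fpsC a * (fpsX K * f) ->
  (1 + fpsX K) * zd g = fpsC a * (fpsX K * g) -> fcoef f 0 = fcoef g 0 -> f = g.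
Proof.
have rec h : (1 + fpsX K) * zd h = fpsC a * (fpsX K * h) ->
    forall n, n.+1%:R * fcoef h n.+1 = (a - n%:R) * fcoef h n.
  move=> H n; have : fcoef ((1 + fpsX K) * zd h) n.+1 = fcoef (fpsC a * (fpsX K * h)) n.+1.
    by rewrite H.
  rewrite mulrDl mul1r fcoefD fcoefCM !fcoefXM /= => e.
  by rewrite mulrBl -e; ring.
move=> hf hg e0; apply/fpsP; elim=> [//|n IH].
have h1 : n.+1%:R != 0 :> K by rewrite pnatr_eq0.
by apply: (mulfI h1); rewrite (rec _ hf) (rec _ hg) IH.
Qed.

Lemma zd_inj f g : zd f = zd g -> fcoef f 0 = fcoef g 0 -> f = g.
Proof.
move=> e e0; apply/fpsP => -[//|n].
have h1 : n.+1%:R != 0 :> K by rewrite pnatr_eq0.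
by apply: (mulfI h1); exact: (congr1 (fun h => fcoef h n.+1) e).
Qed.

Lemma fpsC_mulfI a f g : a != 0 -> fpsC a * f = fpsC a * g -> f = g.
Proof.
move=> a0 e; apply/fpsP => n; apply: (mulfI a0).
by rewrite -!fcoefCM e.
Qed.

Lemma fcoefM0 f g : fcoef (f * g) 0 = fcoef f 0 * fcoef g 0.
Proof. by rewrite fcoefM big_ord_recl big_ord0 addr0. Qed.

Lemma bserM a b : bser a * bser b = bser (a + b).
Proof.
apply: (@zd_ode_uniq (a + b)); last by rewrite fcoefM0 /= !binc0 mulr1.
  rewrite zdM mulrDr mulrA zd_bser [_ * (bser a * _)]mulrCA zd_bser rmorphD /=; ring.
exact: zd_bser.
Qed.

Lemma bser0 : bser 0 = 1.
Proof.
apply: (@zd_ode_uniq 0); first exact: zd_bser.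
  by rewrite zd1 rmorph0 mul0r mulr0.
by rewrite /= binc0 coef1.
Qed.

Lemma bser1 : bser 1 = 1 + fpsX K.
Proof.
apply: (@zd_ode_uniq 1); first exact: zd_bser.
  by rewrite zdD zd1 zdX rmorph1; ring.
by rewrite fcoefD /= binc0 coef1 coefX addr0.
Qed.

Lemma bser_nat n : bser n%:R = (1 + fpsX K) ^+ n.
Proof.
elim: n => [|n IH]; first by rewrite bser0.
by rewrite exprS -IH -bser1 bserM -[n.+1]add1n natrD.
Qed.

Lemma bserV a : bser a * bser (- a) = 1.
Proof. by rewrite bserM subrr bser0. Qed.

Lemma fcoef_bshiftC k (c : nat -> K) n :
  fcoef (bshift k (fun m => fpsC (c m))) n =
  if n is m.+1 then 'C(m, k)%:R * c m else 0.
Proof.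
case: n => [|n]; first by rewrite /= big_ord0.
rewrite /= big_ord_recr /= subnn coefC eqxx big1 ?add0r // => i _.
by rewrite coefC subn_eq0 leqNgt ltnS ltn_ord mulr0.
Qed.

(** On constant coefficients [bshift k] is [z^(k+1)] times [(d/dz)^k / k!], here applied to
    [(1 + z)^a]. *)
Lemma bshift_binc k a :
  bshift k (fun m => fpsC (binc a m)) =
  fpsC (binc a k) * (fpsX K ^+ k.+1 * bser (a - k%:R)).
Proof.
apply/fpsP => n; rewrite fcoef_bshiftC fcoefCM fcoefXnM.
case: n => [|n]; first by rewrite mulr0.
rewrite ltnS subSS; case: ltnP => h; first by rewrite bin_small // mul0r mulr0.
by rewrite -{1 2}(subnKC h) binc_trinomial.
Qed.

End Binomial.

(** * Contractions *)

Section Propagators.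
Variable K : numFieldType.
Implicit Types (G : nat -> nat -> K) (c : nat -> K).
Local Notation X := (fpsX K).

(* For a functional with pairings [G] and one-point values [c] on the modes, these
   are the contractions of [d^k h(z)/k!] with [h(-l-1)], with [d^k' h(z)/k'!] and
   with an external leg. *)
Definition acoef k l : K := l.+1%:R * binc (- l.+2%:R : K) k.
Definition Aser G k l : fps K :=
  fpsC (acoef k l) + X ^+ l.+1 * bshift k (fun m => fpsC (G m l)).
Definition Bser G k k' : fps K :=
  bshift k (fun m => bshift k' (fun m' => fpsC (G m m'))).
Definition Cser c k : fps K := bshift k (fun m => fpsC (c m)).

Lemma acoefS k l : k.+1%:R * acoef k.+1 l = - (k + l.+2)%:R * acoef k l.
Proof. by rewrite /acoef mulrCA bincS natrD; ring. Qed.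

Lemma bin_step m k : k.+1%:R * 'C(m, k.+1)%:R = (m%:R - k%:R) * 'C(m, k)%:R :> K.
Proof. by rewrite -!binc_nat bincS. Qed.

(** [Aser G k l] is the contraction multiplied by [z^(k+l+2)]. With this normalization [d/dz]
    becomes [zd] minus the exponent. *)
Lemma Aser_step G k l :
  fpsC k.+1%:R * Aser G k.+1 l = zd (Aser G k l) - fpsC (k + l.+2)%:R * Aser G k l.
Proof.
rewrite /Aser !mulrDr zdD zdC add0r; apply/fpsP => n.
rewrite !fcoefD fcoefN fcoefD -[fpsC k.+1%:R * fpsC _]rmorphM acoefS.
rewrite -[fpsC (k + l.+2)%:R * fpsC _]rmorphM !fcoefCM.
rewrite mulNr rmorphN fcoefN fcoef_zd !fcoefXnM !fcoef_bshiftC.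
case: ltnP => h; first by rewrite !mulr0 !add0r ?addr0 ?oppr0.
case: (n - l.+1)%N (subnKC h) => [|m] e; first by rewrite !mulr0 !add0r ?addr0 ?oppr0.
rewrite [k.+1%:R * (_ * _)]mulrA bin_step -e !natrD; ring.
Qed.

Section Twisted.
(* The two-point function of the twisted module: [GT] is the expansion at [z = w = 1]
   of [((z/w)^(1/2) + (w/z)^(1/2) - 2) / (2 (z-w)^2)], and [sT], [tT] are the
   expansions of [z^(-3/2) / 2] and [z^(-1/2)], the matrix coefficients of [h(z)]
   between the two lowest weight vectors. *)
Definition sT m : K := 2%:R^-1 * binc (- (3%:R / 2%:R)) m.
Definition tT m : K := binc (- 2%:R^-1) m.
Definition GT m l : K := sT m * sT l / (m + l).+2%:R.
Definition qT : fps K := bser 2%:R^-1.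

Lemma sTS m : m.+1%:R * sT m.+1 = - (m%:R + 3%:R / 2%:R) * sT m.
Proof. by rewrite /sT mulrCA bincS; ring. Qed.

Lemma tTS m : m.+1%:R * tT m.+1 = - (m%:R + 2%:R^-1) * tT m.
Proof. by rewrite /tT bincS; ring. Qed.

Lemma sT_tT m : sT m = (m%:R + 2%:R^-1) * tT m.
Proof.
elim: m => [|m IH]; first by rewrite /sT /tT !binc0; ring.
have h1 : m.+1%:R != 0 :> K by rewrite pnatr_eq0.
by apply: (mulfI h1); rewrite sTS [RHS]mulrCA tTS IH -[m.+1]addn1 natrD; field.
Qed.

Lemma binch_S m : m.+1%:R * binc 2%:R^-1 m.+1 = 2%:R^-1 * tT m.
Proof.
elim: m => [|m IH]; first by rewrite bincS /tT !binc0; ring.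
have h1 : m.+1%:R != 0 :> K by rewrite pnatr_eq0.
by apply: (mulfI h1); rewrite bincS mulrCA IH [RHS]mulrCA tTS -[m.+1]addn1 natrD; field.
Qed.

(** Homogeneity of the self-contraction at [1 + z]. Under [zd] the denominator of [GT] disappears
    and the double series splits into two one-variable series, each a derivative of
    [(1 + z)^(-3/2) / 2]. *)
Lemma Bser_twisted k k' :
  (1 + X) ^+ (k + k').+2 * Bser GT k k' = fpsC (GT k k') * X ^+ (k + k').+2.
Proof.
set n := (k + k').+2.
have e : Bser GT k k' = fpsC (GT k k') * (X ^+ n * bser (- n%:R)).
  apply: zd_inj; last first.
    by rewrite fcoefCM fcoefXnM /= /Bser /= big_ord0 mulr0.
  have -> : zd (Bser GT k k') = Cser sT k * Cser sT k'.
    apply/fpsP => d; rewrite fcoef_zd /Cser fcoefM big_ord_recl fcoef_bshiftC mul0r add0r.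
    rewrite mulr_sumr; apply: eq_bigr => i _; rewrite !fcoef_bshiftC.
    rewrite /=. case: (d - i.+1)%N (subnKC (ltn_ord i)) => [|j] ej.
      by rewrite !mulr0.
    have h1 : (i + j).+2%:R != 0 :> K by rewrite pnatr_eq0.
    have -> : d%:R = (i + j).+2%:R :> K by rewrite -{1}ej; congr _%:R; lia.
    by rewrite /GT add0n; move: (i + j).+2%:R h1 => w h1; field.
  have sE j : Cser sT j = fpsC (sT j) * (X ^+ j.+1 * bser (- (3%:R / 2%:R) - j%:R)).
    have -> : Cser sT j = fpsC 2%:R^-1 * bshift j (fun m => fpsC (binc (- (3%:R / 2%:R)) m)).
      rewrite mulrC -bshiftMr; apply: eq_bshift => m.
      by rewrite fpsCM mulrC.
    by rewrite bshift_binc fpsCM -!mulrA.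
  have zb : zd (bser (- n%:R)) = fpsC (- n%:R) * (X * bser (- n.+1%:R)).
    have i1 : bser (-1) * (1 + X) = 1 by rewrite -bser1 mulrC bserV.
    rewrite -[LHS]mul1r -i1 -mulrA zd_bser mulrCA [bser _ * _]mulrCA bserM.
    by rewrite -opprD -natr1 [1 + _]addrC.
  rewrite zdCM zdM zdXn zdX zb !sE.
  have -> : bser (- n%:R) = (1 + X) * bser (- n.+1%:R).
    by rewrite -bser1 bserM -natr1; congr bser; ring.
  have -> : bser (- n.+1%:R) = bser (- (3%:R / 2%:R) - k%:R) * bser (- (3%:R / 2%:R) - k'%:R) :> fps K.
    by rewrite bserM /n -[(k + k').+3]addn3 !natrD; congr bser; field.
  have -> : fpsC (sT k) * (X ^+ k.+1 * bser (- (3%:R / 2%:R) - k%:R)) *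
      (fpsC (sT k') * (X ^+ k'.+1 * bser (- (3%:R / 2%:R) - k'%:R))) =
      fpsC (sT k * sT k') * X ^+ n * (bser (- (3%:R / 2%:R) - k%:R) * bser (- (3%:R / 2%:R) - k'%:R)).
    by rewrite (fpsCM (sT k)) /n -addSn -addnS exprD; ring.
  have -> : fpsC (sT k * sT k') = fpsC (GT k k') * n%:R.
    by rewrite -fpsC_nat -fpsCM /GT /n divfK // pnatr_eq0.
  by rewrite fpsCN fpsC_nat /n !exprS; ring.
by rewrite e -bser_nat mulrCA [_ * (X ^+ n * _)]mulrCA bserV mulr1.
Qed.

Lemma Cser_binc k a b : 
  (1 + X) ^+ k.+1 * Cser (fun m => b * binc a m) k =
  fpsC (b * binc a k) * X ^+ k.+1 * bser (a + 1).
Proof.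
have -> : Cser (fun m => b * binc a m) k = fpsC b * bshift k (fun m => fpsC (binc a m)).
  by rewrite mulrC -bshiftMr; apply: eq_bshift => m; rewrite rmorphM mulrC.
rewrite bshift_binc -bser_nat fpsCM.
have -> : bser (a + 1) = bser k.+1%:R * bser (a - k%:R).
  by rewrite bserM -natr1; congr bser; ring.
by ring.
Qed.

(** For [k = 0] the contraction is [(1 + z)^(-1/2)] times a multiple of the Taylor polynomial of
    [(1 + z)^(1/2)] of degree [l + 1]; larger [k] follow by differentiation. The leading coefficient
    factors through the other lowest weight vector, as a product of two matrix coefficients of
    [h]. *)
Lemma Aser_twisted k l : exists P : {poly K},
  [/\ (1 + X) ^+ k.+1 * Aser GT k l = qT * fps_poly P,
      (size P <= (k + l).+2)%N & P`_(k + l).+1 = sT k * tT l].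
Proof.
elim: k => [|k [P [eP sP lP]]].
  pose P : {poly K} := l.+1%:R *: fps_trunc l.+2 qT.
  exists P; split; rewrite ?add0n; first last.
  - rewrite coefZ coef_poly ltnSn /= binch_S /sT binc0; ring.
  - by rewrite (leq_trans (size_scale_leq _ _)) // size_poly.
  have i1 : bser (- 2%:R^-1) * qT = 1 by rewrite mulrC bserV.
  have h32 : bser (- (3%:R / 2%:R)) * (1 + X) = bser (- 2%:R^-1) :> fps K.
    by rewrite -bser1 bserM; congr bser; field.
  have hA : Aser GT 0 l = bser (- 2%:R^-1) * fps_poly P.
    apply: zd_inj; last first.
      rewrite fcoefM0 fcoefD fcoefXnM /= coefC coefZ coef_poly /acoef !binc0 /=.
      by rewrite binc0 addr0 !mulr1 mul1r.
    have -> : zd (Aser GT 0 l) = fpsC (2%:R^-1 * sT l) * (X ^+ l.+2 * bser (- (3%:R / 2%:R))).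
      rewrite zdD zdC add0r; apply/fpsP => n; rewrite fcoefCM fcoef_zd !fcoefXnM.
      rewrite fcoef_bshiftC; case: ltnP => h; first by rewrite ltnW ?mulr0 // ltnW.
      case: (n - l.+1)%N (subnKC h) => [|m] e; first by rewrite -e addn0 ltnSn !mulr0.
      have -> : n = (l.+2 + m)%N by rewrite -e addnS addSn.
      rewrite bin0 mul1r ltnNge leq_addr /= addKn.
      have h1 : (m + l).+2%:R != 0 :> K by rewrite pnatr_eq0.
      have -> : (l.+2 + m)%:R = (m + l).+2%:R :> K by congr _%:R; lia.
      have -> : GT m l = 2^-1 * binc (- (3 / 2)) m * sT l / (m + l).+2%:R by [].
      by move: (m + l).+2%:R h1 => w h1; field.
    rewrite zdM.
    have hq : zd (bser (- 2%:R^-1)) = fpsC (- 2%:R^-1) * (X * bser (- (3%:R / 2%:R))) :> fps K.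
      have i2 : bser (-1) * (1 + X) = 1 :> fps K by rewrite -bser1 mulrC bserV.
      rewrite -[LHS]mul1r -i2 -mulrA zd_bser mulrCA [bser _ * _]mulrCA bserM.
      by congr (_ * (_ * bser _)); field.
    rewrite hq.
    (* The full series [qT] solves the homogeneous equation. Its truncation fails to do so only in
       degree [l + 2]. *)
    have key : fpsC (- 2%:R^-1) * X * fps_poly P + (1 + X) * zd (fps_poly P) =
        fpsC (2%:R^-1 * sT l) * X ^+ l.+2.
      apply/fpsP => n; rewrite -[X ^+ l.+2]mulr1 -mulrA mulrDl mul1r !fcoefD !fcoefCM.
      have cP i : fcoef (fps_poly P) i = if (i <= l.+1)%N then l.+1%:R * binc (2^-1 : K) i else 0.
        by rewrite fcoef_poly coefZ coef_poly ltnS; case: ifP; rewrite ?mulr0.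
      rewrite fcoefXnM !fcoefXM fcoef_zd cP.
      case: n => [|n]; first by rewrite ltn0Sn !mulr0 mul0r !addr0.
      rewrite fcoef_zd cP !ltnS subSS [fcoef 1 _]coef1 subn_eq0.
      case: (ltngtP n l.+1) => h.
      - rewrite -ltnS h mulr0.
        have := bincS (2^-1 : K) n => e.
        transitivity (l.+1%:R * (n.+1%:R * binc (2^-1 : K) n.+1 - (2^-1 - n%:R) * binc 2^-1 n)).
          by ring.
        by rewrite e; ring.
      - by rewrite leqNgt (ltnW h) /= !mulr0 !addr0.
      rewrite h ltnn /= mulr0 add0r mulr1 sT_tT.
      have := binch_S l => e.
      transitivity ((l.+1%:R * binc (2^-1 : K) l.+1) * (l.+1%:R - 2^-1)); first by ring.
      by rewrite e -natr1; field.
    by rewrite [LHS]mulrA -key -h32; ring.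
  rewrite expr1 hA mulrA; congr (_ * _).
  by rewrite -bser1 bserM /qT; congr bser; field.
(* [Aser_step] written for [(1 + X)^(-k-1) * qT * P], with the factor [qT] cancelled by
   [(1 + X) * zd qT = X * qT / 2]; this turns [k + 1] into [k + 1/2]. *)
pose Q : {poly K} := k.+1%:R^-1 *: ((1 + 'X) * ('X * P^`()) - (k%:R + 2^-1) *: ('X * P)
   - (k + l.+2)%:R *: ((1 + 'X) * P)).
have h1 : k.+1%:R != 0 :> K by rewrite pnatr_eq0.
exists Q; split.
- have zP : zd (fps_poly P) = fps_poly ('X * P^`()).
    by apply/fpsP => -[|n]; rewrite /= coefXM ?mul0r //= coef_deriv mulr_natl.
  have e1 := congr1 (@zd K) eP.
  rewrite zdM zdXn zdD zd1 add0r zdX zdM zP in e1.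
  have hq : (1 + X) * zd qT = fpsC 2^-1 * (X * qT) by rewrite zd_bser.
  have e2 : (1 + X) ^+ k.+2 * (fpsC k.+1%:R * Aser GT k.+1 l) =
     qT * fps_poly (k.+1%:R *: Q).
    rewrite Aser_step /Q scalerA divff // scale1r.
    have -> : (1 + X) ^+ k.+2 * (zd (Aser GT k l) - fpsC (k + l.+2)%:R * Aser GT k l) =
      (1 + X) * (k.+1%:R * (1 + X) ^+ k.+1.-1 * X * Aser GT k l + (1 + X) ^+ k.+1 * zd (Aser GT k l))
      - k.+1%:R * X * ((1 + X) ^+ k.+1 * Aser GT k l)
      - fpsC (k + l.+2)%:R * (1 + X) * ((1 + X) ^+ k.+1 * Aser GT k l).
      by rewrite /= !exprS; ring.
    rewrite e1 eP mulrDr mulrA hq !fps_polyB !fps_polyZ !fps_polyM fps_poly1X -!/X.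
    have -> : fpsC (k%:R + 2^-1) = fpsC k.+1%:R - fpsC 2^-1 :> fps K.
      by rewrite -[RHS]rmorphB; congr fpsC; rewrite -natr1; field.
    rewrite !fpsC_nat; ring.
  by apply: (fpsC_mulfI h1); rewrite mulrCA e2 fps_polyZ mulrCA.
- rewrite (leq_trans (size_scale_leq _ _)) // addSn.
  apply/leq_sizeP => j hj; rewrite !coefB !coefZ !mulrDl !mul1r !coefD !coefXM.
  have cP i : ((k + l).+2 <= i)%N -> P`_i = 0 by move=> hi; apply: (leq_sizeP _ _ sP).
  case: j hj => [//|j hj]; rewrite /= !coef_deriv !cP; try by lia.
  by rewrite !mul0rn if_same; ring.
rewrite /Q coefZ addSn !coefB !coefZ !mulrDl !mul1r !coefD !coefXM /= !coef_deriv lP.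
have -> : P`_(k + l).+2 = 0 by apply: (leq_sizeP _ _ sP).
have := sTS k => e; apply: (mulfI h1).
rewrite mulrA divff // mul1r [RHS]mulrA e mul0rn -mulr_natr -[(k + l).+1]addn1 !natrD.
by rewrite -[l.+2]addn2 natrD; field.
Qed.

End Twisted.
End Propagators.

(** * Hafnians *)

Section RemPerm.
Variables (I J : eqType).
Implicit Types (s : seq I) (x y : I).

Lemma perm_rem_map (f : I -> J) y s : y \in s ->
  perm_eq (rem (f y) (map f s)) (map f (rem y s)).
Proof.
move=> ys; rewrite -(perm_cons (f y)) -map_cons.
by rewrite -(permPl (perm_to_rem (map_f f ys))) perm_map // perm_to_rem.
Qed.

Lemma perm_rem_cons y x s : y \in s -> perm_eq (rem y (x :: s)) (x :: rem y s).
Proof.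
move=> ys /=; case: eqP => // ->; exact: perm_to_rem.
Qed.

Lemma perm_rem2 x s1 s2 : perm_eq s1 s2 -> perm_eq (rem x s1) (rem x s2).
Proof.
move=> e; have [xs|xs] := boolP (x \in s1).
  rewrite -(perm_cons x) -(permPl (perm_to_rem xs)) (permPl e).
  by apply: perm_to_rem; rewrite -(perm_mem e).
by rewrite !rem_id // -(perm_mem e).
Qed.

Lemma perm_remC x y s : perm_eq (rem x (rem y s)) (rem y (rem x s)).
Proof.
by apply/allP => z _ /=; rewrite !count_mem_rem -!subnDA addnC.
Qed.

Lemma perm_rem_catl y s t : y \in s -> perm_eq (rem y (s ++ t)) (rem y s ++ t).
Proof.
move=> ys; rewrite -(perm_cons y) -cat_cons.
have yst : y \in s ++ t by rewrite mem_cat ys.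
by rewrite -(permPl (perm_to_rem yst)) perm_cat2r perm_to_rem.
Qed.

Lemma perm_rem_catr y s t : y \in t -> perm_eq (rem y (s ++ t)) (s ++ rem y t).
Proof.
move=> yt; rewrite (permPl (perm_rem2 y (permEl (perm_catC s t)))).
by rewrite (permPl (perm_rem_catl _ yt)) (permPl (permEl (perm_catC _ _))).
Qed.

End RemPerm.

Section Hafnian.
Variables (I : eqType) (A : comPzRingType) (G : I -> I -> A).
Implicit Types (s t : seq I) (x y : I).

(** Recursion on fuel, since [rem y s'] is not a subterm of the list. *)
Fixpoint haf_rec n s : A :=
  match n, s with
  | _, [::] => 1
  | n'.+1, x :: s' => \sum_(y <- s') G x y * haf_rec n' (rem y s')
  | 0, _ => 0
  end.

Definition haf s := haf_rec (size s) s.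

Lemma haf_recE n s : (size s <= n)%N -> haf_rec n s = haf s.
Proof.
rewrite /haf => h.
suff H m : forall n1 n2 t, (size t <= m -> m <= n1 -> m <= n2 -> haf_rec n1 t = haf_rec n2 t)%N.
  exact: (H (size s)).
elim: m => [|m IH] n1 n2 [|x t] //=; rewrite ?ltnS; try by case: n1; case: n2.
move=> sz h1 h2; case: n1 h1 => // n1 h1; case: n2 h2 => // n2 h2 /=.
rewrite [LHS]big_seq [RHS]big_seq; apply: eq_bigr => y yt.
by congr (_ * _); apply: IH => //; rewrite size_rem // (leq_trans (leq_pred _)).
Qed.

Lemma haf_nil : haf [::] = 1. Proof. by []. Qed.

Lemma haf_cons x s : haf (x :: s) = \sum_(y <- s) G x y * haf (rem y s).
Proof.
rewrite {1}/haf /= big_seq [RHS]big_seq; apply: eq_bigr => y ys.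
by rewrite haf_recE // size_rem // leq_pred.
Qed.

Hypothesis Gsym : forall x y, G x y = G y x.

(** Permuting the tail is handled by induction after one expansion. The symmetry of [G] enters in
    exchanging the two leading entries. *)
Lemma haf_perm s t : perm_eq s t -> haf s = haf t.
Proof.
have [n] := ubnP (size s); elim: n s t => // n IH s t; rewrite ltnS => sz.
have cons_case x s1 t1 : (size s1 < n)%N -> perm_eq s1 t1 -> haf (x :: s1) = haf (x :: t1).
  move=> szs e; rewrite !haf_cons (perm_big t1) //= big_seq [RHS]big_seq.
  apply: eq_bigr => y yt; congr (_ * _); apply: IH; last exact: perm_rem2.
  by rewrite size_rem ?(perm_mem e) // (leq_ltn_trans (leq_pred _)).
have swap_case x y s1 : (size s1 < n.-1)%N -> haf (x :: y :: s1) = haf (y :: x :: s1).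
  move=> szs.
  (* After both leading entries are expanded, [w'] is allowed to range over all of [s1] and the
     diagonal is subtracted, which makes the double sum visibly symmetric in [a] and [b]. *)
  have expand a b : haf (a :: b :: s1) = G a b * haf s1 +
      \sum_(w <- s1) \sum_(w' <- s1) G a w * G b w' * haf (rem w' (rem w s1))
      - \sum_(w <- s1) G a w * G b w * haf (rem w (rem w s1)).
    rewrite haf_cons big_cons [rem b _]/= eqxx -addrA; congr (_ + _).
    rewrite -sumrB big_seq [RHS]big_seq; apply: eq_bigr => w ws.
    rewrite (IH _ (b :: rem w s1)); last exact: perm_rem_cons.
      rewrite haf_cons (perm_big _ (perm_to_rem ws)) /= big_cons addrAC subrr add0r mulr_sumr.
      by apply: eq_bigr => w' _; rewrite mulrA.
    rewrite (perm_size (perm_rem_cons b ws)) /= size_rem //.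
    by lia.
  have remC w w' : haf (rem w (rem w' s1)) = haf (rem w' (rem w s1)).
    apply: IH; last exact: perm_remC.
    rewrite (leq_ltn_trans (size_subseq (rem_subseq _ _))) //.
    rewrite (leq_ltn_trans (size_subseq (rem_subseq _ _))) //.
    by rewrite (leq_trans szs) // leq_pred.
  rewrite !expand Gsym; congr (_ + _ - _).
    rewrite exchange_big /=; apply: eq_bigr => w _; apply: eq_bigr => w' _.
    by rewrite [G x _ * _]mulrC remC.
  by apply: eq_bigr => w _; rewrite [G x _ * _]mulrC.
case: s sz => [|x s1] sz; first by move=> e; have := perm_size e; case: t e.
case: t => [|y t1] e; first by have := perm_size e.
have [xy|xy] := eqVneq x y.
  by rewrite xy; apply: cons_case => //; rewrite -(perm_cons x) {2}xy.
have ys1 : y \in s1.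
  by have := perm_mem e y; rewrite !inE eqxx eq_sym (negPf xy).
have e1 := perm_to_rem ys1.
rewrite (cons_case _ _ _ _ e1) // swap_case.
  apply: cons_case; first by rewrite /= size_rem //; case: (s1) ys1 sz.
  rewrite -(perm_cons y) -(permPr e) perm_sym -[y :: x :: _]/([:: y] ++ [:: x] ++ _).
  by rewrite perm_sym perm_catCA /= perm_cons perm_sym.
by rewrite size_rem //; move: sz => /=; case: (s1) ys1 => //= c s2 _; lia.
Qed.
End Hafnian.

Section HafnianMap.
Variables (I J : eqType) (A B : comPzRingType) (G : I -> I -> A) (H : J -> J -> B).
Hypothesis Gsym : forall x y, G x y = G y x.
Variables (phi : {rmorphism A -> B}) (f : J -> I) (w : J -> B).

(** Every entry lies in exactly one pair of a perfect matching, so its weight comes out exactly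
    once. *)
Lemma haf_map (s : seq J) :
  {in s &, forall x y, H x y = w x * w y * phi (G (f x) (f y))} ->
  haf H s = \prod_(x <- s) w x * phi (haf G (map f s)).
Proof.
have [n] := ubnP (size s); elim: n s => // n IH [_ _|x s].
  by rewrite big_nil !haf_nil rmorph1 mulr1.
rewrite ltnS => sz HG; rewrite map_cons !haf_cons big_map big_cons rmorph_sum mulr_sumr.
apply: eq_big_seq => y ys.
rewrite HG ?inE ?eqxx ?ys ?orbT // rmorphM (perm_big _ (perm_to_rem ys)) big_cons /=.
rewrite IH ?size_rem //.
- by rewrite (haf_perm Gsym (perm_rem_map f ys)); ring.
- by rewrite (leq_ltn_trans (leq_pred _)).
by move=> a b /mem_rem ha /mem_rem hb; apply: HG; rewrite inE ?ha ?hb orbT.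
Qed.
End HafnianMap.

(** * Monomials as lists of modes *)

Section LinearExtension.
Variables (K : fieldType) (M : choiceType) (V : lmodType K) (F : M -> V).

Definition linext (v : {malg K[M]}) : V := \sum_(m <- msupp v) v@_m *: F m.

Lemma linextEw (d : {fset M}) v : (msupp v `<=` d)%fset ->
  linext v = \sum_(m <- d) v@_m *: F m.
Proof.
move=> le; rewrite /linext [LHS](big_fset_incl _ le) // => x _ /mcoeff_outdom ->.
by rewrite scale0r.
Qed.

Lemma linext_is_linear : linear linext.
Proof.
move=> a u v; pose d := (msupp u `|` msupp v)%fset.
rewrite (@linextEw d) ?(@linextEw d u) ?(@linextEw d v) ?fsubsetUl ?fsubsetUr //.
  rewrite scaler_sumr -big_split; apply: eq_bigr => m _ /=.
  by rewrite mcoeffD mcoeffZ scalerDl scalerA.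
apply: (fsubset_trans (msuppD_le _ _)).
by apply: fsetSU; apply: msuppZ_le.
Qed.
HB.instance Definition _ := GRing.isLinear.Build K {malg K[M]} V *:%R linext linext_is_linear.

Lemma linextU m : linext << m >> = F m.
Proof. by rewrite (linextEw (d := [fset m]%fset)) ?msuppU_le // big_seq_fset1 mcoeffUU scale1r. Qed.

Lemma linextZ a v : linext (a *: v) = a *: linext v.
Proof. exact: linearZ. Qed.
End LinearExtension.

Lemma linext_sum (K : fieldType) (M : choiceType) (V : lmodType K) (I : Type) (r : seq I)
    (c : I -> K) (F : I -> M -> V) v :
  \sum_(i <- r) c i *: linext (F i) v = linext (fun m => \sum_(i <- r) c i *: F i m) v.
Proof.
rewrite /linext; under eq_bigr do rewrite scaler_sumr.
rewrite exchange_big; apply: eq_bigr => m _; rewrite scaler_sumr.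
by apply: eq_bigr => i _; rewrite !scalerA mulrC.
Qed.

Lemma eq_linext_in (K : fieldType) (M : choiceType) (V : lmodType K) (F G : M -> V) v :
  {in msupp v, F =1 G} -> linext F v = linext G v.
Proof. by move=> FG; apply: eq_big_seq => m mv; rewrite FG. Qed.

(* Modes are 0-based: [mon K [:: k1; ...; kr]] is [h(-k1-1)...h(-kr-1)1].  The
   constants are locked because their conversion checks are very expensive. *)
HB.lock Definition mons (s : seq nat) : cmonom nat := \big[mmul/mone]_(k <- s) ucm k.
HB.lock Definition mon (K : numFieldType) (s : seq nat) : M1 K := mvec K (mons s).

Section Lists.
Variable K : numFieldType.
Implicit Types (s t u : seq nat) (m : cmonom nat) (v w : M1 K).
Local Notation mon := (mon K).

Lemma malg_basis v : v = \sum_(m <- msupp v) v@_m *: mvec K m.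
Proof.
rewrite {1}[v]monalgE; apply: eq_bigr => m _.
by rewrite /mvec; refine (proj1 (malgP _ _) _) => k; rewrite mcoeffU mcoeffZ mcoeffU1 mulr_natr.
Qed.

Lemma eq_linext (V : lmodType K) (f g : {linear M1 K -> V}) :
  (forall m, f (mvec K m) = g (mvec K m)) -> f =1 g.
Proof.
move=> fg v; rewrite [v]malg_basis !linear_sum; apply: eq_bigr => m _.
by rewrite !linearZ /= fg.
Qed.

Definition mlist m : seq nat := flatten [seq nseq (m i) i | i <- enum_fset (finsupp m)].
Definition wt s : nat := (\sum_(k <- s) k.+1)%N.

Lemma mons_nil : mons [::] = mone. Proof. by rewrite mons.unlock big_nil. Qed.
Lemma mons_cons a s : mons (a :: s) = mmul (ucm a) (mons s).
Proof. by rewrite mons.unlock big_cons. Qed.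

Lemma monsE s k : mons s k = count_mem k s.
Proof.
elim: s => [|a s IH]; first by rewrite mons_nil cm1.
by rewrite mons_cons cmM IH cmU.
Qed.

Lemma count_mlist m k : count_mem k (mlist m) = m k.
Proof.
rewrite /mlist count_flatten -map_comp sumnE big_map /=.
under eq_bigr => i _ do rewrite count_nseq /=.
have [km|km] := boolP (k \in finsupp m).
  rewrite (bigD1_seq k) //= ?eqxx ?mul1n ?fset_uniq // big1 ?addn0 // => i ik.
  by rewrite (negPf ik).
rewrite big1_seq => [|i /= im]; first by apply/esym/eqP; rewrite cmE_eq0.
by case: eqP im km => [->|//] ->.
Qed.

Lemma mlistK m : mons (mlist m) = m.
Proof. by apply/eqP/cmP => k; rewrite monsE count_mlist. Qed.

Lemma monsK s : perm_eq (mlist (mons s)) s.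
Proof. by apply/allP => k _ /=; rewrite count_mlist monsE. Qed.

Lemma mons_perm s t : perm_eq s t -> mons s = mons t.
Proof. rewrite mons.unlock; exact: perm_big. Qed.

Lemma mon_perm s t : perm_eq s t -> mon s = mon t.
Proof. by rewrite mon.unlock => /mons_perm ->. Qed.

Lemma mon_mlist m : mon (mlist m) = mvec K m.
Proof. by rewrite mon.unlock mlistK. Qed.

Lemma mon_nil : mon [::] = 1.
Proof. by rewrite mon.unlock mons_nil. Qed.

Lemma mon_cons k s : mon (k :: s) = hvar K k * mon s.
Proof.
rewrite !mon.unlock /hvar /mvec mons_cons malgM_def fgmulUU; congr (<< _ *g _ >>).
by rewrite mulr1.
Qed.

Lemma wt_perm s t : perm_eq s t -> wt s = wt t.
Proof. exact: perm_big. Qed.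

Lemma wt_cons k s : wt (k :: s) = (k.+1 + wt s)%N.
Proof. by rewrite /wt big_cons. Qed.

Lemma wt_rem k s : k \in s -> (wt (rem k s) + k.+1)%N = wt s.
Proof. by move=> ks; rewrite (wt_perm (perm_to_rem ks)) wt_cons addnC. Qed.

Lemma ltn_wt k s : k \in s -> (k < wt s)%N.
Proof. by move=> /wt_rem <-; rewrite addnS ltnS leq_addl. Qed.

Lemma big_mlist m (F : nat -> nat) :
  (\sum_(k <- mlist m) F k = \sum_(k <- finsupp m) F k * m k)%N.
Proof.
rewrite /mlist big_flatten big_map; apply: eq_bigr => k _.
by rewrite big_nseq iter_addn_0.
Qed.

Lemma wtmE m : wtm m = wt (mlist m).
Proof. by rewrite /wt big_mlist. Qed.

Lemma mdeg_mlist m : mdeg m = size (mlist m).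
Proof. by rewrite -sum1_size big_mlist; apply: eq_bigr => k _; rewrite mul1n. Qed.

Lemma partsE m : parts m = map S (mlist m).
Proof.
rewrite /parts /mlist map_flatten -map_comp; congr flatten; apply: eq_map => i /=.
by rewrite map_nseq.
Qed.

Lemma sumn_mapS s : sumn (map S s) = wt s.
Proof. by rewrite sumnE big_map. Qed.

Lemma divcm_mons k s : k \in s -> divcm (mons s) (ucm k) = mons (rem k s).
Proof.
move=> ks; apply/eqP/cmP => i; rewrite divcmE !monsE ucmE count_mem_rem.
by [].
Qed.

Lemma hderivE k v :
  hderiv K k v = linext (fun m => (m k)%:R *: mvec K (divcm m (ucm k))) v.
Proof. by apply: eq_bigr => m _; rewrite scalerA. Qed.

Lemma hderiv_mon k s : hderiv K k (mon s) = (count_mem k s)%:R *: mon (rem k s).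
Proof.
rewrite hderivE {1}mon.unlock linextU monsE; case: (boolP (k \in s)) => ks.
  by rewrite mon.unlock (divcm_mons ks).
by rewrite (count_memPn ks) mulr0n [LHS](scale0r (mvec K _)) [RHS](scale0r (mon _)).
Qed.

Lemma hop_is_linear j : linear (hop K j).
Proof.
move=> a u w; case: j => [[|k]|k] /=; first by rewrite scaler0 addr0.
  by rewrite !hderivE linearP scalerDr !scalerA mulrC.
by rewrite mulrDr -scalerAr.
Qed.
HB.instance Definition _ j := GRing.isLinear.Build K (M1 K) (M1 K) *:%R (hop K j) (hop_is_linear j).

Lemma linext_mvec (V : lmodType K) (F : cmonom nat -> V) m : linext F (mvec K m) = F m.
Proof. exact: linextU. Qed.

Lemma linext_mon (V : lmodType K) (F : cmonom nat -> V) s : linext F (mon s) = F (mons s).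
Proof. by rewrite mon.unlock linext_mvec. Qed.

Lemma hop_pos_mon k s :
  hop K (Posz k.+1) (mon s) = (k.+1%:R * (count_mem k s)%:R) *: mon (rem k s).
Proof. by rewrite [LHS](congr1 ( *:%R k.+1%:R) (hderiv_mon k s)) scalerA. Qed.

Lemma hop0 v : hop K (Posz 0) v = 0. Proof. by []. Qed.

Lemma hopZ j a v : hop K j (a *: v) = a *: hop K j v.
Proof. exact: linearZ. Qed.

Lemma hop_sum j I (r : seq I) (P : pred I) (F : I -> M1 K) :
  hop K j (\sum_(i <- r | P i) F i) = \sum_(i <- r | P i) hop K j (F i).
Proof. exact: linear_sum. Qed.

Lemma hop_comm (i j : nat) v :
  hop K (Posz i) (hop K (Posz j) v) = hop K (Posz j) (hop K (Posz i) v).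
Proof.
pose f a b : {linear M1 K -> M1 K} := hop K (Posz a) \o hop K (Posz b).
have H : f i j =1 f j i; last exact: (H v).
apply: eq_linext => m; rewrite -mon_mlist; set s := mlist m.
change (hop K (Posz i) (hop K (Posz j) (mon s)) = hop K (Posz j) (hop K (Posz i) (mon s))).
clear f; case: i => [|i]; first by rewrite !hop0 linear0.
case: j => [|j]; first by rewrite !hop0 linear0.
rewrite !hop_pos_mon !hopZ !hop_pos_mon !scalerA (mon_perm (perm_remC j i s)).
rewrite !count_mem_rem; have [->|ij] := eqVneq i j; first by [].
rewrite !subn0; set a := _%:R; set b := _%:R; set c := _%:R; set d := _%:R.
by rewrite (_ : a * b * (c * d) = c * d * (a * b)) // mulrC.
Qed.

End Lists.

(** * Vertex operators *)

Arguments hop : simpl never.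

Lemma big_ord_widen_if (V : nmodType) n B (F : nat -> V) : (n <= B)%N ->
  \sum_(m < n) F m = \sum_(m < B) if (m < n)%N then F m else 0.
Proof. by move=> nB; rewrite (big_ord_widen _ F nB) big_mkcond. Qed.

Section Modes.
Variable K : numFieldType.
Implicit Types (s t u : seq nat) (m : cmonom nat) (v w : M1 K) (js : seq int).
Local Notation mon := (mon K).

Lemma scaler_congr (a b : K) v w : a = b -> v = w -> a *: v = b *: w.
Proof. by move=> -> ->. Qed.

Definition annih js v := foldr (fun (j : int) w => if 0 <= j then hop K j w else w) v js.
Definition creat js v := foldr (fun (j : int) w => if j < 0 then hop K j w else w) v js.

Lemma nordE js v : nord K js v = creat js (annih js v). Proof. by []. Qed.

Lemma annih_is_linear js : linear (annih js).
Proof.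
elim: js => [|j js IH] a u w //=; rewrite -/(annih js u) -/(annih js w) -/(annih js _) IH.
by case: ifP => // _; rewrite linearP.
Qed.
Lemma creat_is_linear js : linear (creat js).
Proof.
elim: js => [|j js IH] a u w //=; rewrite -/(creat js u) -/(creat js w) -/(creat js _) IH.
by case: ifP => // _; rewrite linearP.
Qed.
Lemma nord_is_linear js : linear (nord K js).
Proof. by move=> a u w; rewrite !nordE annih_is_linear creat_is_linear. Qed.
HB.instance Definition _ js :=
  GRing.isLinear.Build K (M1 K) (M1 K) *:%R (nord K js) (nord_is_linear js).

Lemma annih_hop (j : nat) js v : annih js (hop K (Posz j) v) = hop K (Posz j) (annih js v).
Proof.
elim: js => [|i js IH]; first by [].
rewrite /annih /= -/(annih js v) -/(annih js _) IH.
by case: i => [i|i]; [exact: hop_comm|].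
Qed.

(** Annihilation operators commute with one another, so the first one may be moved to the innermost
    place. *)
Lemma nord_cons (j : int) js v :
  nord K (j :: js) v = if j < 0 then hop K j (nord K js v) else nord K js (hop K j v).
Proof.
rewrite !nordE /annih /creat /= -/(annih js v) -/(creat js _).
by case: j => [j|j]; [rewrite /= -annih_hop|].
Qed.

(** [Ymon] with the truncation bound and the sum of the indices as free parameters: the bound must
    stay fixed while factors are peeled off. *)
Definition bsum (B : nat) (ns : seq nat) (tau : int) v : M1 K :=
  \sum_(js <- ibox B (size ns) | \sum_(j <- js) j == tau)
     (\prod_(p <- zip ns js) dcoef K p.1 p.2) *: nord K js v.

Lemma bsum_is_linear B ns tau : linear (bsum B ns tau).
Proof.
move=> a u w; rewrite /bsum scaler_sumr -big_split; apply: eq_bigr => js _ /=.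
by rewrite linearP scalerDr !scalerA mulrC.
Qed.
HB.instance Definition _ B ns tau :=
  GRing.isLinear.Build K (M1 K) (M1 K) *:%R (bsum B ns tau) (bsum_is_linear B ns tau).

Lemma bsum_nil B tau v : bsum B [::] tau v = if tau == 0 then v else 0.
Proof.
rewrite /bsum /= big_cons !big_nil eq_sym; case: (tau == 0); last by [].
by rewrite addr0 scale1r.
Qed.

Lemma bsum_cons B n ns tau v : bsum B (n :: ns) tau v =
  \sum_(j <- irange B) dcoef K n j *:
    (if j < 0 then hop K j (bsum B ns (tau - j) v) else bsum B ns (tau - j) (hop K j v)).
Proof.
rewrite [LHS]big_mkcond.
have -> : ibox B (size (n :: ns)) = [seq (j : int) :: js | j <- irange B, js <- ibox B (size ns)] by [].
rewrite big_allpairs_dep; apply: eq_bigr => j _.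
have -> : (if j < 0 then hop K j (bsum B ns (tau - j) v) else bsum B ns (tau - j) (hop K j v))
  = \sum_(js <- ibox B (size ns) | \sum_(i <- js) i == tau - j)
     (\prod_(p <- zip ns js) dcoef K p.1 p.2) *: nord K (j :: js) v.
  case: (boolP (j < 0)) => hj.
    by rewrite /bsum hop_sum; apply: eq_bigr => js _; rewrite hopZ nord_cons hj.
  by apply: eq_bigr => js _; rewrite nord_cons (negPf hj).
rewrite scaler_sumr [RHS]big_mkcond; apply: eq_bigr => js _.
rewrite big_cons (_ : (j + \sum_(i <- js) i == tau) = (\sum_(i <- js) i == tau - j));
  last by rewrite [RHS]eq_sym subr_eq addrC eq_sym.
case: (_ == _ - _); last by [].
rewrite scalerA (_ : \prod_(p <- zip (n :: ns) (j :: js)) dcoef K p.1 p.2 =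
  dcoef K n j * \prod_(p <- zip ns js) dcoef K p.1 p.2); last by rewrite [zip _ _]/= big_cons.
by [].
Qed.

Lemma big_irange B (V : nmodType) (F : int -> V) :
  \sum_(j <- irange B) F j =
  \sum_(m < B) F (Negz m) + (F 0 + \sum_(l < B) F (Posz l.+1)).
Proof.
have e : B.*2.+1 = (B + (1 + B))%N by lia.
rewrite /irange big_map e !iotaD !big_cat /= add0n addn1 big_seq1 subrr.
have i0 : iota 0 B = index_iota 0 B by rewrite /index_iota subn0.
rewrite i0 big_mkord (reindex_inj rev_ord_inj) /=.
congr (_ + (_ + _)).
  by apply: eq_bigr => i _; congr F; have := ltn_ord i; lia.
have -> : iota B.+1 B = [seq (B.+1 + i)%N | i <- iota 0 B] by rewrite -iotaDl addn0.
rewrite big_map i0 big_mkord.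
by apply: eq_bigr => i _; congr F; lia.
Qed.

(* The weight [n] component of [Y(mon u, 1) (mon s)]: each factor of [u] either
   creates a mode or is contracted with a factor of [s]. *)
Fixpoint Yt u (n : nat) s : M1 K :=
  match u with
  | [::] => if n == wt s then mon s else 0
  | k :: u' => \sum_(m < n) 'C(m, k)%:R *: (hvar K m * Yt u' (n - m.+1) s) +
               \sum_(l <- s) acoef K k l *: Yt u' n (rem l s)
  end.

Definition YtZ u (n : int) s : M1 K := if n is Posz n' then Yt u n' s else 0.

Lemma gbinomE (a : int) k : gbinom K a k = binc (a%:~R : K) k.
Proof.
by rewrite binc.unlock /gbinom; congr (_ / _); apply: eq_bigr => i _; rewrite rmorphB.
Qed.

Lemma sum_count (V : lmodType K) B s (F : nat -> V) : {in s, forall l, (l < B)%N} ->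
  \sum_(l < B) (count_mem (nat_of_ord l) s)%:R *: F l = \sum_(l <- s) F l.
Proof.
elim: s => [|a s IH] h.
  by rewrite big_nil big1 // => i _; rewrite scale0r.
rewrite big_cons -IH; last by move=> l ls; apply: h; rewrite inE ls orbT.
have aB : (a < B)%N by apply: h; rewrite inE eqxx.
rewrite (eq_bigr (fun l : 'I_B => (a == l)%:R *: F l + (count_mem (nat_of_ord l) s)%:R *: F l)).
  rewrite big_split /= (bigD1 (Ordinal aB)) //= eqxx scale1r big1 ?addr0 // => i ia.
  by rewrite (_ : (a == i) = false) ?scale0r //; apply: contraNF ia => /eqP e; apply/eqP/val_inj.
by move=> l _; rewrite -scalerDl -natrD.
Qed.

Lemma bsumE B u s (tau : int) : (wt s <= B)%N -> (wt s)%:Z - tau <= B%:Z ->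
  bsum B (map S u) tau (mon s) = YtZ u ((wt s)%:Z - tau) s.
Proof.
elim: u s tau => [|k u IH] s tau sB tB.
  rewrite bsum_nil; case: eqP => [->|ne]; first by rewrite subr0 /= eqxx.
  case E: (_ - tau) => [n|n] //=; case: eqP => // e; case: ne; move: E; rewrite -e; lia.
rewrite [map _ _]/= bsum_cons big_irange.
have -> : 0 < 0 :> int = false by [].
rewrite hop0 linear0 scaler0 add0r.
have dneg (m : nat) : dcoef K k.+1 (Negz m) = 'C(m, k)%:R.
  by rewrite /dcoef gbinomE -binc_nat; congr binc; rewrite NegzE opprK -addn1 PoszD addrK.
have dpos l : l.+1%:R * dcoef K k.+1 (Posz l.+1) = acoef K k l.
  rewrite /acoef /dcoef gbinomE; congr (_ * binc _ _).
  by rewrite -opprD rmorphN /= -(PoszD l.+1 1) addn1.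
have e2 : \sum_(l < B) dcoef K k.+1 (Posz l.+1) *:
   (if Posz l.+1 < 0 then hop K (Posz l.+1) (bsum B (map S u) (tau - Posz l.+1) (mon s))
    else bsum B (map S u) (tau - Posz l.+1) (hop K (Posz l.+1) (mon s))) =
  \sum_(l <- s) acoef K k l *: YtZ u ((wt s)%:Z - tau) (rem l s).
  rewrite -(@sum_count _ B) => [|l ls]; last exact: leq_trans (ltn_wt ls) sB.
  apply: eq_bigr => l _ /=; rewrite hop_pos_mon linearZ /= scalerA.
  have [ls|ls] := boolP (nat_of_ord l \in s); last first.
    by rewrite (count_memPn ls) mulr0n !mulr0 !scale0r.
  have e := wt_rem ls.
  rewrite IH; [|lia..]; rewrite scalerA -dpos.
  have -> : (wt (rem (nat_of_ord l) s))%:Z - (tau - Posz l.+1) = (wt s)%:Z - tau by lia.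
  by apply: scaler_congr => [|//]; ring.
have e1 : \sum_(m < B) dcoef K k.+1 (Negz m) *:
   (if Negz m < 0 then hop K (Negz m) (bsum B (map S u) (tau - Negz m) (mon s))
    else bsum B (map S u) (tau - Negz m) (hop K (Negz m) (mon s))) =
  \sum_(m < B) 'C(m, k)%:R *: (hvar K m * YtZ u ((wt s)%:Z - tau - m.+1%:Z) s).
  apply: eq_bigr => m _; rewrite dneg (_ : Negz m < 0 = true); last by [].
  rewrite (IH _ _ sB); last by lia.
  by apply: (congr1 (fun n => _ *: (_ * YtZ u n s))); lia.
etransitivity; first exact: (congr2 +%R e1 e2).
clear e1 e2.
case E: (_ - tau) => [n|n] /=; last first.
  rewrite big1 => [|m _]; last by rewrite mulr0 scaler0.
  by rewrite add0r big1 // => m _; rewrite scaler0.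
apply: (congr2 +%R); last by [].
have nB : (n <= B)%N by move: tB; rewrite E; lia.
pose F (m : nat) : M1 K := 'C(m, k)%:R *: (hvar K m * Yt u (n - m.+1) s).
refine (etrans _ (esym (big_ord_widen_if F nB))).
apply: eq_bigr => m _; case: (ltnP m n) => h.
  by rewrite (_ : Posz n - Posz m.+1 = Posz (n - m.+1)); last by lia.
by rewrite (_ : Posz n - Posz m.+1 = Negz (m - n)) ?mulr0 ?scaler0; last by lia.
Qed.

End Modes.

(** * Zhu's products on monomials *)

Section Products.
Variable K : numFieldType.
Implicit Types (s t : seq nat) (v w : M1 K).
Local Notation mon := (mon K).
Local Notation Yt := (Yt K).
Local Notation YtZ := (YtZ K).

Lemma wtm_le v (m : cmonom nat) : m \in msupp v -> (wtm m <= wtmax K v)%N.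
Proof. by move=> mv; rewrite /wtmax; apply: (leq_bigmax_seq (F := wtm)). Qed.

Lemma YmonE u n v : Ymon K (map S u) n v =
  linext (fun m => YtZ u ((wt (mlist m) + wt u)%:Z - n - 1) (mlist m)) v.
Proof.
rewrite /Ymon sumn_mapS; set B := (_ + 1)%N.
rewrite -/(bsum B (map S u) (n + 1 - (wt u)%:Z) v).
have hB : (wtmax K v + `|n| + wt u < B)%N by rewrite /B; lia.
move: B hB => B hB; rewrite {1}[v]malg_basis linear_sum; apply: eq_big_seq => m mv.
have h := wtm_le mv; rewrite wtmE in h.
rewrite linearZ; apply: scaler_congr; first by [].
rewrite -mon_mlist; refine (etrans (bsumE _ _ _ _) _); [by lia..|].
by apply: (congr1 (fun x => YtZ u x (mlist m))); lia.
Qed.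

Lemma vmodeE (u : M1 K) n v : vmode K u n v =
  linext (fun a => linext (fun b =>
    YtZ (mlist a) ((wt (mlist b) + wt (mlist a))%:Z - n - 1) (mlist b)) v) u.
Proof. by apply: eq_bigr => m _; rewrite partsE YmonE. Qed.

(** The mode [u_n v] has weight [wt u + wt v - n - 1]; the target weights are those of [n = i - 2]
    here and of [n = i - 1] in [cstar]. *)
Definition circ u s : M1 K :=
  \sum_(i < (wt u).+1) 'C(wt u, i)%:R *: Yt u ((wt u + wt s).+1 - i) s.
Definition cstar u s : M1 K :=
  \sum_(i < (wt u).+1) 'C(wt u, i)%:R *: Yt u (wt u + wt s - i) s.

Lemma zcircE k (u v : M1 K) : homog K k u ->
  zcirc K k u v = linext (fun a => linext (fun b => circ (mlist a) (mlist b)) v) u.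
Proof.
move=> hu; rewrite /zcirc.
under [LHS]eq_bigr => i _ do rewrite vmodeE.
refine (etrans (linext_sum _ _ _ _) _); apply: eq_linext_in => a au.
refine (etrans (linext_sum _ _ _ _) _); apply: eq_linext_in => b bv.
have := hu _ au; rewrite wtmE => <-; apply: eq_bigr => i _.
apply: scaler_congr; first by [].
rewrite (_ : _ - _ - 1 = Posz ((wt (mlist a) + wt (mlist b)).+1 - i)); first by [].
by have := ltn_ord i; lia.
Qed.

Lemma zstarE k (u v : M1 K) : homog K k u ->
  zstar K k u v = linext (fun a => linext (fun b => cstar (mlist a) (mlist b)) v) u.
Proof.
move=> hu; rewrite /zstar.
under [LHS]eq_bigr => i _ do rewrite vmodeE.
refine (etrans (linext_sum _ _ _ _) _); apply: eq_linext_in => a au.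
refine (etrans (linext_sum _ _ _ _) _); apply: eq_linext_in => b bv.
have := hu _ au; rewrite wtmE => <-; apply: eq_bigr => i _.
apply: scaler_congr; first by [].
rewrite (_ : _ - _ - 1 = Posz (wt (mlist a) + wt (mlist b) - i)); first by [].
by have := ltn_ord i; lia.
Qed.

Lemma homog_mvec (a : K) m : homog K (wtm m) (a *: mvec K m).
Proof.
move=> m' /(fsubsetP (msuppZ_le _ _)); rewrite msuppU1 in_fset1 => /eqP ->.
by [].
Qed.

Lemma starE (u v : M1 K) :
  star K u v = linext (fun a => linext (fun b => cstar (mlist a) (mlist b)) v) u.
Proof.
apply: eq_bigr => a _; rewrite zstarE; last exact: homog_mvec.
by rewrite linextZ linext_mvec.
Qed.

End Products.

(** * Gaussian functionals *)

Section Correlators.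
Variables (K : numFieldType) (G : nat -> nat -> K) (leg : bool -> nat -> K).
Hypothesis Gsym : forall k l, G k l = G l k.
Local Notation mon := (mon K).
Local Notation Yt := (Yt K).
Local Notation X := (fpsX K).
Local Notation I := (nat + bool)%type.
Local Notation T := (nat + (nat + I))%type.
Implicit Types (u sv s : seq nat) (J : seq I) (v w : M1 K).

Definition cov (x y : I) : K :=
  match x, y with
  | inl k, inl l => G k l
  | inl k, inr e | inr e, inl k => leg e k
  | inr e, inr e' => (e != e')%:R
  end.

Lemma cov_sym x y : cov x y = cov y x.
Proof. by case: x y => [k|e] [l|e'] //=; rewrite eq_sym. Qed.

(* [inl k] is the mode [h(-k-1)] and [inr e] one of the two external legs; a list [J]
   collects the legs, and the modes already absorbed in the functional. *)
Definition gs J v : K := linext (V := K^o) (fun m => haf cov (map inl (mlist m) ++ J)) v.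

Lemma gs_mon J s : gs J (mon s) = haf cov (map inl s ++ J).
Proof.
rewrite /gs linext_mon; apply: (haf_perm cov_sym).
by rewrite perm_cat2r perm_map // monsK.
Qed.

Lemma gs_linear J : linear (gs J : M1 K -> K^o).
Proof. by move=> a v w; rewrite /gs linearP. Qed.
HB.instance Definition _ J :=
  GRing.isLinear.Build K (M1 K) K^o *:%R (gs J) (gs_linear J).

Lemma gsX J k v : gs J (hvar K k * v) = gs (inl k :: J) v.
Proof.
have h1 : linear ((fun v => gs J (hvar K k * v)) : M1 K -> K^o).
  by move=> a x y; rewrite mulrDr -scalerAr linearP.
pose L1 : GRing.isLinear K (M1 K) K^o *:%R (fun v => gs J (hvar K k * v)) :=
  GRing.isLinear.Build K (M1 K) K^o *:%R _ h1.
pose f : {linear M1 K -> K^o} := HB.pack (fun v : M1 K => gs J (hvar K k * v) : K^o) L1.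
have H : f =1 gs (inl k :: J); last exact: (H v).
apply: (@eq_linext K K^o f (gs (inl k :: J))) => m.
rewrite -mon_mlist; change (gs J (hvar K k * mon (mlist m)) = gs (inl k :: J) (mon (mlist m))).
rewrite -mon_cons !gs_mon; apply: (haf_perm cov_sym).
by rewrite /= -[inl k :: J]/([:: inl k] ++ J) perm_sym perm_catCA.
Qed.

(** The three summands of [T] are factors of [u], modes of [v], and legs or absorbed modes. The
    power [X ^+ l.+1] records the weight of a mode of [v]; for a factor of [u] the powers are built
    into [bshift]. *)
Definition covS (x y : T) : fps K :=
  match x, y with
  | inl k, inl k' => Bser G k k'
  | inl k, inr (inl l) | inr (inl l), inl k => Aser G k l
  | inl k, inr (inr z) | inr (inr z), inl k => Cser (fun m => cov (inl m) z) k
  | inr (inl l), inr (inl l') => X ^+ (l.+1 + l'.+1) * fpsC (G l l')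
  | inr (inl l), inr (inr z) | inr (inr z), inr (inl l) => X ^+ l.+1 * fpsC (cov (inl l) z)
  | inr (inr z), inr (inr z') => fpsC (cov z z')
  end.

Hypothesis Bser_sym : forall k k', Bser G k k' = Bser G k' k.

Lemma covS_sym x y : covS x y = covS y x.
Proof.
case: x y => [k|[l|z]] [k'|[l'|z']] //=; first by rewrite Gsym addnC.
by rewrite cov_sym.
Qed.

Definition slist u sv J : seq T :=
  map inl u ++ map (inr \o inl) sv ++ map (inr \o inr) J.

Definition shaf u sv J : fps K := haf covS (slist u sv J).

Lemma shaf_nil sv J : shaf [::] sv J = X ^+ (wt sv) * fpsC (haf cov (map inl sv ++ J)).
Proof.
pose w (x : T) : fps K := if x is inr (inl l) then X ^+ l.+1 else 1.
pose f (x : T) : I := match x with inl k => inl k | inr (inl l) => inl l | inr (inr z) => z end.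
rewrite /shaf (haf_map cov_sym (phi := @fpsC K) (f := f) (w := w)).
  rewrite /slist /= big_cat !big_map /= [X in _ * X * _]big1 // mulr1 map_cat -!map_comp.
  by rewrite -(big_morph _ (exprD X) (expr0 X)) map_id_in.
have ns x : x \in slist [::] sv J -> if x is inl _ then False else True.
  by rewrite /slist /= mem_cat => /orP [] /mapP [z _ ->].
move=> x y /ns hx /ns hy; case: x y hx hy => [//|[l|z]] [//|[l'|z']] _ _ /=.
- by rewrite exprD.
- by rewrite mulr1.
- by rewrite mul1r cov_sym.
- by rewrite !mul1r.
Qed.

Lemma slist_rem_u k u sv J : k \in u ->
  perm_eq (rem (inl k) (slist u sv J)) (slist (rem k u) sv J).
Proof.
move=> ku; rewrite /slist (permPl (perm_rem_catl _ (map_f inl ku))) perm_cat2r.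
exact: perm_rem_map.
Qed.

Lemma slist_rem_v l u sv J : l \in sv ->
  perm_eq (rem (inr (inl l)) (slist u sv J)) (slist u (rem l sv) J).
Proof.
move=> lv; have h := map_f (inr \o inl : nat -> T) lv.
rewrite /slist (permPl (perm_rem_catr _ _)); last by rewrite mem_cat h.
by rewrite perm_cat2l (permPl (perm_rem_catl _ h)) perm_cat2r; exact: (perm_rem_map (inr \o inl)).
Qed.

Lemma slist_rem_J x u sv J : x \in J ->
  perm_eq (rem (inr (inr x)) (slist u sv J)) (slist u sv (rem x J)).
Proof.
move=> xJ; have h := map_f (inr \o inr : I -> T) xJ.
rewrite /slist (permPl (perm_rem_catr _ _)); last by rewrite mem_cat h orbT.
by rewrite perm_cat2l (permPl (perm_rem_catr _ h)) perm_cat2l; exact: (perm_rem_map (inr \o inr)).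
Qed.

Lemma shaf_expand x u sv J :
  haf covS (x :: slist u sv J) =
  \sum_(k <- u) covS x (inl k) * shaf (rem k u) sv J +
  (\sum_(l <- sv) covS x (inr (inl l)) * shaf u (rem l sv) J +
   \sum_(z <- J) covS x (inr (inr z)) * shaf u sv (rem z J)).
Proof.
rewrite haf_cons {1}/slist !big_cat !big_map /=; congr (_ + (_ + _)).
- apply: eq_big_seq => k ku; congr (_ * _).
  exact: (haf_perm covS_sym (slist_rem_u _ _ ku)).
- apply: eq_big_seq => k ku; congr (_ * _).
  exact: (haf_perm covS_sym (slist_rem_v _ _ ku)).
apply: eq_big_seq => k ku; congr (_ * _).
exact: (haf_perm covS_sym (slist_rem_J _ _ ku)).
Qed.

Lemma shaf_cons k u sv J : shaf (k :: u) sv J =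
  \sum_(k' <- u) Bser G k k' * shaf (rem k' u) sv J +
  (\sum_(l <- sv) Aser G k l * shaf u (rem l sv) J +
   \sum_(z <- J) Cser (fun m => cov (inl m) z) k * shaf u sv (rem z J)).
Proof. exact: (shaf_expand (inl k)). Qed.

(** Wick's formula for the composite. A mode created by the first factor of [u] is absorbed in the
    functional and then paired with everything else, which yields [Bser], [Cser] and the second term
    of [Aser]; the contractions in [Yt] supply its first term. *)
Lemma shaf_Yt u n sv J : fcoef (shaf u sv J) n = gs J (Yt u n sv).
Proof.
elim: u n sv J => [|k u IH] n sv J.
  rewrite shaf_nil [Yt _ _ _]/=; case: eqP => [->|ne].
    by rewrite fcoefXnM ltnn subnn gs_mon fcoefC.
  rewrite linear0 fcoefXnM; case: ltnP => // h; rewrite fcoefC; case: eqP => //; lia.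
rewrite shaf_cons.
have creation : \sum_(m < n) 'C(m, k)%:R * gs J (hvar K m * Yt u (n - m.+1) sv) =
   fcoef (bshift k (fun m => shaf u sv (inl m :: J))) n.
  by apply: eq_bigr => m _; rewrite IH gsX.
have -> : gs J (Yt (k :: u) n sv) =
  \sum_(m < n) 'C(m, k)%:R * gs J (hvar K m * Yt u (n - m.+1) sv) +
  \sum_(l <- sv) acoef K k l * gs J (Yt u n (rem l sv)).
  rewrite [Yt _ _ _]/= linearD !linear_sum; congr (_ + _).
    by apply: eq_bigr => m _; rewrite linearZ.
  by apply: eq_bigr => m _; rewrite linearZ.
rewrite creation.
have -> : bshift k (fun m => shaf u sv (inl m :: J)) =
  \sum_(k' <- u) Bser G k k' * shaf (rem k' u) sv J +
  (\sum_(l <- sv) X ^+ l.+1 * bshift k (fun m => fpsC (G m l)) * shaf u (rem l sv) J +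
   \sum_(z <- J) Cser (fun m => cov (inl m) z) k * shaf u sv (rem z J)).
  rewrite (@eq_bshift _ k _ (fun m => haf covS (inr (inr (inl m)) :: slist u sv J))); last first.
    move=> m; apply: (haf_perm covS_sym).
    by rewrite /slist /= catA -cat1s perm_catCA -catA.
  rewrite (@eq_bshift _ k _ _ (fun m => shaf_expand (inr (inr (inl m))) u sv J)).
  rewrite !bshiftD !bshift_sum; congr (_ + (_ + _)); apply: eq_bigr => z _ /=.
  - rewrite bshiftMr; congr (_ * _); apply: eq_bshift => m.
    by apply: eq_bshift => m'; rewrite Gsym.
  - rewrite bshiftMr; congr (_ * _).
    by rewrite mulrC -bshiftMr; apply: eq_bshift => m; rewrite mulrC Gsym.
  - by rewrite bshiftMr.
have eA : \sum_(l <- sv) Aser G k l * shaf u (rem l sv) J =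
    \sum_(l <- sv) fpsC (acoef K k l) * shaf u (rem l sv) J +
    \sum_(l <- sv) X ^+ l.+1 * bshift k (fun m => fpsC (G m l)) * shaf u (rem l sv) J.
  by rewrite -big_split; apply: eq_bigr => l _ /=; rewrite /Aser mulrDl.
have -> : \sum_(l <- sv) acoef K k l * gs J (Yt u n (rem l sv)) =
    fcoef (\sum_(l <- sv) fpsC (acoef K k l) * shaf u (rem l sv) J) n.
  by rewrite fcoef_sum; apply: eq_bigr => l _; rewrite fcoefCM IH.
by rewrite eA -fcoefD; congr (fcoef _ _); rewrite -[RHS]addrA; congr (_ + _); rewrite [RHS]addrC addrA.
Qed.

End Correlators.

(** * Degree and leading coefficient at infinity *)

Section PolynomialGrowth.
Variable K : numFieldType.
Local Notation X := (fpsX K).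
Implicit Types (f g h : fps K) (a b : nat) (c d : K).

(* Zhu's products extract the coefficients of degree [wt u + wt v] and
   [wt u + wt v + 1] of [(1 + z)^(wt u) phi(Y(u, z) v)].  For odd [u] that series is
   only a polynomial up to a factor [g]. *)
Definition growth g a b c f := exists p : {poly K},
  [/\ f = g * fps_poly p, (size p + b <= a.+1)%N & c = if (b <= a)%N then p`_(a - b) else 0].

Lemma growthD g a b c1 c2 f1 f2 :
  growth g a b c1 f1 -> growth g a b c2 f2 -> growth g a b (c1 + c2) (f1 + f2).
Proof.
move=> [p [-> sp ->]] [r [-> sr ->]]; exists (p + r); split.
- by rewrite fps_polyD mulrDr.
- by have := size_polyD p r; lia.
by rewrite coefD; case: ifP => _; rewrite ?addr0.
Qed.

Lemma growth0 g a b : (b <= a.+1)%N -> growth g a b 0 0.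
Proof.
move=> ba; exists 0; split; rewrite ?rmorph0 ?mulr0 ?size_poly0 //.
by rewrite coef0 if_same.
Qed.

Lemma growth_sum (I : eqType) (r : seq I) (F : I -> fps K) (C : I -> K) g a b :
  (b <= a.+1)%N -> {in r, forall i, growth g a b (C i) (F i)} ->
  growth g a b (\sum_(i <- r) C i) (\sum_(i <- r) F i).
Proof.
move=> ba; elim: r => [|i r IH] h; first by rewrite !big_nil; apply: growth0.
rewrite !big_cons; apply: growthD; first by apply: h; rewrite inE eqxx.
by apply: IH => j jr; apply: h; rewrite inE jr orbT.
Qed.

(** [e] is the slack between the two degree bounds: with positive slack the coefficient read off
    lies above the degree and is zero. *)
Lemma growth_shift g a b a' b' e c f : (a + b' + e = a' + b)%N ->
  growth g a b c f -> growth g a' b' (if e == 0%N then c else 0) f.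
Proof.
move=> h [p [-> sp ->]]; exists p; split=> //; first by lia.
case: eqP => [e0|e0].
  case: leqP => h1; case: leqP => h2; try lia; last by [].
  by congr (p`_ _); lia.
case: leqP => [h1|//]; rewrite nth_default //.
by move: (size p) sp h1 e0 h => n; lia.
Qed.

Lemma growthM g g' a b a' b' c c' f f' : (b <= a)%N ->
  growth g a b c f -> growth g' a' b' c' f' ->
  growth (g * g') (a + a') (b + b') (c * c') (f * f').
Proof.
move=> ba [p [-> sp ->]] [r [-> sr ->]]; exists (p * r); split.
- by rewrite fps_polyM; ring.
- by have := size_polyMleq p r; lia.
rewrite ba; case: leqP => h; last first.
  have -> : r = 0 by apply/eqP; rewrite -size_poly_eq0; lia.
  by rewrite !mulr0 coef0 if_same.
rewrite (_ : (b + b' <= a + a')%N = true); last by lia.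
have -> : (a + a' - (b + b') = (a - b) + (a' - b'))%N by lia.
rewrite coefM (bigD1 (inord (a - b))) //= inordK; last by lia.
rewrite addKn big1 ?addr0 // => i /eqP ie.
have [lt|gt|e] := ltngtP i (a - b)%N.
- rewrite [r`__]nth_default ?mulr0 //.
  by move: (size r) sr (nat_of_ord i) lt => n sr j lt; lia.
- rewrite nth_default ?mul0r //.
  by move: (size p) sp (nat_of_ord i) gt => n sp' j gt; lia.
by case: ie; apply: val_inj; rewrite /= inordK // -e; have := ltn_ord i; lia.
Qed.

Lemma growth_mono d n : growth 1 n 0 d (fpsC d * X ^+ n).
Proof.
exists (d%:P * 'X^n); split.
- by rewrite mul1r fps_polyM; congr (_ * _); rewrite rmorphXn.
- rewrite addn0 mul_polyC (leq_trans (size_scale_leq _ _)) //.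
  by rewrite size_polyXn.
by rewrite subn0 coefCM coefXn eqxx mulr1.
Qed.

Lemma growth_1X N : growth 1 N 0 1 ((1 + X) ^+ N).
Proof.
exists ((1 + 'X) ^+ N); split.
- by rewrite mul1r -fps_poly1X rmorphXn.
- by rewrite addn0 addrC -(opprK 1) -polyCN size_exp_XsubC.
rewrite subn0 leq0n addrC.
have := monic_exp N (monicXsubC (- 1 : K)); rewrite monicE lead_coefE.
by rewrite size_exp_XsubC /= polyCN opprK => /eqP.
Qed.

Lemma growth_absorb g g' N a b c f : g' = (1 + X) ^+ N * g ->
  growth g' a b c f -> growth g (N + a) b c f.
Proof.
move=> -> h; have h1 := growth_1X N.
case: h => p [-> sp hc].
have /(growthM (leq0n N) h1) : growth g a b c (g * fps_poly p) by exists p.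
by rewrite mul1r add0n mul1r mulrA.
Qed.

End PolynomialGrowth.

(** * Factorization through the lowest intermediate state *)

Section LowestModes.
Variables (K : numFieldType) (G : nat -> nat -> K) (leg : bool -> nat -> K).
Variables (N : nat) (q qi : fps K).
Local Notation X := (fpsX K).
Local Notation I := (nat + bool)%type.
Local Notation cov := (cov G leg).
Local Notation shaf := (shaf G leg).
Local Notation gs := (gs G leg).
Implicit Types (u sv : seq nat) (i j : bool).

Hypothesis Gsym : forall k l, G k l = G l k.
Hypothesis N_range : (0 < N <= 2)%N.
Hypothesis qiK : q * qi = 1.
Hypothesis q2 : q * q = (1 + X) ^+ N.
Hypothesis Bser_homog : forall k k',
  (1 + X) ^+ (k + k').+2 * Bser G k k' = fpsC (G k k') * X ^+ (k + k').+2.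
Hypothesis Aser_growth : forall k l, growth q (k + l).+2 N (leg false k * leg true l)
  ((1 + X) ^+ k.+1 * Aser G k l).
Hypothesis leg0_homog : forall k,
  (1 + X) ^+ k.+1 * Cser (leg false) k = fpsC (leg false k) * X ^+ k.+1 * qi.
Hypothesis leg1_homog : forall k,
  (1 + X) ^+ k.+1 * Cser (leg true) k = fpsC (leg true k) * X ^+ k.+1 * q.

Lemma Bser_sym k k' : Bser G k k' = Bser G k' k.
Proof.
have inv f h : (1 + X) ^+ (k + k').+2 * f = (1 + X) ^+ (k + k').+2 * h -> f = h.
  move=> e; rewrite -[f]mul1r -[h]mul1r -(bserV ((k + k').+2%:R : K)) bser_nat.
  by rewrite mulrAC e mulrAC.
by apply: inv; rewrite Bser_homog [(k + k')%N in RHS]addnC addnC Bser_homog Gsym.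
Qed.

(** [inr true] stands for an excited out-state and [inr false] for an excited in-state. Thus
    [corr i j u] is the matrix coefficient of [u] between two lowest weight vectors, the flag [true]
    choosing the upper one. *)
Definition legs i j : seq I :=
  (if i then [:: inr true] else [::]) ++ (if j then [:: inr false] else [::]).
Definition corr i j u : K := haf cov (map inl u ++ legs i j).

Lemma corr_cons i j k u : corr i j (k :: u) =
  \sum_(k' <- u) G k k' * corr i j (rem k' u) +
  ((if i then leg true k * corr false j u else 0) +
   (if j then leg false k * corr i false u else 0)).
Proof.
rewrite /corr [map _ _]/= cat_cons haf_cons big_cat big_map; congr (_ + _).
  apply: eq_big_seq => k' ku; congr (_ * _); apply: (haf_perm (cov_sym leg Gsym)).
  rewrite (permPl (perm_rem_catl _ (map_f inl ku))) perm_cat2r.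
  exact: perm_rem_map.
have remJ x t : x \notin map inl u -> rem (x : I) (map inl u ++ t) = map inl u ++ rem x t.
  elim: (map inl u) => //= y r IH; rewrite inE negb_or => /andP [xy xr].
  by rewrite eq_sym (negPf xy) IH.
have nin (e : bool) : inr e \notin map (inl : nat -> I) u by apply/mapP => -[].
case: i; case: j; rewrite /legs /= ?big_cons big_nil ?(remJ _ _ (nin _)) /= ?eqxx ?addr0 ?add0r //.
Qed.

Lemma corr_true j u : corr true j u =
  \sum_(l <- u) leg true l * corr false j (rem l u) + (if j then corr false false u else 0).
Proof.
rewrite /corr; have -> : haf cov (map inl u ++ legs true j) =
    haf cov (inr true :: (map inl u ++ legs false j)).
  apply: (haf_perm (cov_sym leg Gsym)).
  by rewrite /legs /= -cat1s perm_catCA.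
rewrite haf_cons big_cat big_map; congr (_ + _).
  apply: eq_big_seq => k' ku; congr (_ * _); apply: (haf_perm (cov_sym leg Gsym)).
  rewrite (permPl (perm_rem_catl _ (map_f inl ku))) perm_cat2r.
  exact: perm_rem_map.
case: j; rewrite /legs /= ?big_cons big_nil //= addr0 mul1r.
apply: (haf_perm (cov_sym leg Gsym)).
have h : inr false \notin map (inl : nat -> I) u by apply/mapP => -[].
rewrite (permPl (perm_rem_catr _ _)) ?inE //=.
Qed.

Definition bser_uv u sv J : fps K := (1 + X) ^+ (wt u) * shaf u sv J.

Lemma bser_uv_cons k u sv J : bser_uv (k :: u) sv J =
  \sum_(k' <- u) fpsC (G k k') * X ^+ (k + k').+2 * bser_uv (rem k' u) sv J +
  (\sum_(l <- sv) (1 + X) ^+ k.+1 * Aser G k l * bser_uv u (rem l sv) J +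
   \sum_(z <- J) (1 + X) ^+ k.+1 * Cser (fun m => cov (inl m) z) k * bser_uv u sv (rem z J)).
Proof.
rewrite /bser_uv (shaf_cons leg Gsym Bser_sym) !mulrDr !mulr_sumr wt_cons exprD.
congr (_ + (_ + _)).
- apply: eq_big_seq => k' ku; rewrite -Bser_homog -(wt_rem ku) addnC.
  have -> : (k + k').+2 = (k.+1 + k'.+1)%N by lia.
  by rewrite !exprD; ring.
- by apply: eq_bigr => l _; ring.
by apply: eq_bigr => z _; ring.
Qed.

(** An odd [u] exchanges the sectors, whose lowest weights differ by [N / 2]. This leaves
    [(1 + z)^(N/2)] or its inverse in front of a polynomial. *)
Definition gfac (o j : bool) : fps K := if o then (if j then qi else q) else 1.

Lemma growth_conv (m : bool) e g g' a b a' b' c c' f :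
  g = (if m then (1 + X) ^+ N else 1) * g' ->
  ((if m then N else 0) + a + b' + e = a' + b)%N ->
  c' = (if e == 0%N then c else 0) -> growth g a b c f -> growth g' a' b' c' f.
Proof.
move=> hg h ->; case: m hg h => [hg h /(growth_absorb hg)|].
  exact: growth_shift.
by rewrite mul1r => -> h; apply: growth_shift.
Qed.

(** For large [z] the lowest state of the sector [i (+) o] dominates between [u] and [v], hence the
    product of two matrix coefficients. The induction contracts the first factor of [u] within [u],
    with [v], or with a leg, and matches the three kinds with the expansions [corr_cons] and
    [corr_true] of the two coefficients. *)
Lemma bser_uv_growth i j u sv (o := odd (size u)) :
  growth (gfac o j) (wt u + wt sv + (if o then N * (i + j) else 0))%N (if o then N else 0)%N
    (corr i (i (+) o) u * corr (i (+) o) j sv) (bser_uv u sv (legs i j)).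
Proof.
rewrite /o {o}.
have [n] := ubnP (size u); elim: n i j u sv => // n IH i j [|k u] sv sz.
  rewrite /= !addbF addn0 /bser_uv (shaf_nil leg Gsym) /wt big_nil -/(wt sv) expr0 mul1r add0n.
  have -> : corr i i [::] = 1.
    by rewrite /corr /legs; case: (i); rewrite /= ?haf_cons ?big_cons ?big_nil /= ?haf_nil ?eqxx; ring.
  by rewrite mul1r mulrC; apply: growth_mono.
have {}sz : (size u < n)%N by [].
rewrite [odd _]/=; set o := odd (size u); set kp := i (+) ~~ o.
have qiK' : qi * q = 1 by rewrite mulrC.
have qqi : q = (1 + X) ^+ N * qi by rewrite -q2 -mulrA qiK mulr1.
have Npos : (N == 0%N) = false by case/andP: N_range; case: (N).
(* A contraction between [u] and [v] reaches the leading order only through the excited intermediate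
   state, that is, when [kp] holds; it then splits into [leg false k * leg true l]. *)
have -> : corr i kp (k :: u) * corr kp j sv =
  \sum_(k' <- u) G k k' * (corr i kp (rem k' u) * corr kp j sv) +
  (\sum_(l <- sv) (if kp then leg false k * leg true l *
       (corr i false u * corr false j (rem l sv)) else 0) +
   ((if i then leg true k * (corr false kp u * corr kp j sv) else 0) +
    (if j then (if kp then leg false k * (corr i false u * corr false false sv) else 0) else 0))).
  rewrite corr_cons !mulrDl mulr_suml; congr (_ + _).
    by apply: eq_bigr => k' _; rewrite mulrA.
  rewrite addrCA; congr (_ + _).
    by case: (i); rewrite ?mul0r // mulrA.
  case: kp; last by rewrite mul0r big1 // if_same addr0.
  rewrite corr_true mulrDr mulr_sumr; congr (_ + _).
    by apply: eq_bigr => l _; ring.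
  by case: (j); rewrite ?mulr0 // mulrA.
rewrite bser_uv_cons.
set a := (wt (k :: u) + wt sv + _)%N; set b := (if ~~ o then N else 0%N).
have Wk : wt (k :: u) = (k.+1 + wt u)%N := wt_cons k u.
have ba : (b <= a.+1)%N.
  rewrite /b /a Wk; case: (~~ o) => //; case/andP: N_range => _.
  by case: (N) => [|[|[|//]]] //= _; rewrite !addSn ?ltnS.
apply: growthD; last apply: growthD.
- apply: growth_sum => // k' ku.
  have sr : size u = (size (rem k' u)).+1 by rewrite size_rem // prednK //; case: (u) ku.
  have h := IH i j (rem k' u) sv; rewrite -[odd (size (rem k' u))]negbK
    -[~~ odd _]/(odd (size (rem k' u)).+1) -sr -/o -/kp in h.
  have h2 := growthM (leq0n _) (growth_mono (G k k') (k + k').+2) (h _).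
  apply: (@growth_conv false 0) (h2 _).
  + by rewrite !mul1r.
  + by rewrite /a Wk -(wt_rem ku) -/b; lia.
  + by [].
  exact: ltnW.
- apply: growth_sum => // l ls.
  have Nkl : (N <= (k + l).+2)%N by case/andP: N_range => _; lia.
  have h := growthM Nkl (Aser_growth k l) (IH i j u (rem l sv) sz); rewrite -/o in h.
  have eW := wt_rem ls.
  (* Cases on [o], [i], [j]. The flag [true] absorbs a surplus [(1 + X)^N] into the polynomial; the
     slack is [N] exactly when [kp] is false, and then the term contributes nothing to the leading
     coefficient. *)
  move: h; rewrite /a /b /kp Wk -eW; clear -Npos qiK q2 qqi; case: o; case: i; case: j => /= h;
  [apply: (@growth_conv false 0) h|apply: (@growth_conv true 0) h
  |apply: (@growth_conv false N) h|apply: (@growth_conv true N) h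
  |apply: (@growth_conv true N) h|apply: (@growth_conv false N) h
  |apply: (@growth_conv true 0) h|apply: (@growth_conv false 0) h];
  rewrite ?Npos ?mul1r ?mulr1 //; lia.
have -> : \sum_(z <- legs i j) (1 + X) ^+ k.+1 * Cser (fun m => cov (inl m) z) k * bser_uv u sv (rem z (legs i j)) =
   (if i then fpsC (leg true k) * X ^+ k.+1 * q * bser_uv u sv (legs false j) else 0) +
   (if j then fpsC (leg false k) * X ^+ k.+1 * qi * bser_uv u sv (legs i false) else 0).
  by case: (i); case: (j); rewrite /legs /= ?big_cons ?big_nil /= -?leg1_homog -?leg0_homog ?addr0 ?add0r.
have g1 d g : growth g k.+1 0 d (fpsC d * X ^+ k.+1 * g).
  case: (growth_mono d k.+1) => p [e sp hc]; exists p; split=> //.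
  by rewrite e mul1r mulrC.
apply: growthD.
- move: ba; rewrite /a /kp; case: (i) => ba; last exact: growth0.
  have h := growthM (leq0n _) (g1 (leg true k) q) (IH false j u sv sz); rewrite -/o addFb in h.
  move: h; rewrite /b Wk; clear -Npos qiK q2 qqi; case: o; case: j => /= h;
  [apply: (@growth_conv false 0) h|apply: (@growth_conv true 0) h
  |apply: (@growth_conv true 0) h|apply: (@growth_conv false 0) h];
  rewrite ?Npos ?mul1r ?mulr1 //; lia.
move: ba; rewrite /a; case: (j) => ba; last exact: growth0.
have h := growthM (leq0n _) (g1 (leg false k) qi) (IH i false u sv sz); rewrite -/o in h.
move: h; rewrite /b /kp Wk; clear -Npos qiK qiK'; case: o; case: i => /= h;
  [apply: (@growth_conv false 0) h|apply: (@growth_conv false N) h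
  |apply: (@growth_conv false N) h|apply: (@growth_conv false 0) h];
  rewrite ?Npos ?mul1r ?mulr1 //; lia.
Qed.
End LowestModes.

(** * Characters of Zhu's algebra *)

Section Characters.
Variable K : numFieldType.
Local Notation X := (fpsX K).
Local Notation mon := (mon K).
Implicit Types (u sv : seq nat) (phi : {linear M1 K -> K^o}).

Definition genY phi u sv : fps K := Fps (fun n => phi (Yt K u n sv)).

Lemma fcoef_1XM w (f : fps K) n : (w <= n)%N ->
  fcoef ((1 + X) ^+ w * f) n = \sum_(e < w.+1) 'C(w, e)%:R * fcoef f (n - e).
Proof.
move=> wn; rewrite -bser_nat fcoefM.
rewrite (big_ord_widen n.+1 (fun e : nat => 'C(w, e)%:R * fcoef f (n - e))) // [RHS]big_mkcond.
apply: eq_bigr => e _; rewrite [fcoef (bser _) e]binc_nat ltnS.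
by case: leqP => // h; rewrite bin_small ?mul0r.
Qed.

Lemma phi_circ phi u sv c : growth 1 (wt u + wt sv) 0 c ((1 + X) ^+ (wt u) * genY phi u sv) ->
  phi (circ K u sv) = 0 /\ phi (cstar K u sv) = c.
Proof.
move=> [p [e sp ->]]; rewrite mul1r in e; rewrite subn0 leq0n.
have gen n : (wt u <= n)%N ->
    phi (\sum_(i < (wt u).+1) 'C(wt u, i)%:R *: Yt K u (n - i) sv) = p`_n.
  move=> h; rewrite linear_sum -fcoef_poly -e fcoef_1XM //.
  by apply: eq_bigr => i _; rewrite linearZ.
split; rewrite gen ?leqW ?leq_addr // nth_default //.
by rewrite addn0 in sp.
Qed.

Section Evaluation.
Variable a : K.
(** The lowest weight vector of [M(1, a)]: [h(z)] acts there as [a / z], whose Taylor coefficients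
    at [z = 1] are [a * binc (-1) k], and there are no self-contractions. *)
Definition evl u : K := \prod_(k <- u) (a * binc (-1) k).
Definition ev v : K := linext (V := K^o) (fun m => evl (mlist m)) v.

Lemma ev_linear : linear (ev : M1 K -> K^o).
Proof. by move=> c v w; rewrite /ev linearP. Qed.
HB.instance Definition _ := GRing.isLinear.Build K (M1 K) K^o *:%R ev ev_linear.

Lemma ev_mon u : ev (mon u) = evl u.
Proof. by rewrite /ev linext_mon /evl (perm_big _ (monsK u)). Qed.

Lemma ev_hvar k v : ev (hvar K k * v) = a * binc (-1) k * ev v.
Proof.
have h1 : linear ((fun v => ev (hvar K k * v)) : M1 K -> K^o).
  by move=> c x y; rewrite mulrDr -scalerAr linearP.
have h2 : linear ((fun v => a * binc (-1) k * ev v) : M1 K -> K^o).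
  by move=> c x y; rewrite linearP mulrDr; congr (_ + _); exact: mulrCA.
pose L1 := GRing.isLinear.Build K (M1 K) K^o *:%R _ h1.
pose L2 := GRing.isLinear.Build K (M1 K) K^o *:%R _ h2.
pose f1 : {linear M1 K -> K^o} := HB.pack (fun v : M1 K => ev (hvar K k * v) : K^o) L1.
pose f2 : {linear M1 K -> K^o} := HB.pack (fun v : M1 K => a * binc (-1) k * ev v : K^o) L2.
have H : f1 =1 f2; last exact: (H v).
apply: (@eq_linext K K^o f1 f2) => m.
rewrite -mon_mlist; change (ev (hvar K k * mon (mlist m)) = a * binc (-1) k * ev (mon (mlist m))).
by rewrite -mon_cons !ev_mon /evl big_cons.
Qed.

Lemma ev_growth u sv : growth 1 (wt u + wt sv) 0 (evl u * evl sv)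
  ((1 + X) ^+ (wt u) * genY ev u sv).
Proof.
elim: u sv => [|k u IH] sv.
  have -> : genY ev [::] sv = fpsC (evl sv) * X ^+ wt sv.
    apply/fpsP => n; rewrite mulrC fcoefXnM fcoefC /=; case: eqP => [->|ne].
      by rewrite ltnn subnn ev_mon.
    rewrite linear0; case: ltnP => // h; case: eqP => //; lia.
  rewrite /wt big_nil -/(wt sv) expr0 mul1r add0n /evl big_nil mul1r; exact: growth_mono.
have -> : genY ev (k :: u) sv = Cser (fun m => a * binc (-1) m) k * genY ev u sv +
    \sum_(l <- sv) fpsC (acoef K k l) * genY ev u (rem l sv).
  rewrite /Cser -bshiftMr; apply/fpsP => n; rewrite fcoefD fcoef_sum.
  rewrite [LHS]/= linearD !linear_sum; congr (_ + _).
    apply: eq_bigr => m _; rewrite fcoefCM.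
    by refine (etrans (linearZ _ _) _); rewrite [X in _ * X = _]ev_hvar.
  by apply: eq_bigr => m _; rewrite linearZ fcoefCM.
have -> : (1 + X) ^+ wt (k :: u) * (Cser (fun m => a * binc (-1) m) k * genY ev u sv +
    \sum_(l <- sv) fpsC (acoef K k l) * genY ev u (rem l sv)) =
    (1 + X) ^+ k.+1 * Cser (fun m => a * binc (-1) m) k * ((1 + X) ^+ wt u * genY ev u sv) +
    \sum_(l <- sv) (1 + X) ^+ k.+1 * fpsC (acoef K k l) * ((1 + X) ^+ wt u * genY ev u (rem l sv)).
  rewrite wt_cons exprD mulrDr mulr_sumr; congr (_ + _); first by ring.
  by apply: eq_bigr => l _; ring.
rewrite -[evl _ * _]addr0 wt_cons; apply: growthD.
  have := growthM (leq0n _) (growth_mono (a * binc (-1) k) k.+1) (IH sv).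
  have -> : evl (k :: u) = a * binc (-1) k * evl u by rewrite /evl big_cons.
  by rewrite Cser_binc addNr bser0 !mulr1 -(mulrA _ (evl u)) -(addnA k.+1).
(* A contraction with [v] loses degree [l + 1], so it does not reach the leading coefficient. *)
rewrite [0](_ : _ = \sum_(l <- sv) 0); last by rewrite big1.
apply: growth_sum => // l ls.
have g1 : growth 1 k.+1 0 (acoef K k l) ((1 + X) ^+ k.+1 * fpsC (acoef K k l)).
  have := growthM (leq0n _) (growth_1X K k.+1) (growth_mono (acoef K k l) 0).
  by rewrite !mul1r expr0 mulr1 !addn0.
have := growthM (leq0n _) g1 (IH (rem l sv)); rewrite mulr1.
apply: (@growth_shift _ _ _ _ _ _ l.+1); rewrite -(wt_rem ls); lia.
Qed.
End Evaluation.

End Characters.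

Section ZhuCharacters.
Variable K : numFieldType.
Local Notation X := (fpsX K).
Local Notation mon := (mon K).
Implicit Types (u sv : seq nat) (phi : {linear M1 K -> K^o}) (v w : M1 K).

Definition zhu_char (phi : M1 K -> K) := forall u sv, ~~ odd (size u) -> ~~ odd (size sv) ->
  phi (circ K u sv) = 0 /\ phi (cstar K u sv) = phi (mon u) * phi (mon sv).

Lemma ev_zhu_char (a : K) : zhu_char (ev a).
Proof.
move=> u sv _ _; rewrite [ev a (mon u)]ev_mon [ev a (mon sv)]ev_mon.
by apply: phi_circ; apply: ev_growth.
Qed.

Definition twist_leg (e : bool) : nat -> K := if e then @tT K else @sT K.

Lemma GT_sym k l : GT K k l = GT K l k.
Proof. by rewrite /GT addnC [sT K k * _]mulrC. Qed.

Lemma twisted_zhu_char (e : bool) : zhu_char (gs (GT K) twist_leg (legs e e)).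
Proof.
have qiK : qT K * bser (- 2%:R^-1) = 1 by exact: bserV.
have q2 : qT K * qT K = (1 + X) ^+ 1.
  by rewrite /qT bserM expr1 -bser1; congr bser; field.
have hA k l : growth (qT K) (k + l).+2 1 (twist_leg false k * twist_leg true l)
    ((1 + X) ^+ k.+1 * Aser (GT K) k l).
  by have [P [eP sP lP]] := Aser_twisted K k l; exists P; split=> //; lia.
have h0 k : (1 + X) ^+ k.+1 * Cser (twist_leg false) k =
    fpsC (twist_leg false k) * X ^+ k.+1 * bser (- 2%:R^-1).
  by rewrite /twist_leg /sT Cser_binc; congr (_ * bser _); field.
have h1 k : (1 + X) ^+ k.+1 * Cser (twist_leg true) k =
    fpsC (twist_leg true k) * X ^+ k.+1 * qT K.
  rewrite (_ : Cser (twist_leg true) k = Cser (fun m => 1 * binc (- 2%:R^-1) m) k).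
    by rewrite Cser_binc mul1r; congr (_ * bser _); field.
  by apply: eq_bshift => m; rewrite mul1r.
move=> u sv ou ov.
have := bser_uv_growth GT_sym (isT : (0 < 1 <= 2)%N) qiK q2 (@Bser_twisted K) hA h0 h1 e e u sv.
rewrite (negPf ou) /= addbF addn0 !(gs_mon twist_leg GT_sym).
have -> : bser_uv (GT K) twist_leg u sv (legs e e) =
    (1 + X) ^+ wt u * genY (gs (GT K) twist_leg (legs e e)) u sv.
  congr (_ * _); apply/fpsP => n; apply: shaf_Yt; first exact: GT_sym.
  by move=> k k'; apply: Bser_sym GT_sym (@Bser_twisted K) k k'.
exact: phi_circ.
Qed.

(** Matrix coefficients of [h(z)] between the vacuum and [h(-1)1]: the constant [1] one way and
    [z^(-2)] the other, expanded at [z = 1]. *)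
Definition flat_leg (e : bool) (k : nat) : K := if e then (k == 0%N)%:R else binc (- 2%:R) k.

Definition flatG (k l : nat) : K := 0.
Lemma flatG_sym k l : flatG k l = flatG l k. Proof. by []. Qed.

Lemma flat_zhu_char : zhu_char (gs flatG flat_leg (legs true true)).
Proof.
have qiK : bser 1 * bser (- 1) = 1 :> fps K by exact: bserV.
have q2 : bser 1 * bser 1 = (1 + X) ^+ 2 by rewrite bser1 expr2.
have z k k' : Bser flatG k k' = 0.
  apply/fpsP => n; rewrite /= big1 // => m _; rewrite big1 ?mulr0 // => i _.
  by rewrite coefC if_same mulr0.
have hB k k' : (1 + X) ^+ (k + k').+2 * Bser flatG k k' = fpsC 0 * X ^+ (k + k').+2.
  by rewrite z rmorph0 mulr0 mul0r.
have hA k l : growth (bser 1) (k + l).+2 2 (flat_leg false k * flat_leg true l)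
    ((1 + X) ^+ k.+1 * Aser flatG k l).
  have -> : Aser flatG k l = fpsC (acoef K k l).
    rewrite /Aser -[RHS]addr0; congr (_ + _).
    apply/fpsP => n; rewrite fcoefXnM fcoef_bshiftC fcoef0; case: ltnP => // _.
    by case: (_ - _)%N => // m; rewrite mulr0.
  have -> : (1 + X) ^+ k.+1 * fpsC (acoef K k l) = bser 1 * ((1 + X) ^+ k * fpsC (acoef K k l)).
    by rewrite bser1 exprS mulrA.
  have := growthM (leq0n _) (growth_1X K k) (growth_mono (acoef K k l) 0).
  rewrite !mul1r expr0 mulr1 !addn0 => -[p [-> sp hc]]; exists p; split; rewrite ?mul1r //.
    by lia.
  rewrite subn2 /= /flat_leg; rewrite subn0 /= /acoef in hc.
  (* The coefficient of degree [k + l] of a polynomial of degree at most [k]: only [l = 0]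
     contributes, in agreement with [flat_leg true]. *)
  case: l hc => [|l] hc; first by rewrite addn0 -hc mul1r mulr1.
  by rewrite mulr0 nth_default //; move: (size p) sp => n; lia.
have h0 k : (1 + X) ^+ k.+1 * Cser (flat_leg false) k =
    fpsC (flat_leg false k) * X ^+ k.+1 * bser (- 1).
  rewrite (_ : Cser (flat_leg false) k = Cser (fun m => 1 * binc (- 2%:R) m) k).
    by rewrite Cser_binc mul1r; congr (_ * bser _); ring.
  by apply: eq_bshift => m; rewrite mul1r.
have h1 k : (1 + X) ^+ k.+1 * Cser (flat_leg true) k =
    fpsC (flat_leg true k) * X ^+ k.+1 * bser 1.
  have e m : flat_leg true m = 1 * binc 0 m.
    by rewrite mul1r -[0]/(0%:R) binc_nat; case: m => [|m]; rewrite ?bin0.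
  rewrite (_ : Cser (flat_leg true) k = Cser (fun m => 1 * binc 0 m) k).
    by rewrite Cser_binc e add0r.
  by apply: eq_bshift => m; rewrite e.
move=> u sv ou ov.
have := bser_uv_growth flatG_sym (isT : (0 < 2 <= 2)%N) qiK q2 hB hA h0 h1 true true u sv.
rewrite (negPf ou) /= addn0 !(gs_mon flat_leg flatG_sym).
have -> : bser_uv flatG flat_leg u sv (legs true true) =
    (1 + X) ^+ wt u * genY (gs flatG flat_leg (legs true true)) u sv.
  by congr (_ * _); apply/fpsP => n; apply: (shaf_Yt _ flatG_sym) => k k'; rewrite !z.
exact: phi_circ.
Qed.

End ZhuCharacters.

(** * Reduction modulo O *)

Section QuadraticCirc.
Variable K : numFieldType.
Implicit Types (s t u : seq nat) (v w : M1 K).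
Local Notation mon := (mon K).
Local Notation Yt := (Yt K).
Local Notation acoef := (acoef K).

Lemma big_ord_pick (V : nmodType) n (F : nat -> V) m0 : (m0 < n)%N ->
  (forall m, (m < n)%N -> m != m0 -> F m = 0) -> \sum_(m < n) F m = F m0.
Proof.
move=> h0 h; rewrite (bigD1 (Ordinal h0)) //= big1 ?addr0 // => i ne.
by apply: h => //; apply: contraNneq ne => e; apply/eqP/val_inj.
Qed.

Lemma big_ord_pick2 (V : nmodType) n (F : nat -> V) m0 m1 : (m0 < m1 < n)%N ->
  (forall m, (m < n)%N -> m != m0 -> m != m1 -> F m = 0) -> \sum_(m < n) F m = F m0 + F m1.
Proof.
move=> /andP [h01 h1] h; have h0 := ltn_trans h01 h1.
rewrite (bigD1 (Ordinal h0)) //= (bigD1 (Ordinal h1)) /=; last first.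
  by apply/eqP => /(congr1 val) /= e; rewrite e ltnn in h01.
by rewrite big1 ?addr0 // => i /andP [n0 n1]; apply: h.
Qed.

Lemma scale_mul_sum (A : lalgType K) (c : K) (x : A) I (r : seq I) (F : I -> A) :
  c *: (x * \sum_(i <- r) F i) = \sum_(i <- r) c *: (x * F i).
Proof. by rewrite mulr_sumr scaler_sumr. Qed.

Lemma scale_mul_scale (A : algType K) (c a : K) (x y : A) :
  c *: (x * (a *: y)) = (a * c) *: (x * y).
Proof. by rewrite -scalerAr scalerA mulrC. Qed.

Definition cre1 j n s : M1 K :=
  if (wt s < n)%N then 'C((n - wt s).-1, j)%:R *: mon ((n - wt s).-1 :: s) else 0.

Lemma Yt1 j n s : Yt [:: j] n s =
  cre1 j n s + \sum_(l <- s) acoef j l *: (if n == wt (rem l s) then mon (rem l s) else 0).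
Proof.
rewrite [LHS]/=; apply: (congr2 +%R); last by [].
pose F (m : nat) : M1 K := 'C(m, j)%:R *: (hvar K m * (if (n - m.+1)%N == wt s then mon s else 0)).
rewrite -[LHS]/(\sum_(m < n) F m) /cre1.
have F0 m : (n - m.+1)%N != wt s -> F m = 0.
  by rewrite /F => /negPf ->; rewrite mulr0 scaler0.
case: (ltnP (wt s) n) => h.
  rewrite (@big_ord_pick _ n F (n - wt s).-1); last 2 first.
  - by lia.
  - by move=> m mn ne; apply: F0; apply: contraNneq ne => e; apply/eqP; lia.
  rewrite /F (_ : (n - (n - wt s).-1.+1)%N == wt s); last by apply/eqP; lia.
  by rewrite mon_cons.
by rewrite big1 // => i _; apply: F0; apply/eqP; have := ltn_ord i; lia.
Qed.

(** The target weight exceeds [wt s], whereas two contractions would lower the weight. Hence at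
    least one of the two factors creates a mode. *)
Lemma Yt2 i j d s : Yt [:: i; j] (wt s + d).+1 s =
  \sum_(m < d) ('C(m, i)%:R * 'C((d - m).-1, j)%:R) *: mon [:: nat_of_ord m, (d - m).-1 & s] +
  \sum_(l <- s) (acoef j l * 'C((d + l).+1, i)%:R + acoef i l * 'C((d + l).+1, j)%:R) *:
      mon ((d + l).+1 :: rem l s).
Proof.
pose n := (wt s + d).+1.
have e0 : Yt [:: i; j] n s = \sum_(m < n) 'C(m, i)%:R *: (hvar K m * Yt [:: j] (n - m.+1) s) +
    \sum_(l <- s) acoef i l *: Yt [:: j] n (rem l s) by [].
have e1 : \sum_(l <- s) acoef i l *: Yt [:: j] n (rem l s) =
    \sum_(l <- s) (acoef i l * 'C((d + l).+1, j)%:R) *: mon ((d + l).+1 :: rem l s).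
  apply: eq_big_seq => l ls; rewrite Yt1; have e := wt_rem ls.
  rewrite big1_seq => [|l' /= l's]; last first.
    have e' := wt_rem l's.
    by rewrite (_ : (n == _) = false) ?scaler0 //; apply/negP => /eqP; rewrite /n; lia.
  rewrite addr0 /cre1 (_ : (wt (rem l s) < n)%N); last by rewrite /n; lia.
  rewrite scalerA (_ : (n - wt (rem l s)).-1 = (d + l).+1) //; rewrite /n; lia.
pose F (m : nat) : M1 K := 'C(m, i)%:R *: (hvar K m * cre1 j (n - m.+1) s).
pose H l (m : nat) : M1 K := 'C(m, i)%:R *: (hvar K m *
  (acoef j l *: (if (n - m.+1)%N == wt (rem l s) then mon (rem l s) else 0))).
have e2 : \sum_(m < n) 'C(m, i)%:R *: (hvar K m * Yt [:: j] (n - m.+1) s) =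
   \sum_(m < n) F m + \sum_(l <- s) \sum_(m < n) H l m.
  rewrite exchange_big -big_split; apply: eq_bigr => m _.
  rewrite Yt1 (mulrDr (hvar K m)) (scalerDr 'C(m, i)%:R); apply: (congr2 +%R); first by [].
  exact: scale_mul_sum.
have e3 : \sum_(m < n) F m =
    \sum_(m < d) ('C(m, i)%:R * 'C((d - m).-1, j)%:R) *: mon [:: nat_of_ord m, (d - m).-1 & s].
  pose F' (m : nat) : M1 K := ('C(m, i)%:R * 'C((d - m).-1, j)%:R) *: mon [:: m, (d - m).-1 & s].
  have dn : (d <= n)%N by rewrite /n; lia.
  refine (etrans _ (esym (big_ord_widen_if F' dn))); apply: eq_bigr => m _.
  rewrite /F /cre1 (_ : (wt s < n - m.+1)%N = (m < d)%N); last by rewrite /n; lia.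
  case: (ltnP m d) => h; last by rewrite mulr0 scaler0.
  rewrite (_ : (n - m.+1 - wt s).-1 = (d - m).-1); last by rewrite /n; lia.
  by refine (etrans (scale_mul_scale _ _ _ _) _); rewrite -mon_cons mulrC.
have e4 : \sum_(l <- s) \sum_(m < n) H l m =
    \sum_(l <- s) (acoef j l * 'C((d + l).+1, i)%:R) *: mon ((d + l).+1 :: rem l s).
  apply: eq_big_seq => l ls; have e := wt_rem ls.
  rewrite (@big_ord_pick _ n (H l) (d + l).+1); last 2 first.
  - by rewrite /n; lia.
  - move=> m mn ne; have h : ((n - m.+1)%N == wt (rem l s)) = false.
      by apply: contraNF ne => /eqP h; apply/eqP; move: h mn; rewrite /n; lia.
    by rewrite /H h; refine (etrans (scale_mul_scale _ _ _ _) _); rewrite mulr0 scaler0.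
  have h : ((n - (d + l).+2)%N == wt (rem l s)) = true by apply/eqP; rewrite /n; lia.
  rewrite /H h; refine (etrans (scale_mul_scale _ _ _ _) _).
  by rewrite -mon_cons.
refine (etrans e0 (etrans (congr2 +%R (etrans e2 (congr2 +%R e3 e4)) e1) _)).
clear; rewrite -[LHS]addrA; apply: (congr2 +%R); first by [].
by rewrite -big_split; apply: eq_bigr => l _; exact/esym/scalerDl.
Qed.

(** The two summands say which of the factors [i], [j] is contracted with [l]; the other one creates
    the mode [d + l + 1]. *)
Definition gamma i j l d : K :=
  'C((i + j).+2, d)%:R * (acoef j l * 'C((d + l).+1, i)%:R + acoef i l * 'C((d + l).+1, j)%:R).

Section Terms.
Variables (V : lmodType K) (e : seq nat -> V).

(** [L(-1) + L(0)] applied to the two factors [i], [j], with [s] as a spectator; [L(-1)] sends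
    [h(-i-1)] to [(i+1) h(-i-2)]. *)
Definition quadD i j s : V :=
  (i + j).+2%:R *: e [:: i, j & s] + j.+1%:R *: e [:: i, j.+1 & s]
  + i.+1%:R *: e [:: i.+1, j & s].

Definition quadE i j s : V :=
  \sum_(l <- s) \sum_(d < (i + j).+3) gamma i j l d *: e ((d + l).+1 :: rem l s).

End Terms.

Lemma circ2 i j s : circ K [:: i; j] s = quadD mon i j s + quadE mon i j s.
Proof.
have w2 : wt [:: i; j] = (i + j).+2 by rewrite !wt_cons /wt big_nil; lia.
rewrite /circ w2 (reindex_inj rev_ord_inj) /=.
have e1 : \sum_(d < (i + j).+3) 'C((i + j).+2, (i + j).+3 - d.+1)%:R *:
      Yt [:: i; j] (((i + j).+2 + wt s).+1 - ((i + j).+3 - d.+1)) s =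
    \sum_(d < (i + j).+3) 'C((i + j).+2, d)%:R *: Yt [:: i; j] (wt s + d).+1 s.
  apply: eq_bigr => d _; have := ltn_ord d => hd.
  rewrite subSS bin_sub; last by lia.
  by rewrite (_ : (_.+1 - _)%N = (wt s + d).+1); last by lia.
refine (etrans e1 _).
under eq_bigr => d _ do rewrite Yt2 scalerDr.
rewrite big_split; apply: (congr2 +%R); last first.
  rewrite /quadE [RHS]exchange_big; apply: eq_bigr => d _; rewrite scaler_sumr.
  by apply: eq_bigr => l _; rewrite scalerA.
pose F (d m : nat) : M1 K :=
  ('C(m, i)%:R * 'C((d - m).-1, j)%:R) *: mon [:: m, (d - m).-1 & s].
have F0 (d m : nat) : (m < i)%N || ((d - m).-1 < j)%N -> F d m = 0.
  by case/orP => h; rewrite /F (bin_small h) ?mul0r ?mulr0 scale0r.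
pose f (d : nat) : M1 K := 'C((i + j).+2, d)%:R *: \sum_(m < d) F d m.
(* The created indices are at least [i] and [j], so a nonzero term needs [d > i + j]: only the two
   highest weights remain. *)
have e2 : \sum_(d < (i + j).+3) f d = f (i + j).+1 + f (i + j).+2.
  apply: big_ord_pick2 => [|d hd n0 n1]; first by rewrite !ltnSn.
  have z : \sum_(m < d) F d m = 0.
    by apply: big1 => m _; apply: F0; have := ltn_ord m; lia.
  by rewrite /f z (scaler0 _ 'C((i + j).+2, d)%:R).
refine (etrans e2 _).
have f1 : f (i + j).+1 = (i + j).+2%:R *: mon [:: i, j & s].
  rewrite /f (@big_ord_pick _ _ (F (i + j).+1) i); last 2 first.
  - by lia.
  - by move=> m hm ne; apply: F0; lia.
  apply: scaler_congr; first by rewrite -bin_sub ?subSnn ?bin1.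
  rewrite /F (_ : ((i + j).+1 - i).-1 = j); last by lia.
  by rewrite !binn mulr1 scale1r.
have f2 : f (i + j).+2 = j.+1%:R *: mon [:: i, j.+1 & s] + i.+1%:R *: mon [:: i.+1, j & s].
  rewrite /f binn scale1r (@big_ord_pick2 _ _ (F (i + j).+2) i i.+1); last 2 first.
  - by lia.
  - by move=> m hm n0 n1; apply: F0; lia.
  rewrite /F (_ : ((i + j).+2 - i).-1 = j.+1); last by lia.
  rewrite (_ : ((i + j).+2 - i.+1).-1 = j); last by lia.
  by apply: (congr2 +%R); apply: scaler_congr; rewrite ?binSn ?binn ?mul1r ?mulr1.
exact: (etrans (congr2 +%R f1 f2) (addrA _ _ _)).
Qed.
End QuadraticCirc.

(** * Subspaces and quadratic elements of O *)

Section Subspaces.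
Variables (K : fieldType) (V : lmodType K).
Implicit Types (S : V -> Prop) (u v : V) (a : K).

Definition subspace S :=
  [/\ S 0, forall u v, S u -> S v -> S (u + v) & forall a v, S v -> S (a *: v)].

Lemma subspace_sum S I (r : seq I) (P : pred I) (F : I -> V) : subspace S ->
  (forall i, P i -> S (F i)) -> S (\sum_(i <- r | P i) F i).
Proof. by case=> S0 SD _ h; apply: (big_ind S). Qed.

Lemma subspace_sum_seq S (I : eqType) (r : seq I) (F : I -> V) : subspace S ->
  (forall i, i \in r -> S (F i)) -> S (\sum_(i <- r) F i).
Proof. by move=> Ssub h; rewrite big_seq; apply: subspace_sum. Qed.

Lemma subspaceN S v : subspace S -> S v -> S (- v).
Proof. by case=> _ _ SZ h; rewrite -scaleN1r; apply: SZ. Qed.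

Lemma subspaceB S u v : subspace S -> S u -> S v -> S (u - v).
Proof. by move=> Ss hu hv; case: (Ss) => _ SD _; apply: SD => //; apply: subspaceN. Qed.

Lemma subspaceDr S u v : subspace S -> S v -> S (u + v) -> S u.
Proof. by move=> Ss hv h; rewrite -(addrK v u); apply: subspaceB. Qed.

Lemma subspace_unscale S a v : subspace S -> a != 0 -> S (a *: v) -> S v.
Proof. by case=> _ _ SZ a0 /(SZ a^-1); rewrite scalerA mulVf // scale1r. Qed.

End Subspaces.

Section FixedPoints.
Variable K : numFieldType.
Implicit Types (s : seq nat) (u v w : M1 K) (m : cmonom nat).
Local Notation mon := (mon K).

Lemma mcoeff_mvec m m' : (mvec K m)@_m' = (m == m')%:R.
Proof. exact: mcoeffU1. Qed.

Lemma theta_coef v m : (theta K v)@_m = (-1) ^+ mdeg m * v@_m.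
Proof.
rewrite /theta raddf_sum /=.
under eq_bigr => m' _ do rewrite mcoeffZ mcoeff_mvec.
have [mv|mv] := boolP (m \in msupp v).
  rewrite (bigD1_seq m) ?fset_uniq //= eqxx mulr1 big1 ?addr0 // => i /negPf ->.
  by rewrite mulr0.
rewrite (mcoeff_outdom mv) mulr0 big1_seq // => i /= iv.
by case: eqP iv mv => [-> -> //|]; rewrite mulr0.
Qed.

Lemma inVplusP v : inVplus K v <-> forall m, m \in msupp v -> ~~ odd (size (mlist m)).
Proof.
have h m : (mdeg m = size (mlist m))%N := mdeg_mlist m.
split=> [hv m mv|hv]; last first.
  refine (proj1 (malgP _ _) _) => m; rewrite theta_coef.
  have [mv|mv] := boolP (m \in msupp v); last by rewrite (mcoeff_outdom mv) mulr0.
  by rewrite h -signr_odd (negPf (hv m mv)) expr0 mul1r.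
have e := theta_coef v m; rewrite [theta K v]hv h -signr_odd in e.
rewrite -mcoeff_neq0 in mv; apply: contraNN mv => od; rewrite od expr1 mulN1r in e.
by move/eqP: e; rewrite -addr_eq0 -mulr2n mulrn_eq0.
Qed.

Lemma mem_msupp_mon s m : m \in msupp (mon s) -> m = mons s.
Proof. by rewrite mon.unlock /mvec msuppU1 in_fset1 => /eqP. Qed.

Lemma inVplus_mon s : ~~ odd (size s) -> inVplus K (mon s).
Proof.
by move=> hs; apply/inVplusP => m /mem_msupp_mon ->; rewrite (perm_size (monsK s)).
Qed.

Lemma homog_mon s : homog K (wt s) (mon s).
Proof. by move=> m /mem_msupp_mon ->; rewrite wtmE (wt_perm (monsK s)). Qed.

Lemma inO_subspace : subspace (inO K).
Proof.
split.
- by exists [::]; rewrite big_nil; split.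
- move=> u v [r [hr ->]] [q [hq ->]]; exists (r ++ q); split.
    by move=> t; rewrite mem_cat => /orP [/hr|/hq].
  by rewrite big_cat.
move=> a v [r [hr ->]].
exists [seq (a * t.1.1.1, t.1.1.2, t.1.2, t.2) | t <- r]; split.
  by move=> t /mapP [t' /hr h ->].
by rewrite big_map scaler_sumr; apply: eq_bigr => t _; rewrite scalerA.
Qed.

Lemma inO_zcirc k u v : homog K k u -> inVplus K u -> inVplus K v -> inO K (zcirc K k u v).
Proof.
move=> h1 h2 h3; exists [:: (1, k, u, v)]; split.
  by move=> t; rewrite inE => /eqP ->.
by rewrite big_seq1 /= scale1r.
Qed.

Lemma mon_swap i j s : mon [:: i, j & s] = mon [:: j, i & s].
Proof. by apply: mon_perm; apply/permP => p /=; rewrite addnCA. Qed.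

Lemma quadD_sym i j s : quadD mon i j s = quadD mon j i s.
Proof.
have e (x y z : M1 K) : x + y + z = x + z + y by exact: addrAC.
refine (etrans (e _ _ _) _); rewrite /quadD.
rewrite [(i + j)%N]addnC.
rewrite (mon_swap i j s).
rewrite (mon_swap i j.+1 s).
rewrite (mon_swap i.+1 j s).
reflexivity.
Qed.

Lemma quadE_sym i j s : quadE mon i j s = quadE mon j i s.
Proof.
rewrite /quadE [(i + j)%N]addnC; apply: eq_bigr => l _; apply: eq_bigr => d _.
by apply: scaler_congr; rewrite // /gamma [(i + j)%N]addnC; congr (_ * _); rewrite addrC.
Qed.

Lemma quadD_perm i j s (t : seq nat) : perm_eq s t -> quadD mon i j s = quadD mon i j t.
Proof.
move=> e; have h a b : mon [:: a, b & s] = mon [:: a, b & t].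
  by apply: mon_perm; rewrite !perm_cons.
by rewrite /quadD !h.
Qed.

Lemma quadE_perm i j s (t : seq nat) : perm_eq s t -> quadE mon i j s = quadE mon i j t.
Proof.
move=> e; rewrite /quadE (perm_big _ e); apply: eq_bigr => l _; apply: eq_bigr => d _.
by apply: scaler_congr => //; apply: mon_perm; rewrite perm_cons; exact: perm_rem2.
Qed.

Lemma perm_pair (T : eqType) (l : seq T) (i j : T) : perm_eq l [:: i; j] -> l = [:: i; j] \/ l = [:: j; i].
Proof.
move=> e; have := perm_size e; case: l e => [|a [|b [|//]]] // e _.
have := perm_mem e a; rewrite !inE eqxx /= => /esym/orP [] /eqP E; subst a.
  by left; move: e; rewrite perm_cons => /perm_mem /(_ j); rewrite !inE eqxx => /eqP ->.
right; have : perm_eq [:: j; b] [:: j; i] by rewrite (permPl e); apply/permP => p /=; rewrite addnCA.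
by rewrite perm_cons => /perm_mem /(_ i); rewrite !inE eqxx => /eqP ->.
Qed.

Lemma inO_quad i j s : ~~ odd (size s) -> inO K (quadD mon i j s + quadE mon i j s).
Proof.
move=> hs; have -> : quadD mon i j s + quadE mon i j s = zcirc K (wt [:: i; j]) (mon [:: i; j]) (mon s).
  rewrite (zcircE _ (@homog_mon [:: i; j])) linext_mon linext_mon.
  have es := monsK s.
  case: (perm_pair (monsK [:: i; j])) => ->; rewrite circ2 (quadD_perm _ _ es) (quadE_perm _ _ es) //.
  by rewrite quadD_sym quadE_sym.
apply: inO_zcirc; [exact: homog_mon|exact: inVplus_mon|exact: inVplus_mon].
Qed.

End FixedPoints.

(** * A spanning set of M(1)^+ modulo O *)

Section Reduction.
Variables (K : numFieldType) (A : comAlgType K) (mon : seq nat -> A) (S : A -> Prop).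
Hypothesis mon_perm : forall s (t : seq nat), perm_eq s t -> mon s = mon t.
Hypothesis Ss : subspace S.
Local Notation quadD := (quadD mon).
Local Notation quadE := (quadE mon).
Hypothesis Squad : forall i j s, ~~ odd (size s) -> S (quadD i j s + quadE i j s).

Lemma scale_in_alg (a : K) (x : A) : a *: x = in_alg A a * x.
Proof. by rewrite mulr_algl. Qed.

Let S0 : S 0. Proof. by case: Ss. Qed.
Let SD u v : S u -> S v -> S (u + v). Proof. by case: Ss => _ h _; apply: h. Qed.
Let SZ (a : K) v : S v -> S (a *: v). Proof. by case: Ss => _ _; apply. Qed.

Lemma mon_swap2 a b s : mon [:: a, b & s] = mon [:: b, a & s].
Proof. by apply: mon_perm; apply/permP => p /=; rewrite addnCA. Qed.

Lemma quadE_lower i j s :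
  (forall t, size t = size s -> S (mon t)) -> S (quadE i j s).
Proof.
move=> h; apply: (subspace_sum_seq Ss) => l ls; apply: (subspace_sum_seq Ss) => d _.
apply: SZ; apply: h => /=.
by rewrite size_rem // prednK //; case: (s) ls.
Qed.

Lemma quadD_lower i j s : ~~ odd (size s) ->
  (forall t, size t = size s -> S (mon t)) -> S (quadD i j s).
Proof. by move=> hs h; apply: (subspaceDr Ss (quadE_lower i j h)); apply: Squad. Qed.

(** [L(-1) + L(0)] is a derivation that sends [h(-a-1)] to [(a+1)(h(-a-2) + h(-a-1))]. From its
    action on the pairs [ab], [ac], [bc], twice its action on [a] alone is [ab + ac - bc]. The
    accompanying contraction terms are shorter monomials. *)
Lemma mon_lower_step a b c s : odd (size s) ->
  (forall t, size t = (size s).+1 -> S (mon t)) ->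
  S (mon [:: a.+1, b, c & s] + mon [:: a, b, c & s]).
Proof.
move=> hs h.
have q i j k : S (quadD i j (k :: s)) by apply: quadD_lower => //=; rewrite hs.
apply: (@subspace_unscale _ _ S (2 * a.+1%:R) _ Ss); first by rewrite mulf_neq0 // pnatr_eq0.
suff -> : (2 * a.+1%:R) *: (mon [:: a.+1, b, c & s] + mon [:: a, b, c & s]) =
    quadD a b (c :: s) + quadD a c (b :: s) - quadD b c (a :: s).
  by apply: (subspaceB Ss) => //; apply: SD.
rewrite /quadD.
have sw x y z : mon [:: x, y, z & s] = mon [:: x, z, y & s].
  by apply: mon_perm; rewrite perm_cons; apply/permP => p /=; rewrite addnCA.
rewrite (sw a c b) (sw a c.+1 b) (sw a.+1 c b).
rewrite (sw b c a) (mon_swap2 b a) (sw b c.+1 a) (mon_swap2 b a) (sw b.+1 c a) (mon_swap2 b.+1 a).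
rewrite !scale_in_alg; ring.
Qed.

Lemma span_mon_ge4 n s : ~~ odd n -> size s = n.+4 ->
  (forall t, size t = n.+2 -> S (mon t)) -> S (mon (nseq n.+4 0%N)) -> S (mon s).
Proof.
move=> en hs h h0.
have step (a : nat) (t : seq nat) : size t = n.+3 -> S (mon (0%N :: t)) -> S (mon (a :: t)).
  case: t => [|b [|c t]] //= [ht]; elim: a => // a IH /IH ha.
  by apply: (subspaceDr Ss ha); apply: mon_lower_step; rewrite ht.
suff H t k : (size t + k = n.+4)%N -> S (mon (t ++ nseq k 0%N)).
  by rewrite -(cats0 s); apply: (H s 0); rewrite addn0.
elim: t k => [|a t IH] k /= e; first by rewrite (_ : k = n.+4).
apply: step; first by rewrite size_cat size_nseq; lia.
rewrite -cat1s catA (@mon_perm _ (t ++ nseq k.+1 0%N)); first by apply: IH; lia.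
by rewrite -[k.+1]addn1 addnC nseqD catA perm_cat2r perm_catC.
Qed.

Hypothesis S4 : forall r, S (mon (nseq r.*2 0%N)).
Hypothesis S2 : S (mon [:: 2; 0]%N).
Hypothesis S44 : S (mon [:: 4; 0]%N).
Hypothesis S6 : S (mon [:: 6; 0]%N).

(** At the top weight the pair relation reads [(k+1) X_(k+1) X_M = - (M+1) X_k X_(M+1)], which
    solves to signed binomial coefficients. *)
Lemma mon2_top N k : (k <= N)%N -> (forall i j, (i + j < N)%N -> S (mon [:: i; j])) ->
  S (mon [:: k; N - k]%N - ((-1) ^+ k * 'C(N, k)%:R) *: mon [:: 0%N; N]).
Proof.
move=> kN h; elim: k kN => [|k IH] kN.
  by rewrite bin0 mulr1 scale1r subn0 subrr.
have {}IH := IH (ltnW kN); set M := (N - k.+1)%N.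
have eM : (N - k = M.+1)%N by rewrite /M; lia.
apply: (@subspace_unscale _ _ S k.+1%:R _ Ss); first by rewrite pnatr_eq0.
have hq : S (quadD k M [::]).
  rewrite -[quadD _ _ _]addr0; have := @Squad k M [::] isT.
  by rewrite /quadE big_nil.
have hl := h k M; rewrite /quadD in hq.
have eC : (k.+1%:R : K) * 'C(N, k.+1)%:R = M.+1%:R * 'C(N, k)%:R.
  by rewrite -!natrM -eM mul_bin_left.
have -> : k.+1%:R *: (mon [:: k.+1; M] - ((-1) ^+ k.+1 * 'C(N, k.+1)%:R) *: mon [:: 0%N; N]) =
  ((k + M).+2%:R *: mon [:: k; M] + M.+1%:R *: mon [:: k; M.+1] + k.+1%:R *: mon [:: k.+1; M])
  - (k + M).+2%:R *: mon [:: k; M] 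
  - M.+1%:R *: (mon [:: k; M.+1] - ((-1) ^+ k * 'C(N, k)%:R) *: mon [:: 0%N; N]).
  rewrite !scalerBr !scalerA [k.+1%:R * (_ * _)]mulrCA eC exprS.
  by move: ((-1) ^+ k) ('C(N, k)%:R : K) => e c; rewrite !scale_in_alg; ring.
apply: (subspaceB Ss); last by apply: SZ; rewrite -eM.
apply: (subspaceB Ss); first by [].
by apply: SZ; apply: hl; rewrite /M; lia.
Qed.

(** The highest weight occurs only for [d = i + j + 2], once for each of the two factors available
    for contraction. *)
Lemma quadE_top i j k l :
  (forall a b, (a + b < i + j + 3 + k + l)%N -> S (mon [:: a; b])) ->
  S (quadE i j [:: k; l] -
     (gamma K i j k (i + j).+2 *: mon [:: ((i + j).+2 + k).+1; l] +
      gamma K i j l (i + j).+2 *: mon [:: ((i + j).+2 + l).+1; k])).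
Proof.
move=> h.
have r1 : rem k [:: k; l] = [:: l] by rewrite /= eqxx.
have r2 : rem l [:: k; l] = [:: k] by rewrite /= eqxx; case: eqP => [->|].
rewrite /quadE big_cons big_seq1 r1 r2 2!(@big_ord_recr _ _ _ (i + j).+2) /=.
have e (x y z t : A) : x + y + (z + t) - (y + t) = x + z by ring.
rewrite e; apply: SD; apply: (subspace_sum_seq Ss) => d _; apply: SZ; apply: h; have := ltn_ord d; lia.
Qed.

Lemma quadE_low i j k l :
  (forall a b, (a + b < i + j + 4 + k + l)%N -> S (mon [:: a; b])) ->
  S (quadE i j [:: k; l]).
Proof.
move=> h; apply: (subspaceDr Ss _ (quadE_top _)); last by move=> a b hab; apply: h; lia.
by apply: (subspaceN Ss); apply: SD; apply: SZ; apply: h; lia.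
Qed.

Lemma gamma00 l : gamma K 0 0 l 2 = 2 * l.+1%:R.
Proof. by rewrite /gamma /acoef !binc0 !bin0 binn; ring. Qed.

Lemma gamma11 l : gamma K 1 1 l 4 = - (2 * l.+1%:R * l.+2%:R * (l + 5)%:R).
Proof.
have e : binc (- l.+2%:R : K) 1 = - l.+2%:R.
  by have := bincS (- l.+2%:R : K) 0; rewrite binc0 mul1r subr0 mulr1.
by rewrite /gamma /acoef binn bin1 e; ring.
Qed.

(* The same combination of elements of [O] is therefore quadratic; its leading
   term eliminates [h(-N-1)h(-1)1] for all even [N] except 2, 4 and 6. *)
Lemma quad_relation_degree4 n :
  3%:R *: quadD 0 0 [:: n; 1]%N + 2%:R *: quadD 0 0 [:: n; 2]%N =
  2%:R *: quadD 0 1 [:: n; 0]%N + quadD 1 1 [:: n; 0]%N.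
Proof.
rewrite /quadD.
have tac s t : (forall P, count P s = count P t) -> mon s = mon t.
  by move=> h; apply: mon_perm; apply/permP.
rewrite (tac [:: 0; 0; n; 1]%N [:: 0; 1; n; 0]%N); last by move=> P /=; lia.
rewrite (tac [:: 0; 1; n; 1]%N [:: 1; 1; n; 0]%N); last by move=> P /=; lia.
rewrite (tac [:: 1; 0; n; 1]%N [:: 1; 1; n; 0]%N); last by move=> P /=; lia.
rewrite (tac [:: 0; 0; n; 2]%N [:: 0; 2; n; 0]%N); last by move=> P /=; lia.
rewrite (tac [:: 0; 1; n; 2]%N [:: 1; 2; n; 0]%N); last by move=> P /=; lia.
rewrite (tac [:: 1; 0; n; 2]%N [:: 1; 2; n; 0]%N); last by move=> P /=; lia.
rewrite (tac [:: 2; 1; n; 0]%N [:: 1; 2; n; 0]%N); last by move=> P /=; lia.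
rewrite !scale_in_alg; ring.
Qed.

Lemma top_coef_neq0 n (C2 C5 : K) : (2 < n)%N ->
  2 * C2 = (n + 5)%:R * (n + 4)%:R ->
  120 * C5 = (n + 5)%:R * (n + 4)%:R * (n + 3)%:R * (n + 2)%:R * n.+1%:R ->
  2 * n.+1%:R * n.+2%:R * (n + 5)%:R - 20 * C5 + 4 * n.+1%:R * C2 - 12 * C5 != 0.
Proof.
move=> hn e2 e5; apply/eqP => h.
(* Fifteen times the coefficient in this factored form. The last factor vanishes for a natural [n]
   only at [n = 1], the exceptional value [N = 6]. *)
have /eqP : 4 * n.+1%:R * (n + 5)%:R * (n + 3)%:R * (15 - ((n + 4) * (n + 2))%:R) = 0 :> K.
  apply: etrans (mulr0 15); rewrite -h.
  have -> : C5 = (n + 5)%:R * (n + 4)%:R * (n + 3)%:R * (n + 2)%:R * n.+1%:R / 120.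
    by rewrite -e5; field.
  have -> : C2 = (n + 5)%:R * (n + 4)%:R / 2 by rewrite -e2; field.
  by field.
have e15 : (15 : K) = 15%:R by [].
rewrite !mulf_eq0 !addnS !pnatr_eq0 /= subr_eq0 e15 eqr_nat => /eqP; lia.
Qed.

Lemma span_mon2 N i j : (i + j = N)%N -> S (mon [:: i; j]).
Proof.
elim/ltn_ind: N i j => N IH.
have {}IH a b : (a + b < N)%N -> S (mon [:: a; b]) by move=> h; apply: (IH _ h).
pose T := mon [:: 0%N; N].
suff ST : S T.
  move=> i j e; have iN : (i <= N)%N by lia.
  rewrite (_ : j = (N - i)%N); last by lia.
  apply: (subspaceDr Ss _ (mon2_top iN IH)).
  by apply: (subspaceN Ss); apply: SZ.
(* For odd [N] the case [k = N] of [mon2_top], combined with the symmetry of the pair, gives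
   [T = - T] modulo [S]. *)
have [oN|eN] := boolP (odd N).
  have := mon2_top (leqnn N) IH; rewrite subnn binn mulr1 -signr_odd oN expr1 scaleN1r opprK.
  rewrite mon_swap2 -/T -mulr2n -scaler_nat.
  by apply: (subspace_unscale Ss); rewrite pnatr_eq0.
have [N8|N8] := ltnP N 8.
  rewrite /T mon_swap2.
  by case: N N8 eN {IH T} => [|[|[|[|[|[|[|[|]]]]]]]] //= _ _; [exact: (S4 1)].
(* With this [n] the top terms of [quadE 1 1 [:: n; 0]] and [quadE 0 0 [:: n; 2]] have index sum
   [N], while the other two elements of the relation have only lower contraction terms. *)
pose n := (N - 5)%N; have eN5 : N = (n + 5)%N by rewrite /n; lia.
have n2 : (2 < n)%N by rewrite /n; lia.
have e5 : S (mon [:: 5%N; n] + 'C(N, 5)%:R *: T).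
  have h : (5 <= N)%N by lia.
  have := mon2_top h IH; rewrite -/n (_ : (-1) ^+ 5 = -1 :> K); last by ring.
  by rewrite mulN1r scaleNr opprK.
have e2 : S (mon [:: n + 3; 2]%N - 'C(N, 2)%:R *: T).
  have h : (2 <= N)%N by lia.
  have := mon2_top h IH; rewrite (_ : N - 2 = n + 3)%N; last by lia.
  by rewrite mon_swap2 sqrrN expr1n mul1r.
have q i j k l : S (quadD i j [:: k; l] + quadE i j [:: k; l]) by apply: Squad.
have l01 : S (quadE 0 1 [:: n; 0%N]) by apply: quadE_low => a b h; apply: IH; lia.
have l00 : S (quadE 0 0 [:: n; 1%N]) by apply: quadE_low => a b h; apply: IH; lia.
have t11 : S (quadE 1 1 [:: n; 0%N] -
    (- (2 * n.+1%:R * n.+2%:R * (n + 5)%:R) *: T - 20 *: mon [:: 5%N; n])).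
  have h11 : forall a b, (a + b < 1 + 1 + 3 + n + 0)%N -> S (mon [:: a; b]).
    by move=> a b h; apply: IH; lia.
  have := quadE_top h11; rewrite (gamma11 n : gamma K 1 1 n (1 + 1).+2 = _).
  rewrite (gamma11 0 : gamma K 1 1 0 (1 + 1).+2 = _) (_ : ((1 + 1).+2 + n).+1 = N); last by lia.
  rewrite mon_swap2 -/T (_ : - (2 * 1%:R * 2%:R * (0 + 5)%:R) = - 20 :> K); last by ring.
  by rewrite (scaleNr 20).
have t00 : S (quadE 0 0 [:: n; 2%N] -
    ((2 * n.+1%:R) *: mon [:: n + 3; 2]%N + 6 *: mon [:: 5%N; n])).
  have h00 : forall a b, (a + b < 0 + 0 + 3 + n + 2)%N -> S (mon [:: a; b]).
    by move=> a b h; apply: IH; lia.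
  have := quadE_top h00; rewrite (gamma00 n : gamma K 0 0 n (0 + 0).+2 = _).
  rewrite (gamma00 2 : gamma K 0 0 2 (0 + 0).+2 = _) (_ : ((0 + 0).+2 + n).+1 = (n + 3)%N); last by lia.
  by rewrite (_ : 2 * 3%:R = 6 :> K); last by ring.
have C2 : 2 * 'C(N, 2)%:R = (n + 5)%:R * (n + 4)%:R :> K.
  have := bin_ffact N 2; rewrite !ffactnS ffactn0 muln1 => e.
  by rewrite -!natrM mulnC e; congr (_%:R); lia.
have C5 : 120 * 'C(N, 5)%:R =
    (n + 5)%:R * (n + 4)%:R * (n + 3)%:R * (n + 2)%:R * n.+1%:R :> K.
  have := bin_ffact N 5; rewrite !ffactnS ffactn0 muln1 => e.
  by rewrite -!natrM mulnC e; congr (_%:R); rewrite eN5 !addnS /= addn0 !mulnA.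
apply: (subspace_unscale Ss (top_coef_neq0 n2 C2 C5)).
have hZ := quad_relation_degree4 n.
move: hZ t11 t00 e2 e5 l01 l00 (q 0%N 0%N n 1%N) (q 0%N 0%N n 2%N) (q 0%N 1%N n 0%N) (q 1%N 1%N n 0%N).
move: (quadD 0 0 [:: n; 1%N]) (quadD 0 0 [:: n; 2%N]) (quadD 0 1 [:: n; 0%N]) (quadD 1 1 [:: n; 0%N]).
move: (quadE 0 0 [:: n; 1%N]) (quadE 0 0 [:: n; 2%N]) (quadE 0 1 [:: n; 0%N]) (quadE 1 1 [:: n; 0%N]).
move=> E001 E002 E01 E11 D001 D002 D01 D11 hZ t11 t00 e2 e5 l01 l00 q001 q002 q01 q11.
move: t11 t00 e2 e5; move: T (mon [:: n + 3; 2]%N) (mon [:: 5%N; n]) => t x y t11 t00 e2 e5.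
move: (n.+1%:R : K) (n.+2%:R : K) ((n + 5)%:R : K) ('C(N, 5)%:R : K) ('C(N, 2)%:R : K) t11 t00 e2 e5.
move=> n1 n2' n5 c5 c2 t11 t00 e2 e5.
(* The relation cancels the quartic parts and leaves [E11 - 2 *: E002] modulo [S]. Both remaining
   pairs are then expressed through [T]; [32 = 20 + 2 * 6] collects the two occurrences of [mon
   [:: 5; n]]. *)
have -> : (2 * n1 * n2' * n5 - 20 * c5 + 4 * n1 * c2 - 12 * c5) *: t =
  (E11 - (- (2 * n1 * n2' * n5) *: t - 20 *: y))
  - 2 *: (E002 - ((2 * n1) *: x + 6 *: y)) - (4 * n1) *: (x - c2 *: t) - 32 *: (y + c5 *: t)
  - (D11 + E11) - 2 *: (D01 + E01) + 3 *: (D001 + E001) + 2 *: (D002 + E002)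
  + 2 *: E01 - 3 *: E001.
  have {}hZ : D11 = 3%:R *: D001 + 2%:R *: D002 - 2%:R *: D01 by rewrite hZ addrAC subrr add0r.
  by rewrite hZ !scale_in_alg; ring.
by do ?[assumption|apply: SD|apply: SZ|apply: (subspaceN Ss)].
Qed.
Lemma span_mon_even s : ~~ odd (size s) -> S (mon s).
Proof.
move=> es.
have : size s = (size s)./2.*2 by rewrite -[LHS]odd_double_half (negPf es).
move: (size s)./2 => r; elim: r s {es} => [|r IH] s; first by case: s => // _; apply: (S4 0).
case: r IH => [|r] IH hs.
  by case: s hs => [|a [|b []]] // _; apply: (@span_mon2 _ a b erefl).
apply: (span_mon_ge4 _ hs IH (S4 r.+2)).
by rewrite odd_double.
Qed.

End Reduction.

(** * Polynomials in two variables *)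

Lemma monomial_ind (A : pzSemiRingType) (P : A -> Prop) (x y : A) (i j : nat) : P 1 ->
  (forall f, P f -> P (x * f)) -> (forall f, P f -> P (y * f)) -> P (x ^+ i * y ^+ j).
Proof.
move=> P1 Px Py; elim: i => [|i IH]; last by rewrite exprS -mulrA; apply: Px.
by rewrite mul1r; elim: j => // j IH; rewrite exprS; apply: Py.
Qed.

Section BivariatePolynomials.
Variable K : numFieldType.
Local Notation x := (px K).
Local Notation y := (py K).
Implicit Types (f g : Pol K).

Lemma pol_monomial (m : cmonom 'I_2) : << m >> = x ^+ m 0 * y ^+ m 1 :> Pol K.
Proof.
have UU (a b : cmonom 'I_2) : << a >> * << b >> = << mmul a b >> :> Pol K.
  by rewrite malgM_def fgmulUU mulr1.
have UX (a : cmonom 'I_2) n : << a >> ^+ n = << iter n (mmul a) mone >> :> Pol K.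
  elim: n => [|n IH]; first by rewrite expr0.
  rewrite iterS -UU -IH; exact: exprS.
have e : m = mmul (iter (m 0) (mmul (ucm 0)) mone) (iter (m 1) (mmul (ucm 1)) mone).
  have hi (a : cmonom 'I_2) n i : iter n (mmul a) mone i = (n * a i)%N.
    by elim: n => [|n IH]; rewrite ?cm1 // iterS cmM IH mulSn.
  apply/eqP/cmP => i; rewrite cmM !hi !cmU.
  case: i => -[|[|]] //= p; rewrite ?muln1 ?muln0 ?addn0 ?add0n;
    by congr (m _); apply/val_inj.
rewrite {1}e -UU -!UX; reflexivity.
Qed.

Lemma pol_ind (P : Pol K -> Prop) : P 1 -> (forall f, P f -> P (x * f)) ->
  (forall f, P f -> P (y * f)) -> (forall f g, P f -> P g -> P (f + g)) ->
  (forall a f, P f -> P (a *: f)) -> forall f, P f.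
Proof.
move=> P1 Px Py PD PZ f.
have P0 : P 0 by rewrite -(scale0r 1); apply: PZ.
have e := monalgE f; rewrite e {e}.
apply: (big_ind P); [exact: P0|exact: PD|move=> m _].
have -> : << f@_m *g m >> = f@_m *: << m >> :> Pol K.
  by refine (proj1 (malgP _ _) _) => k; rewrite mcoeffU mcoeffZ mcoeffU1 mulr_natr.
apply: PZ; rewrite pol_monomial; 
exact (@monomial_ind (Pol K) P x y (m 0) (m 1) P1 Px Py).
Qed.

Section Evaluation.
Variables (S : comNzRingType) (h : {rmorphism K -> S}) (a b : S).

Definition pmono (m : cmonom 'I_2) : S := a ^+ m 0 * b ^+ m 1.

Lemma pmono_mmorphism : mmorphism pmono.
Proof.
split=> [m m'|]; rewrite /pmono; first by rewrite !cmM !exprD mulrACA.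
by rewrite !cm1 !expr0 mulr1.
Qed.
HB.instance Definition _ := isMultiplicative.Build _ _ pmono pmono_mmorphism.

Definition peval : {rmorphism Pol K -> S} :=
  GRing.RMorphism.clone _ _ (mmap h pmono) _.

Lemma pevalX : peval x = a.
Proof.
rewrite /= /px mmapU; refine (etrans (congr2 *%R (rmorph1 h) erefl) _).
by rewrite mul1r /pmono !cmU expr1 expr0 mulr1.
Qed.
Lemma pevalY : peval y = b.
Proof.
rewrite /= /py mmapU; refine (etrans (congr2 *%R (rmorph1 h) erefl) _).
by rewrite mul1r /pmono !cmU expr1 expr0 mul1r.
Qed.
Lemma pevalZ c f : peval (c *: f) = h c * peval f.
Proof. exact: mmapZ. Qed.
End Evaluation.
End BivariatePolynomials.

(** * The three isolated points *)

Section Points.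
Variable K : numFieldType.

Definition ptx (i : option bool) : K :=
  match i with None => 1 | Some false => 16%:R^-1 | Some true => 9%:R / 16%:R end.
Definition pty (i : option bool) : K :=
  match i with None => - 6 | Some false => 3 / 128 | Some true => - (45 / 128) end.

Lemma ptx_uniq : uniq [seq ptx i | i <- [:: None; Some false; Some true]].
Proof.
have h (a b c : K) : a - b = c -> c != 0 -> (a == b) = false.
  by move=> e; rewrite -e subr_eq0 => /negPf.
have e1 : (1 == 16%:R^-1 :> K) = false.
  by apply: (h _ _ (15 / 16)); [field|rewrite mulf_eq0 invr_eq0 !pnatr_eq0].
have e2 : (1 == 9%:R / 16%:R :> K) = false.
  by apply: (h _ _ (7 / 16)); [field|rewrite mulf_eq0 invr_eq0 !pnatr_eq0].
have e3 : (16%:R^-1 == 9%:R / 16%:R :> K) = false.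
  by apply: (h _ _ (- (8 / 16))); [field|rewrite oppr_eq0 mulf_eq0 invr_eq0 !pnatr_eq0].
by rewrite /= !inE e1 e2 e3.
Qed.

Lemma curve_pt_neq0 i : pty i + ptx i - 4%:R * ptx i ^+ 2 != 0.
Proof.
case: i => [[]|] /=.
- have -> : - (45 / 128) + 9%:R / 16%:R - 4%:R * (9%:R / 16%:R) ^+ 2 = - (135 / 128) :> K by field.
  by rewrite oppr_eq0 mulf_eq0 invr_eq0 !pnatr_eq0.
- have -> : 3 / 128 + 16%:R^-1 - 4%:R * 16%:R^-1 ^+ 2 = 9 / 128 :> K by field.
  by rewrite mulf_eq0 invr_eq0 !pnatr_eq0.
- have -> : - 6 + 1 - 4%:R * 1 ^+ 2 = - 9 :> K by ring.
  by rewrite oppr_eq0 pnatr_eq0.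
Qed.

(** The second factor of [polyP] is the interpolation parabola through the three isolated points,
    cleared of denominators. *)
Lemma conic_pt i :
  70%:R * pty i + 908%:R * ptx i ^+ 2 - 515%:R * ptx i + 27%:R = 0.
Proof. by case: i => [[]|] /=; field. Qed.

Lemma ptx_root i : (ptx i - 1) * (ptx i - 16%:R^-1) * (ptx i - 9%:R / 16%:R) = 0.
Proof. by case: i => [[]|] /=; rewrite subrr !(mul0r, mulr0). Qed.

Lemma interpolation (b : option bool -> K) : exists r : {poly K}, forall i, r.[ptx i] = b i.
Proof.
pose l (i j k : option bool) : {poly K} :=
  (b i / ((ptx i - ptx j) * (ptx i - ptx k))) *: (('X - (ptx j)%:P) * ('X - (ptx k)%:P)).
exists (l None (Some false) (Some true) + l (Some false) None (Some true)
        + l (Some true) None (Some false)).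
by case=> [[]|]; rewrite /l !hornerE /=; field.
Qed.

(** The values [n^2 / 2] are pairwise distinct in characteristic zero, so they exceed the number of
    roots of any nonzero polynomial. *)
Lemma poly_eq0_squares (g : {poly K}) : (forall n : nat, g.[n%:R ^+ 2 / 2] = 0) -> g = 0.
Proof.
move=> h; apply/eqP; apply: contraTT isT => g0.
pose rs : seq K := [seq n%:R ^+ 2 / 2 | n <- iota 0 (size g)].
have := max_poly_roots g0 (_ : all (root g) rs) (_ : uniq rs).
rewrite size_map size_iota ltnn; apply.
  by apply/allP => z /mapP [n _ ->]; apply/eqP/h.
rewrite map_inj_uniq ?iota_uniq // => m n.
have h2 : (2 : K) != 0 by rewrite pnatr_eq0.
move=> /(mulIf (invr_neq0 h2)) /eqP; rewrite -!natrX eqr_nat eqn_exp2r //.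
by move/eqP.
Qed.

End Points.

(** * The ideal of the parabola and the three points *)

Section Ideal.
Variables (K : numFieldType) (A : comAlgType K) (x y : A).
Hypothesis gen_ind : forall P : A -> Prop, P 1 -> (forall f, P f -> P (x * f)) ->
  (forall f, P f -> P (y * f)) -> (forall f g, P f -> P g -> P (f + g)) ->
  (forall (a : K) f, P f -> P (a *: f)) -> forall f, P f.
Variables (pc : {rmorphism A -> {poly K}}) (pt : option bool -> {rmorphism A -> K}).
Hypotheses (pcZ : forall a f, pc (a *: f) = a%:P * pc f) (pcx : pc x = 'X).
Hypothesis pcy : pc y = 4%:R *: 'X^2 - 'X.
Hypotheses (ptZ : forall i a f, pt i (a *: f) = a * pt i f).
Hypotheses (ptX : forall i, pt i x = ptx K i) (ptY : forall i, pt i y = pty K i).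

Let C : A := y + x - 4%:R *: x ^+ 2.
Let D : A := 70%:R *: y + 908%:R *: x ^+ 2 - 515%:R *: x + in_alg A 27%:R.
Let E : A := (x - 1) * (x - in_alg A 16%:R^-1) * (x - in_alg A (9%:R / 16%:R)).
Local Notation U := (horner_alg x).

Let UX q : U ('X * q) = x * U q. Proof. by rewrite rmorphM /= horner_algX. Qed.

Let UM q r : U (q * r) = U q * U r. Proof. exact: rmorphM. Qed.
Let UD q r : U (q + r) = U q + U r. Proof. exact: rmorphD. Qed.
Let UB q r : U (q - r) = U q - U r. Proof. exact: rmorphB. Qed.
Let UZ a q : U (a *: q) = a *: U q. Proof. by rewrite -mul_polyC UM horner_algC mulr_algl. Qed.
Let U1 : U 1 = 1. Proof. exact: rmorph1. Qed.

Let sc (a : K) (u : A) : a *: u = in_alg A a * u. Proof. by rewrite mulr_algl. Qed.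

Lemma curve_decomposition f : exists g q, f = C * g + U q.
Proof.
move: f; apply: gen_ind.
- by exists 0, 1; rewrite mulr0 add0r U1.
- by move=> f [g [q ->]]; exists (x * g), ('X * q); rewrite UX; ring.
- move=> f [g [q ->]]; exists (y * g + U q), ('X * ('X * (4%:R *: q)) - 'X * q).
  by rewrite UB !UX UZ /C !sc; ring.
- move=> _ _ [g [q ->]] [g' [q' ->]]; exists (g + g'), (q + q').
  by rewrite UD; ring.
- move=> a _ [g [q ->]]; exists (a *: g), (a *: q).
  by rewrite UZ !sc; ring.
Qed.

Lemma conic_decomposition f : exists g q, f = D * g + U q.
Proof.
have c70 : in_alg A 70%:R * in_alg A 70%:R^-1 = 1.
  by rewrite -rmorphM mulfV ?rmorph1 // pnatr_eq0.
move: f; apply: gen_ind.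
- by exists 0, 1; rewrite mulr0 add0r U1.
- by move=> f [g [q ->]]; exists (x * g), ('X * q); rewrite UX; ring.
- move=> f [g [q ->]]; exists (y * g + 70%:R^-1 *: U q),
    (70%:R^-1 *: (515%:R *: ('X * q) - 908%:R *: ('X * ('X * q)) - 27%:R *: q)).
  rewrite UZ !UB !UZ !UX !sc.
  have -> : y * (D * g + U q) = D * y * g + y * (in_alg A 70%:R * in_alg A 70%:R^-1) * U q.
    by rewrite c70; ring.
  by rewrite /D !sc; ring.
- move=> _ _ [g [q ->]] [g' [q' ->]]; exists (g + g'), (q + q').
  by rewrite UD; ring.
- move=> a _ [g [q ->]]; exists (a *: g), (a *: q).
  by rewrite UZ !sc; ring.
Qed.

Let pcU q : pc (U q) = q.
Proof.
elim/poly_ind: q => [|q c IH]; first by rewrite !rmorph0.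
rewrite UD mulrC UX rmorphD rmorphM IH pcx horner_algC pcZ rmorph1 mulr1.
by rewrite mulrC.
Qed.

Let ptU i q : pt i (U q) = q.[ptx K i].
Proof.
elim/poly_ind: q => [|q c IH]; first by rewrite !rmorph0 horner0.
rewrite UD mulrC UX rmorphD rmorphM IH ptX horner_algC ptZ rmorph1 mulr1.
by rewrite !hornerE mulrC.
Qed.

Let pcC : pc C = 0.
Proof.
rewrite /C !(rmorphB, rmorphD) /= pcZ rmorphXn pcx pcy -mul_polyC; ring.
Qed.

Let ptC i : pt i C = pty K i + ptx K i - 4%:R * ptx K i ^+ 2.
Proof. by rewrite /C rmorphB rmorphD /= ptZ rmorphXn /= ptX ptY. Qed.

Let ptD i : pt i D = 0.
Proof.
rewrite /D !(rmorphB, rmorphD) /= !ptZ rmorphXn /= ptX ptY rmorph1 mulr1.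
exact: conic_pt.
Qed.

(** Both [C] and [D] are linear in [y] with invertible leading coefficient. Vanishing on the
    parabola makes [f] a multiple [C * g]. Dividing [g] by [D] leaves a polynomial in [x], which
    must vanish at the three abscissas because there [D] is zero and [C] is not. *)
Lemma ideal_characterization f :
  (exists a b, f = a * (C * D) + b * (E * C)) <-> (pc f = 0 /\ forall i, pt i f = 0).
Proof.
split=> [[a [b ->]]|[h1 h2]].
  rewrite rmorphD !rmorphM pcC !(mulr0, mul0r) addr0; split=> // i.
  rewrite rmorphD 4!rmorphM ptD !mulr0 add0r.
  have -> : pt i E = 0; last by rewrite mul0r mulr0.
  have pta c : pt i (in_alg A c) = c by rewrite ptZ rmorph1 mulr1.
  rewrite /E 2!rmorphM 3!rmorphB !pta ptX rmorph1.
  exact: ptx_root.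
have [g [q e]] := curve_decomposition f.
have q0 : q = 0.
  by move: h1; rewrite e rmorphD rmorphM pcC mul0r add0r pcU.
rewrite q0 (rmorph0 U : U 0 = 0) addr0 in e.
have [g' [r e']] := conic_decomposition g.
have r0 i : r.[ptx K i] = 0.
  have := h2 i; rewrite e e' rmorphM [pt i (_ + U r)]rmorphD
    [pt i (D * _)]rmorphM ptU ptD mul0r add0r => /eqP.
  by rewrite ptC mulf_eq0 (negPf (curve_pt_neq0 _ i)) /= => /eqP.
have := @uniq_roots_dvdp K r [seq ptx K i | i <- [:: None; Some false; Some true]].
rewrite uniq_rootsE ptx_uniq => dv.
have /dvdpP [r' er] : (\prod_(z <- [seq ptx K i | i <- [:: None; Some false; Some true]]) ('X - z%:P)) %| r.
  by apply: dv => //; apply/allP => z /mapP [i _ ->]; apply/eqP/r0.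
exists g', (U r'); rewrite e e' er !big_cons big_nil mulr1 !UM !UB horner_algX !horner_algC.
by rewrite /E !sc /ptx; ring.
Qed.

(** A multiple of [C] changes the values at the isolated points freely, since [C] is nonzero there,
    and leaves the restriction to the parabola unchanged. *)
Lemma curve_points_interpolation (g : {poly K}) (b : option bool -> K) :
  exists f, pc f = g /\ forall i, pt i f = b i.
Proof.
have [r hr] := interpolation (fun i => (b i - g.[ptx K i]) / pt i C).
exists (U g + C * U r); split; first by rewrite rmorphD rmorphM pcC mul0r addr0 pcU.
move=> i; have c0 : pt i C != 0 by rewrite ptC curve_pt_neq0.
rewrite rmorphD [pt i (C * _)]rmorphM !ptU hr [pt i C * _]mulrC (divfK c0).
exact: subrKC.
Qed.
End Ideal.

(** * The presentation *)

Section Assembly.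
Variables (K : numFieldType) (A B : comAlgType K) (P O : A -> Prop) (star : A -> A -> A).
Variables (ev : K -> A -> K) (phi : option bool -> A -> K) (d : option bool -> A) (w J : A).
Hypothesis ev_linear : forall t a u v, ev t (a *: u + v) = a * ev t u + ev t v.
Hypothesis phi_linear : forall i a u v, phi i (a *: u + v) = a * phi i u + phi i v.
Hypothesis ev_O : forall t v, O v -> ev t v = 0.
Hypothesis phi_O : forall i v, O v -> phi i v = 0.
Hypothesis PP : forall (a : K) u v, P u -> P v -> P (a *: u + v).
Hypothesis P_star : forall u v, P u -> P v -> P (star u v).
Hypothesis ev_star : forall t u v, P u -> P v -> ev t (star u v) = ev t u * ev t v.
Hypothesis phi_star : forall i u v, P u -> P v -> phi i (star u v) = phi i u * phi i v.
Hypotheses (P_d : forall i, P (d i)) (ev_d : forall t i, ev t (d i) = 0).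
Hypothesis phi_d : forall i j, phi i (d j) = (i == j)%:R.
Hypotheses (P_w : forall g, P (horner_alg w g)) (P_J : P J).
Hypothesis ev_w : forall t g, ev t (horner_alg w g) = g.[t ^+ 2 / 2].
Hypothesis ev_J : forall t, ev t J = t ^+ 4 - t ^+ 2 / 2.
Hypotheses (phi_1 : forall i, phi i 1 = 1) (phi_w : forall i, phi i w = ptx K i).
Hypothesis phi_J : forall i, phi i J = pty K i.
Hypothesis span : forall v, P v -> exists g c,
  O (v - (horner_alg w g + \sum_i c i *: d i)).

Variables (x y : B) (pc : {rmorphism B -> {poly K}}) (pt : option bool -> {rmorphism B -> K}).
Hypotheses (pcZ : forall a f, pc (a *: f) = a%:P * pc f) (pcx : pc x = 'X).
Hypothesis pcy : pc y = 4%:R *: 'X^2 - 'X.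
Hypotheses (ptZ : forall i a f, pt i (a *: f) = a * pt i f).
Hypotheses (ptX : forall i, pt i x = ptx K i) (ptY : forall i, pt i y = pty K i).
Hypothesis interpolate : forall g b, exists f, pc f = g /\ forall i, pt i f = b i.
Variable I : B -> Prop.
Hypothesis IE : forall f, I f <-> pc f = 0 /\ forall i, pt i f = 0.

Let ev0 t : ev t 0 = 0.
Proof. by have := ev_linear t (-1) 0 0; rewrite scaler0 add0r mulN1r addNr. Qed.
Let phi0 i : phi i 0 = 0.
Proof. by have := phi_linear i (-1) 0 0; rewrite scaler0 add0r mulN1r addNr. Qed.
Let evD t u v : ev t (u + v) = ev t u + ev t v.
Proof. by rewrite -[u in LHS]scale1r ev_linear mul1r. Qed.
Let phiD i u v : phi i (u + v) = phi i u + phi i v.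
Proof. by rewrite -[u in LHS]scale1r phi_linear mul1r. Qed.
Let evZ t a u : ev t (a *: u) = a * ev t u.
Proof. by rewrite -[a *: u]addr0 ev_linear ev0 addr0. Qed.
Let phiZ i a u : phi i (a *: u) = a * phi i u.
Proof. by rewrite -[a *: u]addr0 phi_linear phi0 addr0. Qed.
Let evB t u v : ev t (u - v) = ev t u - ev t v.
Proof. by rewrite evD -scaleN1r evZ mulN1r. Qed.
Let phiB i u v : phi i (u - v) = phi i u - phi i v.
Proof. by rewrite phiD -scaleN1r phiZ mulN1r. Qed.

Let P0 : P 0. Proof. by rewrite -(rmorph0 (horner_alg w)); apply: P_w. Qed.
Let PD u v : P u -> P v -> P (u + v).
Proof. by move=> hu hv; rewrite -[u]scale1r; apply: PP. Qed.
Let PZ a u : P u -> P (a *: u).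
Proof. by move=> hu; rewrite -[a *: u]addr0; apply: PP. Qed.
Let PB u v : P u -> P v -> P (u - v).
Proof. by move=> hu hv; rewrite -scaleN1r; apply: PD => //; apply: PZ. Qed.

Let dsum (c : option bool -> K) := \sum_i c i *: d i.

Let P_dsum c : P (dsum c).
Proof. by apply: (big_ind P) => // i _; apply: PZ. Qed.

Let ev_dsum t c : ev t (dsum c) = 0.
Proof.
apply: (big_ind (fun v => ev t v = 0)) => // [u v hu hv|i _]; first by rewrite evD hu hv addr0.
by rewrite evZ ev_d mulr0.
Qed.

Let phi_dsum i c : phi i (dsum c) = c i.
Proof.
have -> : phi i (dsum c) = \sum_j c j * (i == j)%:R.
  rewrite /dsum (big_morph _ (phiD i) (phi0 i)).
  by apply: eq_bigr => j _; rewrite phiZ phi_d.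
rewrite (bigD1 i) //= eqxx mulr1 big1 ?addr0 // => j ne.
by rewrite eq_sym (negPf ne) mulr0.
Qed.

(** In the form given by [span], the functionals [ev t] determine the polynomial part through
    infinitely many values; once it is zero, [phi i] reads off the coefficient of [d i]. *)
Lemma kernel v : P v -> (forall t, ev t v = 0) -> (forall i, phi i v = 0) -> O v.
Proof.
move=> hP he hp; have [g [c hO]] := span hP.
have g0 : g = 0.
  apply: poly_eq0_squares => n; have := ev_O n%:R hO.
  by rewrite evB evD he ev_w [ev _ _]ev_dsum addr0 add0r => /eqP; rewrite oppr_eq0 => /eqP.
have c0 : dsum c = 0.
  rewrite /dsum big1 // => i _; have := phi_O i hO; rewrite g0 rmorph0 add0r.
  rewrite phiB hp [phi i (\sum_j _)]phi_dsum add0r => /eqP; rewrite oppr_eq0 => /eqP ->.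
  by rewrite scale0r.
by move: hO; rewrite g0 rmorph0 [\sum_i _]c0 addr0 subr0.
Qed.

Lemma kernel_eq u v : P u -> P v -> (forall t, ev t u = ev t v) -> (forall i, phi i u = phi i v) ->
  O (u - v).
Proof.
move=> hu hv he hp; apply: kernel => [|t|i]; first exact: PB.
  by rewrite evB he subrr.
by rewrite phiB hp subrr.
Qed.

(** [horner_alg w] uses the commutative product of [A], in the application the polynomial product of
    [M(1)] and not [*]. It has the right values under every [ev t]; the dual vectors, invisible to
    [ev t], repair the values under [phi i]. *)
Definition lift f : A :=
  horner_alg w (pc f) + dsum (fun i => pt i f - phi i (horner_alg w (pc f))).

Let P_lift f : P (lift f). Proof. exact: PD. Qed.

Let ev_lift t f : ev t (lift f) = (pc f).[t ^+ 2 / 2].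
Proof. by rewrite evD ev_dsum addr0 ev_w. Qed.

Let phi_lift i f : phi i (lift f) = pt i f.
Proof. by rewrite phiD phi_dsum subrKC. Qed.

Lemma presentation :
  [/\ (forall f, P (lift f)),
      (forall (a : K) f g, O (lift (a *: f + g) - (a *: lift f + lift g))),
      [/\ O (lift 1 - 1), O (lift x - w) & O (lift y - J)],
      (forall f g, O (lift (f * g) - star (lift f) (lift g))) /\
      (forall f, O (lift f) <-> I f) &
      (forall v, P v -> exists f, O (v - lift f))]
  /\ (forall u v, P u -> P v -> O (star u v - star v u)).
Proof.
have P1 : P 1 by rewrite -(rmorph1 (horner_alg w)); apply: P_w.
have Pw : P w by rewrite -(horner_algX w); apply: P_w.
have ev1 t : ev t 1 = 1.
  by rewrite -(rmorph1 (horner_alg w)) [LHS]ev_w hornerC.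
have evw t : ev t w = t ^+ 2 / 2 by rewrite -(horner_algX w) ev_w hornerX.
split; last first.
  move=> u v hu hv; apply: kernel_eq; try exact: P_star.
    by move=> t; rewrite !ev_star // mulrC.
  by move=> i; rewrite !phi_star // mulrC.
split=> //.
- move=> a f g; apply: kernel_eq => // [|t|i]; first exact: PP.
    by rewrite ev_linear !ev_lift rmorphD /= pcZ !hornerE.
  by rewrite phi_linear !phi_lift rmorphD /= ptZ.
- split; apply: kernel_eq => // [t|i].
  + by rewrite ev_lift rmorph1 hornerC ev1.
  + by rewrite phi_lift rmorph1 phi_1.
  + by rewrite ev_lift pcx hornerX evw.
  + by rewrite phi_lift ptX phi_w.
  + by rewrite ev_lift pcy ev_J hornerD hornerN hornerZ hornerXn hornerX; field.
  + by rewrite phi_lift ptY phi_J.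
- split=> [f g|f].
    apply: kernel_eq => // [|t|i]; first exact: P_star.
      by rewrite ev_star // !ev_lift rmorphM hornerM.
    by rewrite phi_star // !phi_lift rmorphM.
  rewrite IE; split=> [hO|[h1 h2]].
    split; last by move=> i; rewrite -phi_lift phi_O.
    by apply: poly_eq0_squares => n; rewrite -ev_lift ev_O.
  by apply: kernel => // [t|i]; rewrite ?ev_lift ?phi_lift ?h1 ?horner0.
move=> v hv; have [g [c hO]] := span hv.
have [f [f1 f2]] := interpolate g (fun i => phi i v).
exists f; apply: kernel_eq => // [t|i]; last by rewrite phi_lift f2.
have /eqP := ev_O t hO; rewrite evB evD ev_w [ev _ (\sum_i _)]ev_dsum addr0 subr_eq0 => /eqP ->.
by rewrite ev_lift f1.
Qed.
End Assembly.

(** * Functionals on O and parity of Zhu's product *)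

Section CharactersOfZhuAlgebra.
Variable K : numFieldType.
Local Notation mon := (mon K).
Local Notation Yt := (Yt K).
Implicit Types (s : seq nat) (u v w : M1 K) (phi : {linear M1 K -> K^o}).

Lemma linear_linext phi (F : cmonom nat -> M1 K) v :
  phi (linext F v) = \sum_(m <- msupp v) v@_m * phi (F m).
Proof. by rewrite /linext linear_sum; apply: eq_bigr => m _; rewrite linearZ. Qed.

Lemma linear_basis phi v : phi v = \sum_(m <- msupp v) v@_m * phi (mon (mlist m)).
Proof.
rewrite {1}[v]malg_basis linear_sum; apply: eq_bigr => m _.
by rewrite mon_mlist linearZ.
Qed.

Lemma zhu_char_circ phi k u v : zhu_char phi -> homog K k u -> inVplus K u -> inVplus K v ->
  phi (zcirc K k u v) = 0.
Proof.
move=> hphi hu /inVplusP eu /inVplusP ev; rewrite (zcircE _ hu) linear_linext.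
rewrite big1_seq // => m /= mu; rewrite linear_linext big1_seq ?mulr0 // => m' /= mv.
have e := proj1 (hphi (mlist m) (mlist m') (eu m mu) (ev m' mv)).
exact: (etrans (congr1 ( *%R v@_m') e) (mulr0 _)).
Qed.

Lemma zhu_char_inO phi v : zhu_char phi -> inO K v -> phi v = 0.
Proof.
move=> hphi [r [hr ->]]; rewrite linear_sum big1_seq // => t /= /hr [h1 h2 h3].
by rewrite linearZ (zhu_char_circ hphi h1 h2 h3); exact: mulr0.
Qed.

Lemma zhu_char_star phi u v : zhu_char phi -> inVplus K u -> inVplus K v ->
  phi (star K u v) = phi u * phi v.
Proof.
move=> hphi /inVplusP eu /inVplusP ev; rewrite starE linear_linext [phi u]linear_basis mulr_suml.
apply: eq_big_seq => m mu; rewrite linear_linext -mulrA; congr (_ * _).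
rewrite [phi v]linear_basis mulr_sumr; apply: eq_big_seq => m' mv.
have [_ ->] := hphi _ _ (eu _ mu) (ev _ mv); exact: mulrCA.
Qed.

(** The span of the monomials of one parity, encoded as membership in every subspace that contains
    them; this is directly an induction principle. *)
Definition parity (b : bool) v := forall S : M1 K -> Prop, subspace S ->
  (forall s, odd (size s) = b -> S (mon s)) -> S v.

Lemma parity_subspace b : subspace (parity b).
Proof.
split=> [S [] //|u v hu hv S hS h|a v hv S hS h]; case: (hS) => S0 SD SZ.
  by apply: SD; [apply: hu|apply: hv].
by apply: (SZ); apply: hv.
Qed.

Lemma parity_mon s : parity (odd (size s)) (mon s).
Proof. by move=> S _; apply. Qed.

Lemma parity_hvar b k v : parity b v -> parity (~~ b) (hvar K k * v).
Proof.
move=> hv S [S0 SD SZ] h; apply: (hv (fun v => S (hvar K k * v))).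
  split=> [|x y hx hy|a x hx]; first by rewrite mulr0.
    by rewrite mulrDr; apply: SD.
  by rewrite -scalerAr; apply: (SZ).
by move=> s hs; rewrite -mon_cons; apply: h => /=; rewrite hs.
Qed.

Lemma parity_Yt (u : seq nat) n s : parity (odd (size u) (+) odd (size s)) (Yt u n s).
Proof.
elim: u n s => [|k u IH] n s.
  have [p0 _ _] := parity_subspace (odd (size s)).
  by rewrite /=; case: (n == wt s); [exact: parity_mon|exact: p0].
have ps := parity_subspace (odd (size (k :: u)) (+) odd (size s)).
have [p0 pD pZ] := ps; rewrite /=; apply: pD.
  apply: (subspace_sum _ ps) => m _; apply: pZ.
  by rewrite /= addNb; apply: parity_hvar; exact: IH.
apply: (subspace_sum_seq ps) => l ls; apply: pZ.
rewrite (perm_size (perm_to_rem ls)) /= addNb addbN negbK; exact: IH.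
Qed.

Lemma inVplus_subspace : subspace (inVplus K).
Proof.
split.
- apply/inVplusP => m; rewrite msupp0 in_fset0; by [].
- move=> u v hu hv; refine (proj1 (malgP _ _) _) => m.
  by rewrite theta_coef mcoeffD mulrDr -!theta_coef [theta K u]hu [theta K v]hv.
move=> a v hv; refine (proj1 (malgP _ _) _) => m.
by rewrite theta_coef mcoeffZ mulrCA -theta_coef [theta K v]hv.
Qed.

Lemma parity_inVplus v : parity false v -> inVplus K v.
Proof. by apply; [exact: inVplus_subspace|move=> s hs; apply: inVplus_mon; rewrite hs]. Qed.

Lemma inVplus_parity v : inVplus K v -> parity false v.
Proof.
move/inVplusP => hv S hS h; rewrite [v]malg_basis; apply: (subspace_sum_seq hS) => m mv.
have [_ _ SZ] := hS; apply: (SZ); rewrite -mon_mlist; apply: h.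
exact: negbTE (hv _ mv).
Qed.

Lemma inVplus_star u v : inVplus K u -> inVplus K v -> inVplus K (star K u v).
Proof.
move=> /inVplusP eu /inVplusP ev; rewrite starE.
have hS := inVplus_subspace; have [_ _ SZ] := hS.
apply: (subspace_sum_seq hS) => m mu; apply: (SZ).
apply: (subspace_sum_seq hS) => m' mv; apply: (SZ).
apply: (subspace_sum _ hS) => i _; apply: (SZ); apply: parity_inVplus.
have := @parity_Yt (mlist m) (wt (mlist m) + wt (mlist m') - i) (mlist m').
by rewrite (negbTE (eu _ mu)) (negbTE (ev _ mv)).
Qed.

End CharactersOfZhuAlgebra.

(** * Values of the point functionals in low degree *)

Section LowDegreeValues.
Variables (K : numFieldType) (G : nat -> nat -> K) (leg : bool -> nat -> K).
Hypothesis Gsym : forall k l, G k l = G l k.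
Local Notation corr := (corr G leg).
Local Notation s := (leg false).
Local Notation t := (leg true).

Lemma corr_nil e : corr e e [::] = 1.
Proof. by case: e => //; rewrite /corr /haf /= !big_cons !big_nil /= mul1r addr0. Qed.

Lemma corr00_pair a b : corr false false [:: a; b] = G a b.
Proof.
by rewrite (corr_cons leg Gsym) big_seq1 /= eqxx (corr_nil false) !addr0 mulr1.
Qed.

Lemma corr01_single a : corr false true [:: a] = s a.
Proof. by rewrite (corr_cons leg Gsym) big_nil (corr_nil false) !add0r mulr1. Qed.

Lemma corr11_pair a b : corr true true [:: a; b] = G a b + (t a * s b + t b * s a).
Proof.
rewrite (corr_true leg Gsym) big_cons big_seq1 corr00_pair addrC.
have -> : rem a [:: a; b] = [:: b] by rewrite /= eqxx.
have -> : rem b [:: a; b] = [:: a] by rewrite /= eqxx; case: eqP => [->|].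
by rewrite !corr01_single.
Qed.

Lemma corr00_quad a : corr false false [:: a; a; a; a] = 3 * G a a ^+ 2.
Proof.
rewrite (corr_cons leg Gsym) 2!big_cons big_seq1 /= !eqxx corr00_pair; ring.
Qed.

Lemma corr01_triple a : corr false true [:: a; a; a] = 3 * G a a * s a.
Proof.
rewrite (corr_cons leg Gsym) big_cons big_seq1 /= !eqxx corr00_pair corr01_single; ring.
Qed.

Lemma corr11_quad a :
  corr true true [:: a; a; a; a] = 3 * G a a ^+ 2 + 12 * G a a * s a * t a.
Proof.
rewrite (corr_true leg Gsym) 3!big_cons big_seq1 /= !eqxx corr00_quad corr01_triple; ring.
Qed.

Lemma gs_corr e u : gs G leg (legs e e) (mon K u) = corr e e u.
Proof. exact: gs_mon. Qed.

End LowDegreeValues.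

Section PointCharacters.
Variable K : numFieldType.

(* [Some false] and [Some true] are the lowest weights 1/16 and 9/16 of the twisted
   module, [None] is the vector [h(-1)1] of [M(1)^-]. *)
Definition point_char (i : option bool) : {linear M1 K -> K^o} :=
  match i with
  | None => gs (@flatG K) (@flat_leg K) (legs true true)
  | Some e => gs (GT K) (@twist_leg K) (legs e e)
  end.

Lemma point_char_zhu i : zhu_char (point_char i).
Proof. by case: i => [e|]; [apply: twisted_zhu_char|apply: flat_zhu_char]. Qed.

Lemma point_char_twisted e u :
  point_char (Some e) (mon K u) = corr (GT K) (@twist_leg K) e e u.
Proof. exact: (gs_corr _ (@GT_sym K)). Qed.

Lemma point_char_flat u :
  point_char None (mon K u) = corr (@flatG K) (@flat_leg K) true true u.
Proof. exact: (gs_corr _ (@flatG_sym K)). Qed.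

Lemma sT_values : [/\ sT K 0 = 1 / 2, sT K 1 = - (3 / 4), sT K 2 = 15 / 16 &
  [/\ sT K 4 = 315 / 256 & sT K 6 = 3003 / 2048]].
Proof.
have step m (a b : K) : sT K m = a -> - (m%:R + 3%:R / 2%:R) * a = m.+1%:R * b -> sT K m.+1 = b.
  have h1 : m.+1%:R != 0 :> K by rewrite pnatr_eq0.
  by move=> e e'; apply: (mulfI h1); rewrite sTS e.
have e0 : sT K 0 = 1 / 2 by rewrite /sT binc0; ring.
have e1 : sT K 1 = - (3 / 4) by apply: (step _ _ _ e0); field.
have e2 : sT K 2 = 15 / 16 by apply: (step _ _ _ e1); field.
have e3 : sT K 3 = - (35 / 32) by apply: (step _ _ _ e2); field.
have e4 : sT K 4 = 315 / 256 by apply: (step _ _ _ e3); field.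
have e5 : sT K 5 = - (693 / 512) by apply: (step _ _ _ e4); field.
have e6 : sT K 6 = 3003 / 2048 by apply: (step _ _ _ e5); field.
by [].
Qed.

Lemma tT_values : [/\ tT K 0 = 1, tT K 1 = - (1 / 2), tT K 2 = 3 / 8 &
  [/\ tT K 4 = 35 / 128 & tT K 6 = 231 / 1024]].
Proof.
have step m (a b : K) : tT K m = a -> - (m%:R + 2%:R^-1) * a = m.+1%:R * b -> tT K m.+1 = b.
  have h1 : m.+1%:R != 0 :> K by rewrite pnatr_eq0.
  by move=> e e'; apply: (mulfI h1); rewrite tTS e.
have e0 : tT K 0 = 1 by rewrite /tT binc0.
have e1 : tT K 1 = - (1 / 2) by apply: (step _ _ _ e0); field.
have e2 : tT K 2 = 3 / 8 by apply: (step _ _ _ e1); field.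
have e3 : tT K 3 = - (5 / 16) by apply: (step _ _ _ e2); field.
have e4 : tT K 4 = 35 / 128 by apply: (step _ _ _ e3); field.
have e5 : tT K 5 = - (63 / 256) by apply: (step _ _ _ e4); field.
have e6 : tT K 6 = 231 / 1024 by apply: (step _ _ _ e5); field.
by [].
Qed.

Lemma flat_leg_values : [/\ flat_leg K false 0 = 1, flat_leg K false 1 = - 2,
  flat_leg K false 2 = 3 & [/\ flat_leg K false 4 = 5 & flat_leg K false 6 = 7]].
Proof.
have step m (a b : K) : flat_leg K false m = a -> (- 2%:R - m%:R) * a = m.+1%:R * b ->
    flat_leg K false m.+1 = b.
  have h1 : m.+1%:R != 0 :> K by rewrite pnatr_eq0.
  by move=> e e'; apply: (mulfI h1); rewrite /= bincS -e'; congr (_ * _).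
have e0 : flat_leg K false 0 = 1 by rewrite /= binc0.
have e1 : flat_leg K false 1 = - 2 by apply: (step _ _ _ e0); ring.
have e2 : flat_leg K false 2 = 3 by apply: (step _ _ _ e1); ring.
have e3 : flat_leg K false 3 = - 4 by apply: (step _ _ _ e2); ring.
have e4 : flat_leg K false 4 = 5 by apply: (step _ _ _ e3); ring.
have e5 : flat_leg K false 5 = - 6 by apply: (step _ _ _ e4); ring.
have e6 : flat_leg K false 6 = 7 by apply: (step _ _ _ e5); ring.
by [].
Qed.

Definition pair_table (i : option bool) : K * K * K * K * K :=
  match i with
  | None => (2, 3, 5, 7, 0)
  | Some false => (1 / 8, 15 / 128, 105 / 1024, 3003 / (32 * 1024), 9 / 64)
  | Some true => (9 / 8, 159 / 128, 1505 / 1024, (7 * 7821) / (32 * 1024), 57 / 64)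
  end.

Local Notation mon := (mon K).

Lemma point_char_table i :
  (point_char i (mon [:: 0; 0]%N), point_char i (mon [:: 2; 0]%N), point_char i (mon [:: 4; 0]%N),
   point_char i (mon [:: 6; 0]%N), point_char i (mon [:: 1; 1]%N)) = pair_table i.
Proof.
have [s0 s1 s2 [s4 s6]] := sT_values.
have [t0 t1 t2 [t4 t6]] := tT_values.
have [f0 f1 f2 [f4 f6]] := flat_leg_values.
case: i => [[]|].
- rewrite !point_char_twisted !(corr11_pair _ (@GT_sym K)).
  rewrite /twist_leg /GT s0 s1 s2 s4 s6 t0 t1 t2 t4 t6 /pair_table.
  by congr (_, _, _, _, _); field.
- rewrite !point_char_twisted !(corr00_pair _ (@GT_sym K)).
  rewrite /GT s0 s1 s2 s4 s6 /pair_table.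
  by congr (_, _, _, _, _); field.
rewrite !point_char_flat !(corr11_pair _ (@flatG_sym K)).
rewrite f0 f1 f2 f4 f6 /flatG /flat_leg /pair_table /=.
by congr (_, _, _, _, _); ring.
Qed.

Lemma point_char_quad i : point_char i (mon [:: 0; 0; 0; 0]%N) =
  match i with None => 0 | Some false => 3 / 64 | Some true => 51 / 64 end.
Proof.
have [s0 _ _ _] := sT_values; have [t0 _ _ _] := tT_values.
case: i => [[]|].
- rewrite point_char_twisted (corr11_quad _ (@GT_sym K)) /twist_leg /GT s0 t0.
  by field.
- rewrite point_char_twisted (corr00_quad _ (@GT_sym K)) /GT s0.
  by field.
rewrite point_char_flat (corr11_quad _ (@flatG_sym K)) /flatG; ring.
Qed.

Lemma point_char_1 i : point_char i 1 = 1.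
Proof.
rewrite -mon_nil; case: i => [e|].
  by rewrite point_char_twisted corr_nil.
by rewrite point_char_flat corr_nil.
Qed.

End PointCharacters.

(** * Canonical representatives and the dual basis *)

Section CanonicalForms.
Variables (K : numFieldType) (A : comAlgType K) (w : A) (d : option bool -> A).

Lemma horner_alg_ind (P : A -> Prop) : P 0 -> P 1 -> (forall v, P v -> P (w * v)) ->
  (forall u v, P u -> P v -> P (u + v)) -> (forall (a : K) v, P v -> P (a *: v)) ->
  forall g, P (horner_alg w g).
Proof.
move=> P0 P1 Pw PD PZ; elim/poly_ind => [|g c IH]; first by rewrite rmorph0.
by rewrite rmorphD rmorphM /= horner_algX horner_algC mulrC; apply: PD; [apply: Pw|apply: PZ].
Qed.

Lemma linear_horner_alg (f : {linear A -> K^o}) c : f 1 = 1 -> (forall v, f (w * v) = c * f v) ->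
  forall g, f (horner_alg w g) = g.[c].
Proof.
move=> f1 fw; elim/poly_ind => [|g a IH]; first by rewrite rmorph0 linear0 horner0.
rewrite rmorphD rmorphM /= horner_algX horner_algC mulrC linearD linearZ fw IH f1 hornerMXaddC.
by congr (_ + _); [exact: mulrC|exact: mulr1].
Qed.

Definition canonical v := exists g c, v = horner_alg w g + \sum_i c i *: d i.

Lemma canonical_subspace : subspace canonical.
Proof.
split.
- by exists 0, (fun=> 0); rewrite rmorph0 add0r big1 // => i _; rewrite scale0r.
- move=> u v [g [c ->]] [g' [c' ->]]; exists (g + g'), (fun i => c i + c' i).
  rewrite rmorphD addrACA -big_split; congr (_ + _).
  by apply: eq_bigr => i _; rewrite scalerDl.
move=> a v [g [c ->]]; exists (a *: g), (fun i => a * c i).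
rewrite -mul_polyC rmorphM /= horner_algC mulr_algl scalerDr scaler_sumr; congr (_ + _).
by apply: eq_bigr => i _; rewrite scalerA.
Qed.

Lemma canonical_horner g : canonical (horner_alg w g).
Proof. by exists g, (fun=> 0); rewrite big1 ?addr0 // => i _; rewrite scale0r. Qed.

Lemma canonical_d i : canonical (d i).
Proof.
exists 0, (fun j => (j == i)%:R); rewrite rmorph0 add0r (bigD1 i) //= eqxx scale1r.
by rewrite big1 ?addr0 // => j /negPf ->; rewrite scale0r.
Qed.

Variable O : A -> Prop.
Hypothesis Os : subspace O.

Definition reducible v := exists z, canonical z /\ O (v - z).

Lemma reducible_canonical v : canonical v -> reducible v.
Proof. by exists v; rewrite subrr; case: Os. Qed.

Lemma reducible_O v : O v -> reducible v.
Proof. by exists 0; case: canonical_subspace => c0 _ _; rewrite subr0. Qed.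

Lemma reducible_subspace : subspace reducible.
Proof.
have [c0 cD cZ] := canonical_subspace; have [O0 OD OZ] := Os; split.
- exact: reducible_O.
- move=> u v [z [hz hO]] [z' [hz' hO']]; exists (z + z'); split; first exact: cD.
  by rewrite opprD addrACA; apply: OD.
move=> a v [z [hz hO]]; exists (a *: z); split; first exact: cZ.
by rewrite -scalerBr; apply: OZ.
Qed.
End CanonicalForms.

Section DualBasis.
Variable K : numFieldType.

(* The inverse of the matrix of the values of [point_char] on [e_m - e_0]. *)
Definition dual_coef (i : option bool) : K * K * K :=
  match i with
  | None => (3185, - 1488, 256)
  | Some false => (128 * - 2831, 128 * 1317, 128 * - 224)
  | Some true => (128 * - 401, 128 * 187, 128 * - 32)
  end.

(** The differences [e m - e 0] with [m] even are killed by every [ev t], because [h(-m-1)h(-1)1]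
    takes there the value [t^2] for all even [m]. *)
Definition dual_comb (V : lmodType K) (e : nat -> V) (i : option bool) : V :=
  let: (a, b, c) := dual_coef i in
  a *: (e 2%N - e 0%N) + b *: (e 4%N - e 0%N) + c *: (e 6%N - e 0%N).

Lemma linear_comb3 (V : lmodType K) (f : {linear V -> K^o}) a b c x y z :
  f (a *: x + b *: y + c *: z) = a * f x + b * f y + c * f z.
Proof. by rewrite !linearD !linearZ. Qed.

Lemma linear_dual_comb (V : lmodType K) (f : {linear V -> K^o}) (e : nat -> V) i :
  f (dual_comb e i) = let: (a, b, c) := dual_coef i in
  a * (f (e 2%N) - f (e 0%N)) + b * (f (e 4%N) - f (e 0%N)) + c * (f (e 6%N) - f (e 0%N)).
Proof. by rewrite /dual_comb; case: dual_coef => [[a b] c]; rewrite linear_comb3 !linearB. Qed.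

Lemma comb3A (A : comAlgType K) (a b c a' b' c' a'' b'' c'' p q r : K) (x y z : A) :
  p *: (a *: x + b *: y + c *: z) + q *: (a' *: x + b' *: y + c' *: z)
    + r *: (a'' *: x + b'' *: y + c'' *: z) =
  (p * a + q * a' + r * a'') *: x + (p * b + q * b' + r * b'') *: y
    + (p * c + q * c' + r * c'') *: z.
Proof. by rewrite !scale_in_alg; ring. Qed.

(** The coefficients are the values of the point functionals on [e m - e 0], as they must be for a
    dual basis. *)
Lemma dual_comb_inv (A : comAlgType K) (e : nat -> A) :
  [/\ e 2%N - e 0%N = 1 *: dual_comb e None + (- (1 / 128)) *: dual_comb e (Some false)
        + (15 / 128) *: dual_comb e (Some true),
      e 4%N - e 0%N = 3 *: dual_comb e None + (- (23 / 1024)) *: dual_comb e (Some false)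
        + (353 / 1024) *: dual_comb e (Some true) &
      e 6%N - e 0%N = 5 *: dual_comb e None + (- (1093 / (32 * 1024))) *: dual_comb e (Some false)
        + (3 * 5961 / (32 * 1024)) *: dual_comb e (Some true)].
Proof.
have u1 (x y z : A) a b c : a = 1 -> b = 0 -> c = 0 -> x = a *: x + b *: y + c *: z.
  by move=> -> -> ->; rewrite scale1r !scale0r !addr0.
have u2 (x y z : A) a b c : a = 0 -> b = 1 -> c = 0 -> y = a *: x + b *: y + c *: z.
  by move=> -> -> ->; rewrite scale1r !scale0r add0r addr0.
have u3 (x y z : A) a b c : a = 0 -> b = 0 -> c = 1 -> z = a *: x + b *: y + c *: z.
  by move=> -> -> ->; rewrite scale1r !scale0r !add0r.
rewrite /dual_comb /dual_coef; split; rewrite comb3A.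
- by apply: u1; field.
- by apply: u2; field.
by apply: u3; field.
Qed.

End DualBasis.

Section ZhuAlgebra.
Variable K : numFieldType.
Local Notation mon := (mon K).
Implicit Types (u v : M1 K).

Let e (m : nat) : M1 K := mon [:: m; 0%N].
Definition dual_vec : option bool -> M1 K := dual_comb e.

Lemma mon_pair a b : mon [:: a; b] = hvar K a * hvar K b.
Proof.
refine (etrans (mon_cons K a [:: b]) (congr1 ( *%R (hvar K a)) _)).
exact: (etrans (mon_cons K b [::]) (etrans (congr1 ( *%R (hvar K b)) (mon_nil K)) (mulr1 _))).
Qed.

Lemma omegaE : omega K = 2%:R^-1 *: e 0%N.
Proof. by rewrite /omega /e mon_pair. Qed.

Lemma omega_mul v : omega K * v = 2%:R^-1 *: (hvar K 0 * (hvar K 0 * v)).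
Proof.
have h (A : comAlgType K) (c : K) (x z : A) : (c *: (x * x)) * z = c *: (x * (x * z)).
  by rewrite -scalerAl mulrA.
exact: h.
Qed.

Lemma JvecE : Jvec K = mon [:: 0; 0; 0; 0]%N - 2%:R *: e 2%N + (3%:R / 2%:R) *: mon [:: 1; 1]%N.
Proof.
have h4 : mon [:: 0; 0; 0; 0]%N = hvar K 0 ^+ 4.
  rewrite (mon_cons _ 0) (mon_cons _ 0) mon_pair.
  have h (A : comAlgType K) (x : A) : x * (x * (x * x)) = x ^+ 4 by ring.
  exact: h.
by rewrite /Jvec /e h4 !mon_pair.
Qed.

Lemma dual_vec_point i j : point_char K i (dual_vec j) = (i == j)%:R.
Proof.
have := point_char_table K i; rewrite /dual_vec linear_dual_comb /e.
move: (point_char K i (mon [:: 0; 0]%N)) (point_char K i (mon [:: 2; 0]%N))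
  (point_char K i (mon [:: 4; 0]%N)) (point_char K i (mon [:: 6; 0]%N))
  (point_char K i (mon [:: 1; 1]%N)) => p0 p2 p4 p6 p1.
case: i => [[]|]; case: j => [[]|]; rewrite /pair_table /dual_coef => -[-> -> -> -> _] /=;
  by field.
Qed.

Lemma linear_regZ (V : lmodType K) (f : {linear V -> K^o}) (a : K) x : f (a *: x) = a * f x.
Proof. by rewrite linearZ. Qed.

Lemma point_char_omega i : point_char K i (omega K) = ptx K i.
Proof.
have := point_char_table K i; rewrite omegaE linear_regZ /e.
move: (point_char K i (mon [:: 0; 0]%N)) (point_char K i (mon [:: 2; 0]%N))
  (point_char K i (mon [:: 4; 0]%N)) (point_char K i (mon [:: 6; 0]%N))
  (point_char K i (mon [:: 1; 1]%N)) => p0 p2 p4 p6 p1.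
by case: i => [[]|]; rewrite /pair_table => -[-> _ _ _ _] /=; field.
Qed.

Lemma linear_J (V : lmodType K) (f : {linear V -> K^o}) (a b : K) x y z :
  f (x - a *: y + b *: z) = f x - a * f y + b * f z.
Proof. by rewrite linearD linearB !linearZ. Qed.

Lemma point_char_J i : point_char K i (Jvec K) = pty K i.
Proof.
have := point_char_table K i; have := point_char_quad K i.
rewrite JvecE linear_J /e.
move: (point_char K i (mon [:: 0; 0]%N)) (point_char K i (mon [:: 2; 0]%N))
  (point_char K i (mon [:: 4; 0]%N)) (point_char K i (mon [:: 6; 0]%N))
  (point_char K i (mon [:: 1; 1]%N)) => p0 p2 p4 p6 p1.
move: (point_char K i (mon [:: 0; 0; 0; 0]%N)) => p4'.
by case: i => [[]|]; rewrite /pair_table => -> [_ -> _ _ ->] /=; field.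
Qed.

Lemma binc_m1 m : binc (-1 : K) m = (-1) ^+ m.
Proof.
elim: m => [|m IH]; first by rewrite binc0.
have h1 : m.+1%:R != 0 :> K by rewrite pnatr_eq0.
by apply: (mulfI h1); rewrite bincS IH exprS -[m.+1]addn1 natrD; ring.
Qed.

Lemma ev_pair (t : K) a b : ev t (mon [:: a; b]) = t ^+ 2 * (-1) ^+ (a + b).
Proof. by rewrite ev_mon /evl big_cons big_seq1 !binc_m1 exprD; ring. Qed.

Lemma ev_omega_mul (t : K) v : ev t (omega K * v) = t ^+ 2 / 2 * ev t v.
Proof.
rewrite omega_mul linear_regZ; refine (etrans (congr1 _ (ev_hvar _ _ _)) _).
by rewrite ev_hvar binc0; ring.
Qed.

Lemma ev_1 (t : K) : ev t (1 : M1 K) = 1.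
Proof. by rewrite -mon_nil ev_mon /evl big_nil. Qed.

Lemma ev_J (t : K) : ev t (Jvec K) = t ^+ 4 - t ^+ 2 / 2.
Proof.
rewrite JvecE linear_J /e; refine (etrans (congr2 +%R (congr2 +%R (ev_mon _ _)
  (congr1 -%R (congr1 _ (ev_pair _ _ _)))) (congr1 _ (ev_pair _ _ _))) _).
by rewrite /evl 3!big_cons big_seq1 !binc0 !mulr1 sqrrN expr1n; field.
Qed.

Lemma ev_dual_vec (t : K) i : ev t (dual_vec i) = 0.
Proof.
rewrite /dual_vec linear_dual_comb /e; case: (dual_coef K i) => [[a b] c].
have h m n : ev t (mon [:: m.*2; 0%N]) - ev t (mon [:: n.*2; 0%N]) = 0.
  by rewrite !ev_pair !addn0 -!muln2 !exprM !sqrr_sign; apply: subrr.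
by rewrite (h 1%N 0%N) (h 2%N 0%N) (h 3%N 0%N) !mulr0 !addr0.
Qed.

Lemma inVplus_comb (a : K) u v : inVplus K u -> inVplus K v -> inVplus K (a *: u + v).
Proof. by case: (inVplus_subspace K) => _ hD hZ hu hv; apply: hD => //; apply: hZ. Qed.

Lemma inVplus_omega g : inVplus K (horner_alg (omega K) g).
Proof.
apply: parity_inVplus; have [p0 pD pZ] := parity_subspace K false.
apply: (@horner_alg_ind K (M1 K) (omega K) (parity false)); [exact: p0| | |exact: pD|exact: pZ].
  by have h := @parity_mon K [::]; rewrite mon_nil in h.
move=> v hv; rewrite omega_mul; apply: pZ.
exact: (@parity_hvar K true 0 _ (@parity_hvar K false 0 v hv)).
Qed.

Lemma inVplus_dual_vec i : inVplus K (dual_vec i).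
Proof.
have hS := inVplus_subspace K; have [_ hD hZ] := hS.
have he m : inVplus K (e m - e 0%N) by apply: (subspaceB hS); apply: inVplus_mon.
rewrite /dual_vec /dual_comb; case: (dual_coef K i) => [[a b] c].
by apply: (hD); [apply: (hD)|]; apply: (hZ); apply: (he).
Qed.

Lemma inVplus_J : inVplus K (Jvec K).
Proof.
have hS := inVplus_subspace K; have [_ hD hZ] := hS.
rewrite JvecE; apply: (hD); last by apply: (hZ); apply: inVplus_mon.
by apply: (subspaceB hS); [|apply: hZ]; apply: inVplus_mon.
Qed.

Lemma horner_alg_scaleX (A : comAlgType K) (w : A) a g :
  horner_alg w (a *: ('X * g)) = a *: (w * horner_alg w g).
Proof. by rewrite -mul_polyC !rmorphM /= horner_algX horner_algC mulr_algl. Qed.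

Lemma mon_even_power r : exists g, mon (nseq r.*2 0%N) = horner_alg (omega K) g.
Proof.
elim: r => [|r [g IH]]; first by exists 1; rewrite rmorph1; exact: mon_nil.
exists (2 *: ('X * g)); rewrite doubleS (mon_cons K 0 (0%N :: _)) (mon_cons K 0 (nseq _ _)).
rewrite horner_alg_scaleX omega_mul -IH scalerA mulfV; last by rewrite pnatr_eq0.
exact: esym (scale1r _).
Qed.

Local Notation S := (reducible (omega K) dual_vec (inO K)).

Lemma canonical_e : canonical (omega K) dual_vec (e 0%N) /\
  [/\ canonical (omega K) dual_vec (e 2%N), canonical (omega K) dual_vec (e 4%N) &
      canonical (omega K) dual_vec (e 6%N)].
Proof.
have [_ CD CZ] := @canonical_subspace K (M1 K) (omega K) dual_vec.
have h0 : canonical (omega K) dual_vec (e 0%N).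
  have [g hg] := mon_even_power 1.
  by rewrite /e -[[:: 0%N; 0%N]]/(nseq 1.*2 0%N) hg; apply: canonical_horner.
have hd m : canonical (omega K) dual_vec (e m - e 0%N) -> canonical (omega K) dual_vec (e m).
  by move=> h; rewrite -(subrK (e 0%N) (e m)); apply: (CD).
have hc a b c : canonical (omega K) dual_vec
    (a *: dual_vec None + b *: dual_vec (Some false) + c *: dual_vec (Some true)).
  by apply: (CD); [apply: (CD)|]; apply: (CZ); apply: canonical_d.
have [e2 e4 e6] := @dual_comb_inv K (M1 K) e.
split=> //; split; apply: hd; [rewrite e2|rewrite e4|rewrite e6]; exact: hc.
Qed.

Lemma inVplus_reducible v : inVplus K v -> S v.
Proof.
have Os := inO_subspace K.
have Ss := @reducible_subspace K (M1 K) (omega K) dual_vec (inO K) Os.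
have RC := @reducible_canonical K (M1 K) (omega K) dual_vec (inO K) Os.
have RO := @reducible_O K (M1 K) (omega K) dual_vec (inO K).
have [_ [h2 h4 h6]] := canonical_e.
move/inVplus_parity; apply; first exact: Ss.
move=> s hs; have es : ~~ odd (size s) by rewrite hs.
apply: (@span_mon_even K (M1 K) mon S (@mon_perm K) Ss _ _ (RC _ h2) (RC _ h4) (RC _ h6) s es).
  by move=> i j s0 hs0; apply: RO; exact: (inO_quad K i j hs0).
move=> r; apply: RC; have [g ->] := mon_even_power r; exact: canonical_horner.
Qed.

End ZhuAlgebra.

(** * The presentation of Zhu's algebra of M(1)^+ *)

Section Presentation.
Variable K : numFieldType.
Implicit Types (u v : M1 K) (f g : Pol K).

Definition on_curve : {rmorphism Pol K -> {poly K}} :=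
  peval (@polyC K) 'X (4%:R *: 'X^2 - 'X).

Definition at_point (i : option bool) : {rmorphism Pol K -> K} :=
  peval (GRing.RMorphism.clone _ _ idfun _) (ptx K i) (pty K i).

Lemma malgC_in_alg c : c%:MP = in_alg (Pol K) c.
Proof. exact: esym (etrans (esym (mul_malgC c 1)) (mulr1 _)). Qed.

Lemma in_idealPQ_iff f :
  in_idealPQ K f <-> on_curve f = 0 /\ forall i, at_point i f = 0.
Proof.
have := @ideal_characterization K (Pol K) (px K) (py K) (@pol_ind K) on_curve at_point
  (@pevalZ K _ _ _ _) (@pevalX K _ _ _ _) (@pevalY K _ _ _ _)
  (fun i => @pevalZ K _ _ _ _) (fun i => @pevalX K _ _ _ _) (fun i => @pevalY K _ _ _ _) f.
by rewrite /in_idealPQ /Defs.polyP /Defs.polyQ !malgC_in_alg.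
Qed.

Lemma zhu_presentation :
  (exists Phi : Pol K -> M1 K,
     [/\ (forall f, inVplus K (Phi f)),
         (forall (a : K) f g, inO K (Phi (a *: f + g) - (a *: Phi f + Phi g))),
         [/\ inO K (Phi 1 - 1), inO K (Phi (px K) - omega K) & inO K (Phi (py K) - Jvec K)],
         (forall f g, inO K (Phi (f * g) - star K (Phi f) (Phi g))) /\
         (forall f, inO K (Phi f) <-> in_idealPQ K f) &
         (forall v, inVplus K v -> exists f, inO K (v - Phi f))])
  /\ (forall u v : M1 K, inVplus K u -> inVplus K v -> inO K (star K u v - star K v u)).
Proof.
pose ev' (t : K) (v : M1 K) : K := ev t v.
pose phi' (i : option bool) (v : M1 K) : K := point_char K i v.
have h1 t a u v : ev' t (a *: u + v) = a * ev' t u + ev' t v by exact: ev_linear.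
have h2 i a u v : phi' i (a *: u + v) = a * phi' i u + phi' i v by exact: linearP.
have h3 t v : inO K v -> ev' t v = 0 by apply: zhu_char_inO; apply: ev_zhu_char.
have h4 i v : inO K v -> phi' i v = 0 by apply: zhu_char_inO; apply: point_char_zhu.
have h5 t u v : inVplus K u -> inVplus K v -> ev' t (star K u v) = ev' t u * ev' t v.
  by apply: zhu_char_star; apply: ev_zhu_char.
have h6 i u v : inVplus K u -> inVplus K v -> phi' i (star K u v) = phi' i u * phi' i v.
  by apply: zhu_char_star; apply: point_char_zhu.
have h7 t q : ev' t (horner_alg (omega K) q) = q.[t ^+ 2 / 2].
  by apply: (@linear_horner_alg K (M1 K) (omega K) (ev t)); [exact: ev_1|exact: ev_omega_mul].
have h8 v : inVplus K v -> exists q c,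
    inO K (v - (horner_alg (omega K) q + \sum_i c i *: dual_vec K i)).
  by move=> hv; have [z [[q [c ->]] hO]] := inVplus_reducible hv; exists q, c.
have h9 := @curve_points_interpolation K (Pol K) (px K) (py K) on_curve at_point
  (@pevalZ K _ _ _ _) (@pevalX K _ _ _ _) (@pevalY K _ _ _ _)
  (fun i => @pevalZ K _ _ _ _) (fun i => @pevalX K _ _ _ _) (fun i => @pevalY K _ _ _ _).
have [H1 H2] := @presentation K (M1 K) (Pol K) (inVplus K) (inO K) (star K) ev' phi'
  (@dual_vec K) (omega K) (Jvec K) h1 h2 h3 h4 (@inVplus_comb K) (@inVplus_star K) h5 h6
  (@inVplus_dual_vec K) (@ev_dual_vec K) (@dual_vec_point K) (@inVplus_omega K) (@inVplus_J K)
  h7 (@ev_J K) (@point_char_1 K) (@point_char_omega K) (@point_char_J K) h8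
  (px K) (py K) on_curve at_point (@pevalZ K _ _ _ _) (@pevalX K _ _ _ _) (@pevalY K _ _ _ _)
  (fun i => @pevalZ K _ _ _ _) (fun i => @pevalX K _ _ _ _) (fun i => @pevalY K _ _ _ _)
  h9 (in_idealPQ K) in_idealPQ_iff.
by split=> //; exists (lift phi' (@dual_vec K) (omega K) on_curve at_point).
Qed.
End Presentation.

Theorem theorem4p4 (R : realType) :
  (exists Phi : Pol R[i] -> M1 R[i],
     [/\ (forall f, inVplus R[i] (Phi f)),
         (forall (a : R[i]) f g, inO R[i] (Phi (a *: f + g) - (a *: Phi f + Phi g))),
         [/\ inO R[i] (Phi 1 - 1), inO R[i] (Phi (px R[i]) - omega R[i]) & inO R[i] (Phi (py R[i]) - Jvec R[i])],
         (forall f g, inO R[i] (Phi (f * g) - star R[i] (Phi f) (Phi g))) /\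
         (forall f, inO R[i] (Phi f) <-> in_idealPQ R[i] f) &
         (forall v, inVplus R[i] v -> exists f, inO R[i] (v - Phi f))])
  /\ (forall u v : M1 R[i], inVplus R[i] u -> inVplus R[i] v -> inO R[i] (star R[i] u v - star R[i] v u)).
Proof. exact: (zhu_presentation R[i]). Qed.
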